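(* Let $a,b:\mathbb{Z}\to(0,+\infty)$ satisfy $a(j)\,b(j+1)=1$ for all $j\in\mathbb{Z}$, and let $\mathbf{P}^{00}$ be the law on $\mathscr{U}$ of the bridge, from and to $0$ on $[0,1]$, of the continuous-time random walk on $\mathbb{Z}$ which jumps from $j$ to $j+1$ at rate $a(j)$ and from $j$ to $j-1$ at rate $b(j)$. Put $\Xi(j):=a(j)+b(j)$ and suppose that there exists $\kappa>0$ such that $|\Xi(j+1)-\Xi(j)|\le\kappa$ for all $j\in\mathbb{Z}$. Let $P^{00}$ be the law on $\mathscr{U}$ of the bridge, from and to $0$ on $[0,1]$, of the continuous-time random walk on $\mathbb{Z}$ with unit jump rates up and down. Then $$d_{W,1}(\mathbf{P}^{00},P^{00})\le9\left(2\cdot\frac{e^\kappa-1-\kappa}{\kappa^2}-1\right).$$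
   Context: The bridge of a walk with law $\mathbf{P}$ on $\mathbb{D}([0,1];\mathbb{Z})$ is $\mathbf{P}(\cdot\mid X_0=0,X_1=0)$. $\mathscr{U}$ is the set of pairs $U=(U^+,U^-)$ of finite disjoint subsets of $(0,1)$ with $|U^+|=|U^-|$. Piecewise constant càdlàg paths on $[0,1]$ from $0$ to $0$ with jumps $\pm1$ are in bijection with $\mathscr{U}$ by sending a path to ($U^+$ = set of times of $+1$ jumps, $U^-$ = set of times of $-1$ jumps). $\mathscr{U}$ carries the transported $\sigma$-algebra, and bridge laws are identified with their push-forward to $\mathscr{U}$. Let $\mathscr{A}=(0,1)^2\setminus\{(u,u):u\in(0,1)\}$. For $(r,s)\in\mathscr{A}$ define $\Psi_{r,s}U=(U^+\cup\{r\},U^-\cup\{s\})$ if $r\notin U^+$, $s\notin U^-$; $\Psi_{r,s}U=(U^+\setminus\{r\},U^-\setminus\{s\})$ if $r\in U^+$, $s\in U^-$; and $\Psi_{r,s}U=U$ otherwise (also $\Psi_{r,s}U=U$ if the first rule would give a pair not in $\mathscr{U}$; for each $U$ this concerns only a Lebesgue-null set of $(r,s)$). $d$ is the graph distance on $\mathscr{U}$ with $U\ne V$ neighbours iff $U=\Psi_{r,s}V$ for some $(r,s)\in\mathscr{A}$. $\mathrm{Lip}_1(\mathscr{U})$ is the set of measurable $f:\mathscr{U}\to\mathbb{R}$ with $|f(U)-f(V)|\le d(U,V)$, and $d_{W,1}(\mu,\nu)=\sup\{|\int f\,d\mu-\int f\,d\nu|:f\in\mathrm{Lip}_1(\mathscr{U}),\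 f\ \mu\text{- and }\nu\text{-integrable}\}$. *)

(* Defs.v *)
From HB Require Import structures.
From mathcomp Require Import all_boot all_order all_algebra finmap.
From mathcomp Require Import all_classical all_reals all_analysis.

Set Implicit Arguments.
Unset Strict Implicit.
Unset Printing Implicit Defensive.

Import Order.TTheory GRing.Theory Num.Theory.
Import numFieldNormedType.Exports.

Local Open Scope classical_set_scope.
Local Open Scope ring_scope.

(* Càdlàg Z-valued paths on [0,1]. Paths are represented by total functions
   on R whose values outside [0,1] are unconstrained: they are invisible to the
   sigma-algebra below. Since Z is discrete, a limit at t is an eventual value. *)
Definition is_cadlag (R : realType) (x : R -> int) : Prop :=
  (forall t, 0 <= t < 1 -> \forall s \near t^'+, x s = x t) /\
  (forall t, 0 < t <= 1 -> exists l : int, \forall s \near t^'-, x s = l).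

Record cadlag (R : realType) :=
  Cadlag { cadlag_fun :> R -> int; cadlagP : is_cadlag cadlag_fun }.

Lemma cadlag0_subproof (R : realType) : is_cadlag (fun _ : R => 0 : int).
Proof.
split=> t _; first by near=> s.
by exists 0; near=> s.
Unshelve. all: by end_near. Qed.

HB.instance Definition _ (R : realType) := gen_eqMixin (cadlag R).
HB.instance Definition _ (R : realType) := gen_choiceMixin (cadlag R).
HB.instance Definition _ (R : realType) :=
  isPointed.Build (cadlag R) (Cadlag (@cadlag0_subproof R)).

(* The Borel sigma-algebra of the Skorokhod topology is generated by the
   evaluations x |-> x t, t in [0,1]. *)
Definition cadlag_cylinder (R : realType) : set (set (cadlag R)) :=
  [set A | exists (t : R) (k : int), 0 <= t <= 1 /\
    A = [set x : cadlag R | x t = k]].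

HB.instance Definition _ (R : realType) :=
  Measurable.copy (cadlag R) (g_sigma_algebraType (@cadlag_cylinder R)).

Section PairSpace.
Local Open Scope fset_scope.

Definition is_jump_pair (R : realType) (U : {fset R} * {fset R}) : bool :=
  [&& all (fun u => 0 < u < 1) U.1, all (fun u => 0 < u < 1) U.2,
      fdisjoint U.1 U.2 & #|` U.1| == #|` U.2| ].

Record jump_pair (R : realType) :=
  JumpPair { jump_times :> {fset R} * {fset R}; _ : is_jump_pair jump_times }.

HB.instance Definition _ (R : realType) := [isSub for @jump_times R].
HB.instance Definition _ (R : realType) := [Choice of jump_pair R by <:].

Definition up_jumps (R : realType) (U : jump_pair R) : {fset R} :=
  (jump_times U).1.
Definition down_jumps (R : realType) (U : jump_pair R) : {fset R} :=
  (jump_times U).2.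

Lemma jump_pair0_subproof (R : realType) : @is_jump_pair R (fset0, fset0).
Proof. by apply/and4P; split; rewrite ?fdisjoint0X ?eqxx//; apply/allP. Qed.

HB.instance Definition _ (R : realType) :=
  isPointed.Build (jump_pair R) (JumpPair (@jump_pair0_subproof R)).

Definition path_fun (R : realType) (U : jump_pair R) (t : R) : int :=
  #|` [fset u in up_jumps U | u <= t]|%:Z
  - #|` [fset u in down_jumps U | u <= t]|%:Z.

Lemma path_fun_cadlag (R : realType) (U : jump_pair R) : is_cadlag (path_fun U).
Proof.
have nearA (F : set_system R) (FF : Filter F) (A : {fset R}) (P : R -> R -> Prop) :
    (forall u, \forall s \near F, P u s) ->
    \forall s \near F, forall u, u \in A -> P u s.
  move=> H; have /= : \forall s \near F, forall u, u \in enum_fset A -> P u s.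
    elim: (enum_fset A) => [|v l IH]; first by near=> s.
    near=> s; move=> u; rewrite inE => /orP[/eqP ->|]; first by near: s.
    by move: u; near: s.
  by [].
have eqA (A : {fset R}) (p q : R -> bool) : (forall u, u \in A -> p u = q u) ->
    [fset u in A | p u] = [fset u in A | q u].
  by move=> H; apply/fsetP => u; rewrite !inE /=; apply: andb_id2l => /H.
have cardB (A A' B B' : {fset R}) : A = A' -> B = B' ->
    #|` A|%:Z - #|` B|%:Z = #|` A'|%:Z - #|` B'|%:Z by move=> -> ->.
split=> t _.
- have H (A : {fset R}) : \forall s \near t^'+, forall u, u \in A ->
      (u <= s) = (u <= t).
    apply: nearA => u; have [ut|tu] := leP u t.
      by near=> s; rewrite (le_trans ut).
    by near=> s; apply/negbTE; rewrite -ltNge; near: s; exact: nbhs_right_lt.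
  near=> s; rewrite /path_fun; apply: cardB; apply: eqA.
    by near: s; exact: H.
  by near: s; exact: H.
- have H (A : {fset R}) : \forall s \near t^'-, forall u, u \in A ->
      (u <= s) = (u < t).
    apply: nearA => u; have [ut|tu] := ltP u t.
      by near=> s; apply/ltW; near: s; exact: nbhs_left_gt.
    near=> s; apply/negbTE; rewrite -ltNge; apply: lt_le_trans tu.
    by near: s; exact: nbhs_left_lt.
  exists (#|` [fset u in up_jumps U | u < t]|%:Z
          - #|` [fset u in down_jumps U | u < t]|%:Z).
  near=> s; rewrite /path_fun; apply: cardB; apply: eqA.
    by near: s; exact: H.
  by near: s; exact: H.
Unshelve. all: by end_near. Qed.

Definition path_of (R : realType) (U : jump_pair R) : cadlag R :=
  Cadlag (path_fun_cadlag U).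

(* The sigma-algebra transported from D([0,1]; Z): path_of is a bijection onto
   the step paths from 0 to 0 with jumps +1 and -1 located in (0,1). *)
HB.instance Definition _ (R : realType) :=
  Measurable.copy (jump_pair R) (g_sigma_algebra_preimageType (@path_of R)).

(* insubd U p is p if p is the pair of jump times of some element of the
   space, and U otherwise. *)
Definition Psi (R : realType) (r s : R) (U : jump_pair R) : jump_pair R :=
  if (r \notin up_jumps U) && (s \notin down_jumps U) then
    insubd U (r |` up_jumps U, s |` down_jumps U)
  else if (r \in up_jumps U) && (s \in down_jumps U) then
    insubd U (up_jumps U `\ r, down_jumps U `\ s)
  else U.

End PairSpace.

Definition neighbour (R : realType) : rel (jump_pair R) := fun U V =>
  (U != V) && `[< exists r s : R, [/\ 0 < r < 1, 0 < s < 1, r != s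
                                   & U = Psi r s V] >].

Definition graph_dist (R : realType) (U V : jump_pair R) : \bar R :=
  ereal_inf [set (size p)%:R%:E | p in
    [set p : seq (jump_pair R) | path (@neighbour R) U p /\ last U p = V]].

Definition Lip1 (R : realType) : set (jump_pair R -> R) :=
  [set f : jump_pair R -> R | measurable_fun setT f /\
    forall U V, (`|f U - f V|%:E <= graph_dist U V)%E].

Definition dW1 (R : realType) (mu nu : probability (jump_pair R) R) : \bar R :=
  ereal_sup [set `|\int[mu]_U (f U)%:E - \int[nu]_U (f U)%:E|%E | f in
    [set f : jump_pair R -> R | [/\ Lip1 f, mu.-integrable setT (EFin \o f)
                      & nu.-integrable setT (EFin \o f)]]].

Definition jump_rate (R : realType) (a b : int -> R) (i j : int) : R :=
  if j == i + 1 then a i else if j == i - 1 then b i else 0.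

(* The usual construction of the walk which jumps from j to j + 1 at rate a j
   and from j to j - 1 at rate b j, by its jump chain Y and holding times S:
   Y is a Markov chain with transition probabilities
   jump_rate i j / (a i + b i) and, given Y, the S k are independent,
   exponential with rate a (Y k) + b (Y k).
   The law of the initial state Y 0 is arbitrary. *)
Definition is_jump_hold (R : realType) (a b : int -> R) (d : measure_display)
    (T : measurableType d) (P : probability T R)
    (Y : nat -> T -> int) (S : nat -> T -> R) : Prop :=
  [/\ forall n i, measurable (Y n @^-1` [set i]),
      forall n, measurable_fun setT (S n) &
      forall (n : nat) (i : nat -> int) (B : nat -> set R),
        (forall k, measurable (B k)) ->
        P [set w | (forall k, (k <= n)%N -> Y k w = i k) /\
                   (forall k, (k < n)%N -> B k (S k w))] =
        (P (Y 0%N @^-1` [set i 0%N]) *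
         \prod_(k < n)
           ((jump_rate a b (i k) (i k.+1) / (a (i k) + b (i k)))%:E *
            exponential_prob (a (i k) + b (i k)) (B k)))%E].

(* X is a version of the walk: it is equal to Y n between the n-th and the
   (n+1)-st jump times. What X does after a possible explosion is irrelevant
   whenever explosion before time 1 has probability zero, as is the case when
   a + b grows at most linearly. *)
Definition is_walk_law (R : realType) (a b : int -> R)
    (law : probability (cadlag R) R) : Prop :=
  exists (d : measure_display) (T : measurableType d) (P : probability T R)
         (Y : nat -> T -> int) (S : nat -> T -> R) (X : {RV P >-> cadlag R}),
  [/\ is_jump_hold a b P Y S,
      {ae P, forall w, forall (n : nat) (t : R), 0 <= t <= 1 ->
        \sum_(k < n) S k w <= t < \sum_(k < n.+1) S k w -> X w t = Y n w} &
      forall A, measurable A -> law A = distribution P X A].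

(* mu is the law law( . | X_0 = 0, X_1 = 0), carried over to the space of jump
   times. The equation at A = setT forces the conditioning event to have
   positive probability, as mu is a probability. *)
Definition is_bridge_law (R : realType) (law : probability (cadlag R) R)
    (mu : probability (jump_pair R) R) : Prop :=
  let E := [set x : cadlag R | x 0 = 0 /\ x 1 = 0] in
  forall A : set (cadlag R), measurable A ->
    mu (@path_of R @^-1` A) = (law (A `&` E) * ((fine (law E))^-1)%:E)%E.

(* Main.v *)
From HB Require Import structures.
Require Import Defs.
From mathcomp Require Import all_boot all_order all_algebra finmap.
From mathcomp Require Import all_classical all_reals all_analysis.
From mathcomp Require Import measure lebesgue_measure measurable_realfun.
From mathcomp Require Import ring lra zify.
Import Order.TTheory GRing.Theory Num.Theory.
Import numFieldNormedType.Exports.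
Set Implicit Arguments.
Unset Strict Implicit.
Unset Printing Implicit Defensive.
Local Open Scope classical_set_scope.
Local Open Scope ring_scope.

(** Why the theorem holds.  Since a (j) b (j + 1) = 1, there is a positive
    function phi with a (j) = phi (j + 1) / phi (j) and
    b (j + 1) = phi (j) / phi (j + 1), so the product of the jump rates along a
    closed path is 1.  The bridge therefore sees the rates only through the
    holding times: with v (j) = Xi (j) - Xi (0), the jump times of a bridge with
    n up jumps and n down jumps have a density proportional to the exponential
    of minus the integral of v along the path.  [path_measure v] is this
    unnormalized measure on pairs of jump times, and [bridge_path_measure] says
    that it is a positive multiple of the bridge.  The simple walk has v = 0.

    Removing one up jump and one down jump is a step of the graph.  Hence a
    1-Lipschitz f satisfies |f U - f 0| <= N (U), where 0 is the empty pair and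
    N counts the up jumps ([lip_le_n_jump]), and it remains to compare the
    masses z_n of the levels N = n.  Inserting an up jump at r and a down jump
    at s shifts the path by one unit between r and s, so it changes the weight
    by a factor of at most exp (kappa |r - s|).  Each path of level n + 1 arises
    from (n + 1)^2 such insertions (the Mecke formula, [fk_insert_up]), and
    therefore (n + 1)^2 z_(n+1) <= (1 + eps) z_n, where 1 + eps is the double
    integral of exp (kappa |r - s|) over the unit square ([level_massS_le]).
    The bound to be proved is exactly 9 eps.  For v = 0 the recursion is an
    equality without the factor 1 + eps, and z_n = 1 / (n!)^2.

    If eps > 1/4, the mean of N is at most 1 + eps under the first bridge and
    at most 1 under the second one, and 2 + eps <= 9 eps.

    If eps <= 1/4, let c be the mean of f under the second bridge and g = f - c,
    so that |g| <= N + 1.  The potential theta (j) = - kappa |j| ([cone])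
    satisfies |v| <= - theta.  Writing M^v for [path_measure v], this gives
    M^v <= M^theta and, by convexity of the exponential,
    2 M^0 <= M^v + M^theta.  As M^0 integrates g to 0, these two inequalities
    yield |int g dM^v| <= int |g| dM^theta - int |g| dM^0, which is at most the
    sum over n of (n + 1) (y_n - 1 / (n!)^2), y_n being the level masses of
    theta.  The recursion bounds y_n by (1 + eps)^n / (n!)^2, and the n-th term
    of the sum by 9 eps / 2^n for n >= 1, while the term n = 0 vanishes
    ([level_mass_gap]).  Finally M^v has total mass at least 1, the mass of the
    empty pair, so dividing by it preserves the bound 9 eps. *)

(** * Lebesgue measure on tuples *)

Section lebn.
Context {R : realType}.
Local Notation mR := (measurableTypeR R).
Local Notation mu := (@lebesgue_measure R).
Definition tcons n (p : mR * n.-tuple mR) : n.+1.-tuple mR := [tuple of p.1 :: p.2].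
Definition tuncons n (t : n.+1.-tuple mR) : mR * n.-tuple mR := (thead t, [tuple of behead t]).

Lemma measurable_tcons n : measurable_fun setT (@tcons n).
Proof. exact: measurable_cons. Qed.

Lemma measurable_tuncons n : measurable_fun setT (@tuncons n).
Proof.
apply: measurable_fun_pair; last exact: measurable_behead.
exact: (measurable_tnth ord0).
Qed.

Lemma tconsK n : cancel (@tcons n) (@tuncons n).
Proof. by case=> x t; rewrite /tuncons /tcons/= theadE; congr pair; exact/val_inj. Qed.

Section cons_measure.
Variables (n : nat) (m : {sigma_finite_measure set (n.-tuple mR) -> \bar R}).
HB.instance Definition _ := isMeasurableFun.Build _ _ _ _ _ (@measurable_tcons n).
Definition lebcons : set (n.+1.-tuple mR) -> \bar R := pushforward (mu \x m)%E (@tcons n).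
Let lebcons0 : lebcons set0 = 0%E.
Proof. exact: measure0. Qed.
Let lebcons_ge0 A : (0 <= lebcons A)%E.
Proof. exact: measure_ge0. Qed.
Let lebcons_sigma_additive : semi_sigma_additive lebcons.
Proof. 
exact: (@measure_semi_sigma_additive _ _ _ (pushforward (mu \x m)%E (@tcons n))).
Qed.
HB.instance Definition _ := isMeasure.Build _ _ _ lebcons lebcons0 lebcons_ge0 lebcons_sigma_additive.

Let lebcons_sigma_finite : sigma_finite setT lebcons.
Proof.
have /sigma_finiteP[F [FT ndF Foo]] := sigma_finiteT mu.
have /sigma_finiteP[G [GT ndG Goo]] := sigma_finiteT m.
have FGT : setT = \bigcup_k (F k `*` G k).
  apply/esym; rewrite -subTset => -[x t] _.
  have [i _ Fx] : (\bigcup_i F i) x by rewrite -FT.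
  have [j _ Gt] : (\bigcup_i G i) t by rewrite -GT.
  exists (maxn i j) => //; split => /=.
    by move: x Fx; exact/subsetPset/ndF/leq_maxl.
  by move: t Gt; exact/subsetPset/ndG/leq_maxr.
exists (fun k => (@tuncons n) @^-1` (F k `*` G k)).
  by rewrite -preimage_bigcup -FGT preimage_setT.
move=> k; have [mF muF] := Foo k; have [mG muG] := Goo k; split.
  by rewrite -[X in measurable X]setTI; apply: measurable_tuncons => //; exact: measurableX.
rewrite /lebcons /pushforward -comp_preimage (_ : _ \o _ = id).
  by rewrite preimage_id product_measure1E// lte_mul_pinfty// ge0_fin_numE.
by apply/funext => p /=; rewrite tconsK.
Qed.
HB.instance Definition _ := Measure_isSigmaFinite.Build _ _ _ lebcons lebcons_sigma_finite.
End cons_measure.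

(** Built by prepending one coordinate at a time, so that integrals over it
    unfold into iterated one-dimensional integrals. *)
Fixpoint lebn n : {sigma_finite_measure set (n.-tuple mR) -> \bar R} :=
  match n with
  | 0 => \d_([tuple] : 0.-tuple mR)
  | n.+1 => lebcons (lebn n)
  end.

Lemma integral_lebn0 (f : 0.-tuple mR -> \bar R) : measurable_fun [set: 0.-tuple mR] f ->
  (\int[lebn 0]_t f t = f [tuple])%E.
Proof. by move=> mf; rewrite /= integral_dirac// diracT mul1e. Qed.

(** The order with the head outside is the recursion of the Feynman-Kac masses;
    the other order, below, integrates the head out first. *)
Lemma integral_lebnS n (f : n.+1.-tuple mR -> \bar R) : measurable_fun [set: n.+1.-tuple mR] f ->
  (forall t, 0 <= f t)%E ->
  (\int[lebn n.+1]_t f t = \int[mu]_s \int[lebn n]_t f (tcons (s, t)))%E.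
Proof.
move=> mf f0; transitivity (\int[pushforward (mu \x lebn n) (@tcons n)]_t f t)%E.
  by [].
rewrite (ge0_integral_pushforward (@measurable_tcons n))//=.
rewrite preimage_setT.
by rewrite fubini_tonelli1//; exact: (measurableT_comp mf (@measurable_tcons n)).
Qed.

Lemma integral_lebnS' n (f : n.+1.-tuple mR -> \bar R) : measurable_fun [set: n.+1.-tuple mR] f ->
  (forall t, 0 <= f t)%E ->
  (\int[lebn n.+1]_t f t = \int[lebn n]_t \int[mu]_s f (tcons (s, t)))%E.
Proof.
move=> mf f0; transitivity (\int[pushforward (mu \x lebn n) (@tcons n)]_t f t)%E.
  by [].
rewrite (ge0_integral_pushforward (@measurable_tcons n))//=.
rewrite preimage_setT.
by rewrite fubini_tonelli2//; exact: (measurableT_comp mf (@measurable_tcons n)).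
Qed.
End lebn.

(** * Densities on tuples *)

Section tuple_unique.
Context {R : realType}.
Local Notation mR := (measurableTypeR R).
Variable n : nat.
Definition box (B : nat -> set mR) : set (n.-tuple mR) :=
  [set t | forall k : 'I_n, B k (tnth t k)].

Lemma measurable_box B : (forall k, measurable (B k)) -> measurable (box B).
Proof.
move=> mB.
rewrite (_ : box B = \bigcap_(k in [set: 'I_n]) ((fun t : n.-tuple mR => tnth t k) @^-1` B k)).
  apply: fin_bigcap_measurable => //.
  by move=> k _; rewrite -[X in measurable X]setTI; exact: measurable_tnth.
by apply/seteqP; split=> [t tB k _|t tB k]; exact: tB.
Qed.

Lemma measurable_tuple_box : @measurable _ (n.-tuple mR) =
  <<s [set box B | B in [set B | forall k, measurable (B k)]] >>.
Proof.
apply/seteqP; split=> A.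
  apply: smallest_sub; first exact: smallest_sigma_algebra.
  rewrite -bigcup_seq => X [/= k _ [B mB <-]].
  apply: sub_sigma_algebra; exists (fun j => if j == k :> nat then B else setT).
    by move=> j /=; case: ifP.
  apply/seteqP; split=> [t tB|t [_ tB] j].
    by split=> //; have := tB k; rewrite eqxx.
  by case: ifPn => // /eqP/val_inj ->.
apply: smallest_sub; first exact: sigma_algebra_measurable.
by move=> X [B mB <-]; exact: measurable_box.
Qed.

(** Boxes are stable under intersection and generate the sigma-algebra. *)
Lemma tuple_measure_unique (m1 m2 : {measure set (n.-tuple mR) -> \bar R}) :
  (m1 setT < +oo)%E ->
  (forall B, (forall k, measurable (B k)) -> m1 (box B) = m2 (box B)) ->
  forall A, measurable A -> m1 A = m2 A.
Proof.
move=> m1oo m12.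
have boxT : box (fun=> setT) = setT by apply/seteqP; split.
apply: (measure_unique _ (fun=> setT) measurable_tuple_box).
- move=> _ _ [B mB <-] [C mC <-]; exists (fun k => B k `&` C k).
    by move=> k; exact: measurableI.
  apply/seteqP; split=> [t tBC|t [tB tC] k]; last by split; [exact: tB|exact: tC].
  by split=> k; have [] := tBC k.
- by move=> _; exists (fun=> setT).
- by rewrite bigcup_const.
- by move=> _ [B mB <-]; exact: m12.
- by [].
Qed.
End tuple_unique.

Section density.
Context d (T : measurableType d) (R : realType).
Variables (m : {measure set T -> \bar R}) (h : T -> \bar R).
Hypotheses (mh : measurable_fun setT h) (h0 : forall x, (0 <= h x)%E).

Definition density_of (A : set T) : \bar R := (\int[m]_(x in A) h x)%E.
Let density0 : density_of set0 = 0%E.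
Proof. by rewrite /density_of integral_set0. Qed.
Let density_ge0 A : (0 <= density_of A)%E.
Proof. by apply: integral_ge0. Qed.
Let density_sigma_additive : semi_sigma_additive density_of.
Proof.
move=> /= F mF tF mUF; rewrite /density_of; apply: cvg_toP.
  apply: ereal_nondecreasing_is_cvgn => i j ij.
  by apply: lee_sum_nneg_natr => // k _ _; exact: integral_ge0.
by rewrite ge0_integral_bigcup//=; exact: measurable_funTS.
Qed.
Definition density_mixin := isMeasure.Build _ _ _ density_of density0 density_ge0 density_sigma_additive.
(** Bundled with its measure structure by hand, because the hypotheses on h are
    not visible to structure inference. *)
Definition density : {measure set T -> \bar R} := HB.pack density_of density_mixin.
Lemma densityE A : density A = (\int[m]_(x in A) h x)%E. Proof. by []. Qed.
End density.

Section product_density.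
Context {R : realType}.
Local Notation mR := (measurableTypeR R).
Local Notation mu := (@lebesgue_measure R).
Implicit Types h : nat -> R -> R.

Lemma measurable_prod_tuple n h : (forall k, measurable_fun setT (h k)) ->
  measurable_fun [set: n.-tuple mR] (fun t : n.-tuple mR => \prod_(k < n) h k (tnth t k)).
Proof.
move=> mh; apply: measurable_prod => k _.
apply: (@measurableT_comp _ _ _ _ _ _ (h k)) => //; exact: measurable_tnth.
Qed.

Lemma integral_box n h (B : nat -> set R) :
  (forall k, measurable_fun setT (h k)) -> (forall k x, 0 <= h k x) ->
  (forall k, measurable (B k)) ->
  (\int[lebn n]_(t in box B) (\prod_(k < n) h k (tnth t k))%:E =
   \prod_(k < n) \int[mu]_(x in B k) (h k x)%:E)%E.
Proof.
move=> mh h0 mB.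
pose g k x := h k x * \1_(B k) x.
have mg k : measurable_fun setT (g k) by apply: measurable_funM => //; exact: measurable_indic.
have g0 k x : 0 <= g k x by rewrite mulr_ge0.
have gE (k : nat) : (\int[mu]_(x in B k) (h k x)%:E = \int[mu]_x (g k x)%:E)%E.
  rewrite integral_mkcond; apply: eq_integral => x _.
  by rewrite /g patchE indicE; case: (x \in B k); rewrite ?mulr1 ?mulr0.
under eq_bigr do rewrite gE.
have -> : (\int[lebn n]_(t in box B) (\prod_(k < n) h k (tnth t k))%:E =
    \int[lebn n]_t (\prod_(k < n) g k (tnth t k))%:E)%E.
  rewrite integral_mkcond; apply: eq_integral => t _.
  rewrite patchE; case: ifPn => [|].
    rewrite inE => tB; congr EFin; apply: eq_bigr => k _.
    by rewrite /g indicE mem_set ?mulr1//; exact: tB.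
  rewrite notin_setE => tB.
  have [k tk] : exists k : 'I_n, ~ B k (tnth t k) by apply/existsNP.
  by rewrite (bigD1 k)//= /g indicE memNset// mulr0 mul0r.
move: g mg g0 {gE}; clear; elim: n => [|n IH] g mg g0.
  by rewrite integral_lebn0 ?big_ord0//; under eq_fun do rewrite big_ord0; exact: measurable_cst.
rewrite integral_lebnS; last 2 first.
- by apply/measurable_EFinP; exact: measurable_prod_tuple.
- by move=> t; rewrite lee_fin; apply: prodr_ge0.
rewrite big_ord_recl/=.
have E s : (\int[lebn n]_t (\prod_(k < n.+1) g k (tnth (tcons (s, t)) k))%:E =
   (g 0%N s)%:E * \prod_(k < n) \int[mu]_x (g k.+1 x)%:E)%E.
  rewrite -(IH (fun k => g k.+1))// -ge0_integralZl//; last 3 first.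
  - by apply/measurable_EFinP; exact: (measurable_prod_tuple (h := fun k => g k.+1)).
  - by move=> t _; rewrite lee_fin; apply: prodr_ge0.
  - by rewrite lee_fin.
  apply: eq_integral => t _; rewrite big_ord_recl EFinM/=.
  by congr (_ * (_)%:E)%E; apply: eq_bigr => k _; rewrite tnthS.
under eq_integral do rewrite E.
rewrite ge0_integralZr//.
- by apply/measurable_EFinP; exact: (mg 0%N).
- by move=> x _; rewrite lee_fin.
- by apply: prode_ge0 => k _; apply: integral_ge0 => x _; rewrite lee_fin.
Qed.
End product_density.

(** * Feynman-Kac masses and the Mecke formula *)

Section fk.
Context {R : realType}.
Local Notation mR := (measurableTypeR R).
Local Notation mu := (@lebesgue_measure R).
Local Open Scope ereal_scope.
Implicit Types (E : R -> R -> int -> R) (x y r s : R) (j : int).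

(** Mass of the paths that are at j at time x and make n jumps before time 1,
    a of them up and b of them down, when staying at j from x to y has weight
    E x y j.  The propagator E is arbitrary so that the insertion of a jump can
    be expressed as a change of E. *)
Fixpoint fk E (n a b : nat) x j : \bar R :=
  match n with
  | 0 => if (a == 0%N) && (b == 0%N) then (E x 1%R j)%:E else 0
  | n.+1 => \int[mu]_y
      if (x < y < 1)%R then
        (E x y j)%:E * ((if a is a.+1 then fk E n a b y (j + 1) else 0) +
                        (if b is b.+1 then fk E n a b y (j - 1) else 0))
      else 0
  end.

Lemma fkS E n a b x j : fk E n.+1 a b x j = \int[mu]_y
  if (x < y < 1)%R then
    (E x y j)%:E * ((if a is a.+1 then fk E n a b y (j + 1) else 0) +
                    (if b is b.+1 then fk E n a b y (j - 1) else 0))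
  else 0.
Proof. by []. Qed.

(** The propagator of a path with an additional jump of size e at time r, as a
    function of the path without that jump. *)
Definition shift_after E r (e : int) x y j : R :=
  if (y < r)%R then E x y j
  else if (r <= x)%R then E x y (j + e)%R
  else (E x r j * E r y (j + e)%R)%R.

(** Reflecting space exchanges the roles of up and down jumps. *)
Definition reflect_prop E x y j : R := E x y (- j)%R.

Lemma shift_after_early E r e x y j : (y < r)%R -> shift_after E r e x y j = E x y j.
Proof. by rewrite /shift_after => ->. Qed.

Lemma shift_after_across E r e x y j : (x < r)%R -> (r <= y)%R ->
  shift_after E r e x y j = (E x r j * E r y (j + e)%R)%R.
Proof. by move=> xr ry; rewrite /shift_after ltNge ry/= leNgt xr. Qed.

Lemma fk_ge0 E n a b x j : (forall x y j, (0 <= E x y j)%R) -> 0 <= fk E n a b x j.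
Proof.
move=> E0; elim: n a b x j => [|n IH] a b x j /=.
  by case: ifP => // _; rewrite lee_fin.
apply: integral_ge0 => y _; case: ifP => // _.
apply: mule_ge0; first by rewrite lee_fin.
by apply: adde_ge0; [case: a|case: b].
Qed.

Lemma fk_reflect E n a b x j : fk (reflect_prop E) n a b x j = fk E n b a x (- j).
Proof.
elim: n a b x j => [|n IH] a b x j /=; first by rewrite andbC.
apply: eq_integral => y _; case: ifP => // _; congr (_ * _).
rewrite addeC; congr (_ + _).
  by case: b => // b; rewrite IH opprB addrC.
by case: a => // a; rewrite IH opprD.
Qed.

(** Once the additional jump lies in the past, the path is merely translated. *)
Lemma fk_shift_before E r e n a b x j : (r <= x)%R -> (x <= 1)%R ->
  fk (shift_after E r e) n a b x j = fk E n a b x (j + e).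
Proof.
elim: n a b x j => [|n IH] a b x j rx x1 /=.
  by case: ifP => // _; rewrite /shift_after ltNge (le_trans rx x1)/= rx.
apply: eq_integral => y _; case: ifP => // /andP[xy y1]; congr (_ * _).
  by rewrite /shift_after ltNge (le_trans rx (ltW xy))/= rx.
have ry := le_trans rx (ltW xy).
congr (_ + _).
  by case: a => // a; rewrite IH// ?ltW// addrAC.
by case: b => // b; rewrite IH// ?ltW// addrAC.
Qed.

(** Stated for all reparametrizations at once, because the recursion of fk
    evaluates E at times that are variables of the enclosing integrals. *)
Definition jointly_measurable d (W : measurableType d) (E : W -> R -> R -> int -> R) :=
  forall j d' (V : measurableType d') (w : V -> W) (x y : V -> R),
    measurable_fun setT w -> measurable_fun setT x -> measurable_fun setT y ->
    measurable_fun setT (fun v => E (w v) (x v) (y v) j).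

Lemma measurable_fk d (W : measurableType d) (E : W -> R -> R -> int -> R) :
  jointly_measurable E -> (forall w x y j, (0 <= E w x y j)%R) ->
  forall n a b j d' (V : measurableType d') (w : V -> W) (x : V -> R),
    measurable_fun setT w -> measurable_fun setT x ->
    measurable_fun setT (fun v => fk (E (w v)) n a b (x v) j).
Proof.
move=> mE E0; elim => [|n IH] a b j d' V w x mw mx /=.
  case: (_ && _); last exact: measurable_cst.
  by apply/measurable_EFinP; apply: mE.
pose F (p : V * mR) : \bar R := if (x p.1 < p.2 < 1)%R then
        (E (w p.1) (x p.1) p.2 j)%:E * ((if a is a.+1 then fk (E (w p.1)) n a b p.2 (j + 1) else 0) +
                        (if b is b.+1 then fk (E (w p.1)) n a b p.2 (j - 1) else 0))
      else 0.
apply: (measurable_fun_fubini_tonelli_F F); last first.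
  move=> p; rewrite /F; case: ifP => // _; apply: mule_ge0; first by rewrite lee_fin.
  by apply: adde_ge0; [case: a {F}|case: b {F}] => // ?; exact: fk_ge0.
have m1 : measurable_fun setT (fst : V * mR -> V) by exact: measurable_fst.
have m2 : measurable_fun setT (snd : V * mR -> R) by exact: measurable_snd.
have mw1 : measurable_fun setT (w \o fst : V * mR -> W) by exact: measurableT_comp.
have mx1 : measurable_fun setT (x \o fst : V * mR -> R) by exact: measurableT_comp.
apply: measurable_fun_ifT; last exact: measurable_cst.
  apply: measurable_and; apply: measurable_fun_ltr => //.
apply: emeasurable_funM; first by apply/measurable_EFinP; exact: (mE j _ _ (w \o fst) (x \o fst) snd).
apply: emeasurable_funD.
  by case: a {F} => [|a]; [exact: measurable_cst|exact: (IH _ _ _ _ _ (w \o fst) snd)].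
by case: b {F} => [|b]; [exact: measurable_cst|exact: (IH _ _ _ _ _ (w \o fst) snd)].
Qed.

Lemma measurable_fk1 E :
  jointly_measurable (fun _ : unit => E) -> (forall x y j, (0 <= E x y j)%R) ->
  forall n a b j d' (V : measurableType d') (x : V -> R), measurable_fun setT x ->
    measurable_fun setT (fun v => fk E n a b (x v) j).
Proof.
move=> mE E0 n a b j d' V x mx.
by apply: (measurable_fk mE (fun _ => E0) n a b j (w := fun=> tt)).
Qed.

Lemma shift_after_ge0 E r e : (forall x y j, (0 <= E x y j)%R) ->
  forall x y j, (0 <= shift_after E r e x y j)%R.
Proof. by move=> E0 x y j; rewrite /shift_after; case: ifP => // _; case: ifP => // _; rewrite mulr_ge0. Qed.

Lemma jointly_measurable_shift d (W : measurableType d) (E : W -> R -> R -> int -> R) (rho : W -> R) e :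
  jointly_measurable E -> measurable_fun setT rho ->
  jointly_measurable (fun w => shift_after (E w) (rho w) e).
Proof.
move=> mE mrho j d' V w x y mw mx my; rewrite /shift_after.
have mr : measurable_fun setT (rho \o w) by exact: measurableT_comp.
apply: measurable_fun_ifT; first exact: measurable_fun_ltr.
  exact: mE.
apply: measurable_fun_ifT; first exact: measurable_fun_ler.
  exact: mE.
apply: measurable_funM; first exact: (mE j _ _ w x (rho \o w)).
exact: (mE (j + e)%R _ _ w (rho \o w) y).
Qed.

Lemma jointly_measurable_shiftR E e : jointly_measurable (fun _ : unit => E) ->
  jointly_measurable (fun r : R => shift_after E r e).
Proof.
move=> mE; apply: (@jointly_measurable_shift _ _ (fun _ : R => E) id) => //.
move=> j d' V w x y mw mx my.
exact: (mE j _ _ (fun=> tt) x y).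
Qed.

Lemma jointly_measurable_reflect d (W : measurableType d) (E : W -> R -> R -> int -> R) :
  jointly_measurable E -> jointly_measurable (fun w => reflect_prop (E w)).
Proof. by move=> mE j; exact: (mE (- j)%R). Qed.

Lemma integral_point_neq (f g : R -> \bar R) (c : R) :
  measurable_fun setT f -> measurable_fun setT g ->
  (forall y, 0 <= f y) -> (forall y, 0 <= g y) ->
  (forall y, y != c -> f y = g y) -> \int[mu]_y f y = \int[mu]_y g y.
Proof.
move=> mf mg f0 g0 fg; apply: ge0_ae_eq_integral => //.
exists [set c]; split; first exact: measurable_set1.
  exact: lebesgue_measure_set1.
by move=> y /= /not_implyP[_ fgy]; apply: contrapT => /eqP yc; apply: fgy; exact: fg.
Qed.

(** Mecke formula: each of the a + 1 up jumps of a path can be the inserted one.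
    By induction on the number of jumps, according to whether the inserted time
    r comes after the first jump y of the path (G1) or before it (G2).
    Exchanging the integrals over r and y turns the first part into the
    induction hypothesis, while in the second part r is the new first jump. *)
Lemma fk_insert_up E : jointly_measurable (fun _ : unit => E) ->
  (forall x y j, (0 <= E x y j)%R) ->
  forall n a b x j,
  \int[mu]_r (if (x < r < 1)%R then fk (shift_after E r 1) n a b x j else 0) =
  a.+1%:R%:E * fk E n.+1 a.+1 b x j.
Proof.
move=> mE E0.
have mES := jointly_measurable_shiftR 1%R mE.
have ES0 r : forall x y j, (0 <= shift_after E r 1 x y j)%R by exact: shift_after_ge0.
elim=> [|n IH] a b x j.
  rewrite /= -ge0_integralZl//; last 2 first.
  - apply: (measurable_fun_ifT (f := fun y => (x < y < 1)%R)) => //.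
    + by apply: measurable_and; apply: measurable_fun_ltr.
    + apply: emeasurable_funM; first by apply/measurable_EFinP; exact: (mE j _ _ (fun=> tt) (fun=> x) id).
      apply: emeasurable_funD; last by case: b.
      case: (_ && _) => //; apply/measurable_EFinP; exact: (mE (j + 1)%R _ _ (fun=> tt) id (fun=> 1%R)).
  - move=> y _; case: ifP => // _; apply: mule_ge0; first by rewrite lee_fin.
    by apply: adde_ge0; [case: ifP => //; rewrite lee_fin|case: b].
  apply: eq_integral => r _; case: ifPn => [/andP[xr r1]|]; last by rewrite mule0.
  case: a => [|a] /=; last by case: b => [|b]; rewrite ?adde0 !mule0.
  case: b => [|b]; last by rewrite add0e !mule0.
  by rewrite adde0 mul1e /shift_after ltNge (ltW r1)/= leNgt xr/= EFinM.
pose S r y : \bar R := (if a is a'.+1 then fk (shift_after E r 1) n a' b y (j + 1) else 0) +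
           (if b is b'.+1 then fk (shift_after E r 1) n a b' y (j - 1) else 0).
pose S0 y : \bar R := (if a is a'.+1 then fk E n a' b y (j + 1 + 1) else 0) +
           (if b is b'.+1 then fk E n a b' y (j + 1 - 1) else 0).
have S_ge0 r y : 0 <= S r y.
  by apply: adde_ge0; [case: a {S S0}|case: b {S S0}] => // ?; exact: fk_ge0.
have S0_ge0 y : 0 <= S0 y.
  by apply: adde_ge0; [case: a {S S0 S_ge0}|case: b {S S0 S_ge0}] => // ?; exact: fk_ge0.
pose G1 (p : mR * mR) : \bar R := if (x < p.2 < 1)%R && (p.2 < p.1 < 1)%R then (E x p.2 j)%:E * S p.1 p.2 else 0.
pose G2 (p : mR * mR) : \bar R := if (x < p.1 < 1)%R && (p.1 < p.2 < 1)%R then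
  (E x p.1 j)%:E * ((E p.1 p.2 (j + 1)%R)%:E * S0 p.2) else 0.
have G1_ge0 p : 0 <= G1 p.
  by rewrite /G1; case: ifP => // _; rewrite mule_ge0// lee_fin.
have G2_ge0 p : 0 <= G2 p.
  by rewrite /G2; case: ifP => // _; rewrite !mule_ge0// lee_fin.
have m1 : measurable_fun setT (fst : mR * mR -> R) by exact: measurable_fst.
have m2 : measurable_fun setT (snd : mR * mR -> R) by exact: measurable_snd.
have mS : measurable_fun setT (fun p : mR * mR => S p.1 p.2).
  apply: emeasurable_funD.
    case: a {S S0 S_ge0 S0_ge0 G1 G2 G1_ge0 G2_ge0} => [|a]; first exact: measurable_cst.
    exact: (measurable_fk mES ES0 _ _ _ _ (w := fst) (x := snd)).
  case: b {S S0 S_ge0 S0_ge0 G1 G2 G1_ge0 G2_ge0} => [|b]; first exact: measurable_cst.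
  exact: (measurable_fk mES ES0 _ _ _ _ (w := fst) (x := snd)).
have mS0 d' (V : measurableType d') (f : V -> R) : measurable_fun setT f -> measurable_fun setT (S0 \o f).
  move=> mf; apply: emeasurable_funD.
    case: a {S S0 S_ge0 S0_ge0 G1 G2 G1_ge0 G2_ge0 mS} => [|a]; first exact: measurable_cst.
    exact: measurable_fk1.
  case: b {S S0 S_ge0 S0_ge0 G1 G2 G1_ge0 G2_ge0 mS} => [|b]; first exact: measurable_cst.
  exact: measurable_fk1.
have mG1 : measurable_fun setT G1.
  apply: measurable_fun_ifT; last exact: measurable_cst.
    by repeat (apply: measurable_and); apply: measurable_fun_ltr.
  apply: emeasurable_funM => //.
  by apply/measurable_EFinP; exact: (mE j _ _ (fun=> tt) (fun=> x) snd).
have mG2 : measurable_fun setT G2.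
  apply: measurable_fun_ifT; last exact: measurable_cst.
    by repeat (apply: measurable_and); apply: measurable_fun_ltr.
  apply: emeasurable_funM.
    by apply/measurable_EFinP; exact: (mE j _ _ (fun=> tt) (fun=> x) fst).
  apply: emeasurable_funM; last exact: mS0.
  by apply/measurable_EFinP; exact: (mE (j + 1)%R _ _ (fun=> tt) fst snd).
have mpair (c : R) : measurable_fun setT (fun y : mR => (c, y) : mR * mR).
  exact: measurable_fun_pair.
have mpair2 (c : R) : measurable_fun setT (fun y : mR => (y, c) : mR * mR).
  exact: measurable_fun_pair.
have split_r r : (if (x < r < 1)%R then fk (shift_after E r 1) n.+1 a b x j else 0) =
    \int[mu]_y G1 (r, y) + \int[mu]_y G2 (r, y).
  rewrite -ge0_integralD//; last 2 first.
  - exact: (measurableT_comp mG1 (mpair r)).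
  - exact: (measurableT_comp mG2 (mpair r)).
  case: ifPn => [xr1|xr1]; last first.
    rewrite integral0_eq// => y _; rewrite /G1 /G2 /=.
    rewrite (negbTE xr1)/= adde0; case: ifPn => // /andP[/andP[xy _] /andP[yr r1]].
    by rewrite (lt_trans xy yr) r1 in xr1.
  apply: (@integral_point_neq _ _ r).
  - apply: (measurable_fun_ifT (f := fun y => (x < y < 1)%R)) => //.
      by apply: measurable_and; apply: measurable_fun_ltr.
    apply: emeasurable_funM.
      by apply/measurable_EFinP; exact: (mES j _ _ (fun=> r) (fun=> x) id).
    exact: (measurableT_comp mS (mpair r)).
  - apply: emeasurable_funD.
      exact: (measurableT_comp mG1 (mpair r)).
    exact: (measurableT_comp mG2 (mpair r)).
  - move=> y; case: ifP => // _; apply: mule_ge0; first by rewrite lee_fin.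
    exact: S_ge0.
  - by move=> y; rewrite adde_ge0.
  move=> y yr; rewrite /G1 /G2 /= xr1 /=.
  have /andP[xr r1] := xr1.
  have [yr'|ry] := ltP y r.
    rewrite r1 (lt_gtF yr')/= andbT adde0; case: ifP => // _.
    by rewrite shift_after_early.
  have {}ry : (r < y)%R by rewrite lt_neqAle eq_sym yr ry.
  rewrite (lt_trans xr ry) ry/= andbF add0e; case: ifP => // y1.
  rewrite shift_after_across ?(ltW ry)// EFinM -muleA; congr (_ * (_ * _)).
  congr (_ + _).
    by case: a {S S0 S_ge0 S0_ge0 G1 G2 G1_ge0 G2_ge0 mS mS0 mG1 mG2} => // a'; apply: fk_shift_before; exact: ltW.
  case: b {S S0 S_ge0 S0_ge0 G1 G2 G1_ge0 G2_ge0 mS mS0 mG1 mG2} => // b'.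
  by rewrite (addrAC j 1%R (-1)%R); apply: fk_shift_before; exact: ltW.
under eq_integral do rewrite split_r.
rewrite ge0_integralD//; last 4 first.
- by move=> r _; apply: integral_ge0.
- exact: (measurable_fun_fubini_tonelli_F G1).
- by move=> r _; apply: integral_ge0.
- exact: (measurable_fun_fubini_tonelli_F G2).
have fk0 m c d y i : 0 <= fk E m c d y i by exact: fk_ge0.
have mfk m c d i : measurable_fun setT (fun y : mR => fk E m c d y i) by exact: measurable_fk1.
have G1E y : \int[mu]_r G1 (r, y) = if (x < y < 1)%R then (E x y j)%:E *
    (a%:R%:E * fk E n.+1 a b y (j + 1) + (if b is b'.+1 then a.+1%:R%:E * fk E n.+1 a.+1 b' y (j - 1) else 0)) else 0.
  case: ifPn => [/andP[xy y1]|xy1]; last first.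
    by rewrite integral0_eq// => r _; rewrite /G1/= (negbTE xy1).
  have -> : \int[mu]_r G1 (r, y) = \int[mu]_r ((E x y j)%:E * (if (y < r < 1)%R then S r y else 0)).
    by apply: eq_integral => r _; rewrite /G1/= xy y1/=; case: ifP => // _; rewrite mule0.
  have mfkS c d i : measurable_fun setT (fun r : mR => if (y < r < 1)%R then fk (shift_after E r 1) n c d y i else 0).
    apply: measurable_fun_ifT => //; first by apply: measurable_and; apply: measurable_fun_ltr.
    exact: (measurable_fk mES ES0 _ _ _ _ (w := id) (x := fun=> y)).
  have fkS0 c d i r : 0 <= if (y < r < 1)%R then fk (shift_after E r 1) n c d y i else 0.
    by case: ifP => // _; exact: fk_ge0.
  rewrite ge0_integralZl//; last 3 first.
  - apply: measurable_fun_ifT => //; first by apply: measurable_and; apply: measurable_fun_ltr.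
    exact: (measurableT_comp mS (mpair2 y)).
  - by move=> r _; case: ifP.
  - by rewrite lee_fin.
  congr (_ * _).
  pose f1 (r : mR) := if a is a'.+1 then (if (y < r < 1)%R then fk (shift_after E r 1) n a' b y (j + 1) else 0) else 0.
  pose f2 (r : mR) := if b is b'.+1 then (if (y < r < 1)%R then fk (shift_after E r 1) n a b' y (j - 1) else 0) else 0.
  transitivity (\int[mu]_r (f1 r + f2 r)).
    apply: eq_integral => r _; rewrite /f1 /f2 /S.
    by case: ifP => // _; case: (a) => [|?]; case: (b) => [|?]; rewrite ?adde0.
  rewrite ge0_integralD//; last 4 first.
  - by move=> r _; rewrite /f1; case: (a).
  - by rewrite /f1; case: (a) => //; exact: measurable_cst.
  - by move=> r _; rewrite /f2; case: (b).
  - by rewrite /f2; case: (b) => //; exact: measurable_cst.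
  congr (_ + _).
    rewrite /f1; case: (a) => [|a']; last exact: IH.
    by rewrite integral0 mul0e.
  by rewrite /f2; case: (b) => [|b']; [rewrite integral0|exact: IH].
have G2E r : \int[mu]_y G2 (r, y) = if (x < r < 1)%R then (E x r j)%:E * fk E n.+1 a b r (j + 1) else 0.
  case: ifPn => [/andP[xr r1]|xr1]; last first.
    by rewrite integral0_eq// => y _; rewrite /G2/= (negbTE xr1).
  transitivity (\int[mu]_y ((E x r j)%:E * (if (r < y < 1)%R then (E r y (j + 1)%R)%:E * S0 y else 0))).
    by apply: eq_integral => y _; rewrite /G2/= xr r1/=; case: ifP => // _; rewrite mule0.
  rewrite ge0_integralZl//; last 3 first.
  - apply: measurable_fun_ifT => //; first by apply: measurable_and; apply: measurable_fun_ltr.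
    apply: emeasurable_funM; last exact: mS0.
    by apply/measurable_EFinP; exact: (mE (j + 1)%R _ _ (fun=> tt) (fun=> r) id).
  - by move=> y _; case: ifP => // _; rewrite mule_ge0// lee_fin.
  - by rewrite lee_fin.
transitivity (
  \int[mu]_y (if (x < y < 1)%R then (E x y j)%:E *
    (a%:R%:E * fk E n.+1 a b y (j + 1) +
     (if b is b'.+1 then a.+1%:R%:E * fk E n.+1 a.+1 b' y (j - 1) else 0)) else 0) +
  \int[mu]_r (if (x < r < 1)%R then (E x r j)%:E * fk E n.+1 a b r (j + 1) else 0)).
  congr (_ + _); last by apply: eq_integral => r _; exact: G2E.
  by rewrite fubini_tonelli//; apply: eq_integral => y _; exact: G1E.
have mif (f : mR -> \bar R) : measurable_fun setT f -> measurable_fun setT (fun y : mR => if (x < y < 1)%R then f y else 0).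
  by move=> mf; apply: measurable_fun_ifT => //; apply: measurable_and; apply: measurable_fun_ltr.
have mEx : measurable_fun setT (fun y : mR => (E x y j)%:E).
  by apply/measurable_EFinP; exact: (mE j _ _ (fun=> tt) (fun=> x) id).
rewrite -ge0_integralD//; last 4 first.
- move=> y _; case: ifP => // _; rewrite mule_ge0 ?lee_fin// adde_ge0//.
    by rewrite mule_ge0// lee_fin.
  by case: (b) => // b'; rewrite mule_ge0// lee_fin.
- apply: mif; apply: emeasurable_funM => //; apply: emeasurable_funD.
    exact: emeasurable_funM.
  by case: (b) => // b'; exact: emeasurable_funM.
- by move=> y _; case: ifP => // _; rewrite mule_ge0// lee_fin.
- by apply: mif; apply: emeasurable_funM.
rewrite [X in _ = _ * X]fkS -ge0_integralZl//; last 2 first.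
- apply: mif; apply: emeasurable_funM => //; apply: emeasurable_funD => //.
  by case: (b).
- move=> y _; case: ifP => // _; rewrite mule_ge0 ?lee_fin// adde_ge0//.
  by case: (b).
apply: eq_integral => y _; case: ifP => _; last by rewrite adde0 mule0.
rewrite [RHS]muleCA -ge0_muleDr//; last first.
  rewrite adde_ge0//; first by rewrite mule_ge0// lee_fin.
  by case: (b) => // b'; rewrite mule_ge0// lee_fin.
congr (_ * _).
rewrite [RHS]ge0_muleDr; [|exact: fk0|by case: (b) => [|?]; [|exact: fk0]].
rewrite addeAC; congr (_ + _).
  by rewrite -[X in _ + X]mul1e -ge0_muleDl ?lee_fin// -EFinD natr1.
by case: (b) => //; rewrite mule0.
Qed.
End fk.

(** * The double integral of the exponential of a distance *)

Section exponential_integral.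
Context {R : realType}.
Local Notation mR := (measurableTypeR R).
Local Notation mu := (@lebesgue_measure R).

Lemma integral_derive (F f : R -> R) (a b : R) : a <= b ->
  (forall x : R, is_derive x (1 : R) F (f x)) -> continuous f ->
  (\int[mu]_(x in `[a, b]) (f x)%:E = (F b - F a)%:E)%E.
Proof.
rewrite le_eqVlt => /predU1P[<-|ab] dF cf.
  by rewrite set_itv1 integral_set1 subrr.
have cF : continuous F.
  by move=> x; apply/differentiable_continuous/derivable1_diffP; have [] := dF x.
rewrite (@continuous_FTC2 _ f F)//.
- exact: continuous_subspaceT.
- split => [x _||]; first by have [] := dF x.
    by apply/cvg_at_right_filter; exact: cF.
  by apply/cvg_at_left_filter; exact: cF.
- by move=> x _; rewrite derive1E; have [_ ->] := dF x.
Qed.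

Lemma is_derive_expR_affine (c d x : R) :
  is_derive x 1 (fun y : R => expR (c * y + d)) (c * expR (c * x + d)).
Proof.
have H : is_derive x 1 (fun y : R => c * y + d) c.
  apply: is_derive_eq; rewrite /GRing.scale/=; ring.
by apply: is_derive_eq; rewrite /GRing.scale/= mulrC.
Qed.

Lemma continuous_expR_affine (c d : R) : continuous (fun y : R => expR (c * y + d)).
Proof.
move=> x; apply/differentiable_continuous/derivable1_diffP.
by have [] := is_derive_expR_affine c d x.
Qed.

Lemma integral_expR_affine (c d a b : R) : c != 0 -> a <= b ->
  (\int[mu]_(x in `[a, b]) (expR (c * x + d))%:E =
   ((expR (c * b + d) - expR (c * a + d)) / c)%:E)%E.
Proof.
move=> c0 ab.
have dF (x : R) : is_derive x (1 : R) (fun x => c^-1 * expR (c * x + d)) (expR (c * x + d)).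
  have H := is_derive_expR_affine c d x.
  by apply: is_derive_eq; rewrite /GRing.scale/= mulrA mulVf// mul1r.
rewrite (integral_derive ab dF); last exact: continuous_expR_affine.
by rewrite -mulrBr mulrC.
Qed.

Variable k : R.
Hypothesis k0 : 0 < k.

(** Adding 1 gives the average of expR (k * |r - s|) over the unit square. *)
Definition excess : R := 2 * ((expR k - 1 - k) / k ^+ 2) - 1.

Lemma measurable_expR_affine (c d : R) : measurable_fun setT (fun x : R => (expR (c * x + d))%:E).
Proof.
apply/measurable_EFinP; apply: continuous_measurable_fun; exact: continuous_expR_affine.
Qed.

Lemma integral_if_oo (f : R -> \bar R) (a b : R) : measurable_fun setT f ->
  (\int[mu]_x (if (a < x < b)%R then f x else 0) = \int[mu]_(x in `[a, b]) f x)%E.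
Proof.
move=> mf; rewrite integral_itv_bndoo; last exact: measurable_funTS.
by rewrite [RHS]integral_mkcond; apply: eq_integral => x _; rewrite patchE mem_setE/= in_itv.
Qed.

Lemma integral_expR_dist (r : R) : 0 < r < 1 ->
  (\int[mu]_s (if (0 < s < 1)%R then (expR (k * `|r - s|))%:E else 0) =
   ((expR (k * r) + expR (k * (1 - r)) - 2) / k)%:E)%E.
Proof.
move=> /andP[r0 r1].
rewrite integral_if_oo; last first.
  apply/measurable_EFinP; apply: measurableT_comp => //.
  by apply: measurable_funM => //; apply: measurableT_comp => //; apply: measurable_funB.
have kn : - k != 0 by rewrite oppr_eq0 gt_eqF.
have -> : `[0, 1]%classic = `[0, r]%classic `|` `]r, 1]%classic :> set R.
  by rewrite -itv_bndbnd_setU// bnd_simp ltW.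
rewrite ge0_integral_setU//=; last 2 first.
- apply: measurable_funTS; apply/measurable_EFinP; apply: measurableT_comp => //.
  by apply: measurable_funM => //; apply: measurableT_comp => //; apply: measurable_funB.
- rewrite disj_set2E; apply/eqP/seteqP; split => // x [] /=; rewrite !in_itv/= => /andP[_ xr] /andP[rx _].
  by move: (lt_le_trans rx xr); rewrite ltxx.
transitivity (\int[mu]_(x in `[0%R, r]) (expR (- k * x + k * r))%:E +
              \int[mu]_(x in `[r, 1%R]) (expR (k * x - k * r))%:E)%E.
  congr (_ + _)%E.
    apply: eq_integral => x; rewrite inE/= in_itv/= => /andP[_ xr].
    by rewrite ger0_norm ?subr_ge0//; congr ((expR _)%:E); ring.
  rewrite -integral_itv_obnd_cbnd; last first.
    by apply: measurable_funTS; exact: (measurable_expR_affine k (- (k * r))).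
  apply: eq_integral => x; rewrite inE/= in_itv/= => /andP[rx _].
  by rewrite ltr0_norm ?subr_lt0//; congr ((expR _)%:E); ring.
rewrite integral_expR_affine ?ltW// integral_expR_affine ?gt_eqF ?ltW// -EFinD; congr EFin.
rewrite mulNr addNr mulr0 add0r subrr expR0.
have -> : k * 1 - k * r = k * (1 - r) by ring.
by field; rewrite gt_eqF.
Qed.

Lemma integral_expR_dist2 :
  (\int[mu]_r (if (0 < r < 1)%R then
     \int[mu]_s (if (0 < s < 1)%R then (expR (k * `|r - s|))%:E else 0) else 0) =
   (1 + excess)%:E)%E.
Proof.
transitivity (\int[mu]_r (if (0 < r < 1)%R then
    ((expR (k * r) + expR (k * (1 - r)) - 2) / k)%:E else 0))%E.
  by apply: eq_integral => r _; case: ifP => // r01; rewrite integral_expR_dist.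
have kn : - k != 0 by rewrite oppr_eq0 gt_eqF.
rewrite integral_if_oo; last first.
  apply/measurable_EFinP; apply: measurable_funM => //; apply: measurable_funB => //.
  apply: measurable_funD; apply: measurableT_comp => //; apply: measurable_funM => //.
  exact: measurable_funB.
have dF (x : R) : is_derive x (1 : R)
    (fun r => ((expR (k * r + 0) - expR (- k * r + k)) / k - 2 * r) / k)
    ((expR (k * x) + expR (k * (1 - x)) - 2) / k).
  have H1 := is_derive_expR_affine k 0 x; have H2 := is_derive_expR_affine (- k) k x.
  apply: is_derive_eq; rewrite /GRing.scale/= addr0 (_ : - k * x + k = k * (1 - x)); last by ring.
  by field; rewrite gt_eqF.
rewrite (integral_derive ler01 dF).
  congr EFin; rewrite /excess !mulr0 !mulr1 !addr0 !add0r addNr expR0.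
  by field; rewrite gt_eqF.
move=> x; apply: cvgMl; apply: cvgB; last exact: cvg_cst.
have H c d := @continuous_expR_affine c d x.
apply: cvgD; first by have := H k 0; under eq_fun do rewrite addr0.
have := H (- k) k; rewrite (_ : (fun y => expR (- k * y + k)) = (fun y => expR (k * (1 - y))))//.
by apply/funext => y; congr expR; ring.
Qed.

(** The exponential of a nonnegative number is at least 1, and so is its average. *)
Lemma excess_ge0 : 0 <= excess.
Proof.
have : (1%:E <= (1 + excess)%:E :> \bar R)%E.
  rewrite -integral_expR_dist2.
  have one : (\int[mu]_r (if (0 < r < 1)%R then 1 else 0) = 1 :> \bar R)%E.
    rewrite integral_if_oo; last exact: measurable_cst.
    by rewrite integral_cst//= lebesgue_measure_itv/= lte_fin ltr01 oppr0 adde0 mul1e.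
  rewrite -[X in (X <= _)%E]one; apply: ge0_le_integral => //.
  - by move=> r _; case: ifP.
  - apply: measurable_fun_ifT => //; apply: measurable_and; exact: measurable_fun_ltr.
  - rewrite (_ : (fun r => _) = 
     (fun r : mR => if (0 < r < 1)%R then ((expR (k * r) + expR (k * (1 - r)) - 2) / k)%:E else 0%E)); last first.
      by apply/funext => r; case: ifP => // r01; rewrite integral_expR_dist.
    apply: measurable_fun_ifT => //; first by apply: measurable_and; exact: measurable_fun_ltr.
    apply/measurable_EFinP; apply: measurable_funM => //; apply: measurable_funB => //.
    apply: measurable_funD; apply: measurableT_comp => //; apply: measurable_funM => //.
    exact: measurable_funB.
  - move=> r _; case: ifP => // r01; rewrite -[X in (X <= _)%E]one; apply: ge0_le_integral => //.
    + by move=> s _; case: ifP.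
    + apply: measurable_fun_ifT => //; apply: measurable_and; exact: measurable_fun_ltr.
    + apply: measurable_fun_ifT => //; first by apply: measurable_and; exact: measurable_fun_ltr.
      apply/measurable_EFinP; apply: measurableT_comp => //.
      by apply: measurable_funM => //; apply: measurableT_comp => //; apply: measurable_funB.
    + by move=> s _; case: ifP => // _; rewrite lee_fin -expR0 ler_expR mulr_ge0// ltW.
by rewrite lee_fin lerDl.
Qed.
End exponential_integral.

(** * The recursion for the masses of the levels *)

Section fk_comparison.
Context {R : realType}.
Local Notation mR := (measurableTypeR R).
Local Notation mu := (@lebesgue_measure R).
Local Open Scope ereal_scope.
Implicit Types (E : R -> R -> int -> R) (x y r s : R) (j : int).

(** Obtained from the insertion of an up jump by reflection. *)
Lemma fk_insert_down E : jointly_measurable (fun _ : unit => E) ->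
  (forall x y j, (0 <= E x y j)%R) ->
  forall n a b x j,
  \int[mu]_r (if (x < r < 1)%R then fk (shift_after E r (-1)) n a b x j else 0) =
  b.+1%:R%:E * fk E n.+1 a b.+1 x j.
Proof.
move=> mE E0 n a b x j.
have mE' := jointly_measurable_reflect mE.
have E0' x' y' j' : (0 <= reflect_prop E x' y' j')%R by exact: E0.
have reflK (F : R -> R -> int -> R) : reflect_prop (reflect_prop F) = F.
  by apply/funext => u; apply/funext => w; apply/funext => i; rewrite /reflect_prop opprK.
have := fk_insert_up mE' E0' n b a x (- j).
rewrite fk_reflect opprK => <-; apply: eq_integral => r _; case: ifP => // _.
rewrite -[in LHS](reflK (shift_after E r (-1))) fk_reflect; congr (fk _ _ _ _ _ _).
apply/funext => u; apply/funext => w; apply/funext => i; rewrite /reflect_prop /shift_after.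
by rewrite opprD.
Qed.

Lemma measurable_fk_integrand E n a b x j : jointly_measurable (fun _ : unit => E) ->
  (forall x y j, (0 <= E x y j)%R) ->
  measurable_fun setT (fun y : mR => if (x < y < 1)%R then
    (E x y j)%:E * ((if a is a.+1 then fk E n a b y (j + 1) else 0) +
                    (if b is b.+1 then fk E n a b y (j - 1) else 0))
  else 0).
Proof.
move=> mE E0; apply: measurable_fun_ifT => //.
  by apply: measurable_and; apply: measurable_fun_ltr.
apply: emeasurable_funM; first by apply/measurable_EFinP; exact: (mE j _ _ (fun=> tt) (fun=> x) id).
apply: emeasurable_funD.
  by case: a => [|a]; [exact: measurable_cst|exact: measurable_fk1].
by case: b => [|b]; [exact: measurable_cst|exact: measurable_fk1].
Qed.

(** The factors expR (G y - G x) telescope along the path. *)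
Lemma fk_le E E' (G : R -> R) :
  jointly_measurable (fun _ : unit => E) -> jointly_measurable (fun _ : unit => E') ->
  (forall x y j, (0 <= E x y j)%R) -> (forall x y j, (0 <= E' x y j)%R) ->
  (forall x y j, (x <= y)%R -> (E' x y j <= expR (G y - G x) * E x y j)%R) ->
  forall n a b x j, (x <= 1)%R ->
  fk E' n a b x j <= (expR (G 1 - G x))%:E * fk E n a b x j.
Proof.
move=> mE mE' E0 E0' EE'; elim=> [|n IH] a b x j x1.
  by rewrite /=; case: ifP => _; rewrite ?mule0// -EFinM lee_fin EE'.
have fk0 F m c d y i : (forall x y j, (0 <= F x y j)%R) -> 0 <= fk F m c d y i by move=> ?; exact: fk_ge0.
have S0 F y : (forall x y j, (0 <= F x y j)%R) ->
    0 <= (if a is a.+1 then fk F n a b y (j + 1) else 0) + (if b is b.+1 then fk F n a b y (j - 1) else 0).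
  by move=> F0; apply: adde_ge0; [case: (a) => [|?] //|case: (b) => [|?] //]; exact: fk0.
rewrite !fkS -ge0_integralZl//; last 2 first.
- exact: measurable_fk_integrand.
- by move=> y _; case: ifP => // _; rewrite mule_ge0 ?lee_fin// S0.
apply: ge0_le_integral => //.
- by move=> y _; case: ifP => // _; rewrite mule_ge0 ?lee_fin// S0.
- exact: measurable_fk_integrand.
- by apply: emeasurable_funM => //; exact: measurable_fk_integrand.
move=> y _; case: ifPn => [/andP[xy y1]|]; last by rewrite mule0.
rewrite (_ : (G 1 - G x = (G y - G x) + (G 1 - G y))%R); last by ring.
rewrite expRD EFinM muleACA -EFinM.
apply: lee_pmul; rewrite ?lee_fin//; first exact: S0.
  by apply: EE'; exact: ltW.
rewrite ge0_muleDr.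
- apply: leeD.
    by case: (a) => [|?]; [rewrite mule0|apply: IH; exact: ltW].
  by case: (b) => [|?]; [rewrite mule0|apply: IH; exact: ltW].
- by case: (a) => [|?] //; exact: fk0.
- by case: (b) => [|?] //; exact: fk0.
Qed.

Definition decay (v : int -> R) x y j : R := expR (- v j * (y - x)).

Lemma decay_ge0 v x y j : (0 <= decay v x y j)%R. Proof. exact: expR_ge0. Qed.

Lemma jointly_measurable_decay v : jointly_measurable (fun _ : unit => decay v).
Proof.
move=> j d' V w x y mw mx my; apply: measurableT_comp => //.
by apply: measurable_funM => //; exact: measurable_funB.
Qed.

(** The projection of t to the interval between r and s: the increment of clamp
    from x to y is the time that [x, y] spends between r and s. *)
Definition clamp r s t : R := Num.min (Num.max t (Num.min r s)) (Num.max r s).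

(** The two inserted jumps move the path by one unit between r and s and leave
    it unchanged elsewhere, and one unit changes v by at most k. *)
Lemma shift_pair_le (v : int -> R) (k : R) r s : (forall j, (`|v (j + 1) - v j| <= k)%R) ->
  forall x y j, (x <= y)%R ->
  (shift_after (shift_after (decay v) r 1) s (-1) x y j <=
   expR (k * clamp r s y - k * clamp r s x) * decay v x y j)%R.
Proof.
move=> vk x y j xy.
have k0 : (0 <= k)%R by exact: le_trans (vk 0%R).
have up : (v j - v (j + 1) <= k)%R by have := vk j; rewrite ler_norml; lra.
have dn : (v j - v (j - 1) <= k)%R by have := vk (j - 1)%R; rewrite subrK ler_norml; lra.
(* The cases below are the relative positions of x, y, r and s; in each of them
   t is the exponent of the product of the propagators. *)
rewrite -expRD; set B := expR _.
suff [t [tE tB]] : exists t, shift_after (shift_after (decay v) r 1) s (-1) x y j = expR t /\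
    (t <= k * clamp r s y - k * clamp r s x + - v j * (y - x))%R.
  by rewrite tE ler_expR.
rewrite /B /decay /shift_after /clamp {B} !subrK.
have H (u w : R) : (v j - u <= k)%R -> (0 <= w)%R -> (- u * w <= k * w - v j * w)%R by move=> *; nra.
have Hu w := H _ w up; have Hd w := H _ w dn.
have Hu1 := Hu (y - x)%R; have Hd1 := Hd (y - x)%R.
have Hu2 := Hu (y - r)%R; have Hd2 := Hd (r - x)%R.
have Hu3 := Hu (s - x)%R; have Hd3 := Hd (y - s)%R.
have Hu4 := Hu (s - r)%R; have Hd4 := Hd (r - s)%R.
have [ys|sy] := ltP y s.
  have [yr|ry] := ltP y r.
    exists (- v j * (y - x))%R; split => //.
    have -> : Num.max y (Num.min r s) = Num.min r s by apply/max_idPr; rewrite le_min !ltW.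
    have -> : Num.max x (Num.min r s) = Num.min r s by apply/max_idPr; rewrite le_min !(le_trans xy) ?ltW.
    lra.
  have rs := le_lt_trans ry ys.
  rewrite (min_l (ltW rs)) (max_r (ltW rs)) (max_l ry) (min_l (ltW ys)).
  have [rx|xr] := leP r x.
    exists (- v (j + 1) * (y - x))%R; split => //.
    rewrite (min_l (ltW (le_lt_trans xy ys))). lra.
  exists (- v j * (r - x) + - v (j + 1) * (y - r))%R; split; first by rewrite expRD.
  rewrite (min_l (ltW rs)). lra.
have [sx|xs] := leP s x.
  have [yr|ry] := ltP y r.
    exists (- v (j - 1) * (y - x))%R; split => //.
    have sr := le_lt_trans sy yr.
    rewrite (min_r (ltW sr)) (max_l (ltW sr)) (max_l sy) (max_l sx).
    rewrite (min_l (ltW yr)) (min_l (le_trans xy (ltW yr))). lra.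
  have [rx|xr] := leP r x.
    exists (- v j * (y - x))%R; split => //.
    have -> : Num.max y (Num.min r s) = y by apply/max_idPl; rewrite ge_min ry.
    have -> : Num.max x (Num.min r s) = x by apply/max_idPl; rewrite ge_min rx.
    have -> : Num.min y (Num.max r s) = Num.max r s by apply/min_idPr; rewrite ge_max ry sy.
    have -> : Num.min x (Num.max r s) = Num.max r s by apply/min_idPr; rewrite ge_max rx sx.
    lra.
  exists (- v (j - 1) * (r - x) + - v j * (y - r))%R; split; first by rewrite expRD.
  have sr := le_lt_trans sx xr.
  rewrite (min_r (ltW sr)) (max_l (ltW sr)) (max_l sy) (max_l sx).
  rewrite (min_r ry) (min_l (ltW xr)). lra.
have [sr|rs] := ltP s r.
  rewrite (max_l sy) (max_r (ltW xs)) (min_l (ltW sr)).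
  have [yr|ry] := ltP y r.
    exists (- v j * (s - x) + - v (j - 1) * (y - s))%R; split; first by rewrite expRD.
    rewrite ?(min_l (ltW yr)); lra.
  exists (- v j * (s - x) + (- v (j - 1) * (r - s) + - v j * (y - r)))%R; split; first by rewrite !expRD.
  rewrite ?(min_r ry); lra.
rewrite ltNge (le_trans rs sy)/=.
have -> : Num.max y r = y by apply/max_idPl; exact: le_trans rs sy.
rewrite ?(min_r sy).
have [rx|xr] := leP r x.
  exists (- v (j + 1) * (s - x) + - v j * (y - s))%R; split; first by rewrite expRD.
  rewrite ?(min_l (ltW xs)); lra.
exists (- v j * (r - x) + - v (j + 1) * (s - r) + - v j * (y - s))%R; split; first by rewrite !expRD.
rewrite ?(min_l rs); lra.
Qed.

(** A path starting and ending at 0 has as many up jumps as down jumps; their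
    common number m is its level. *)
Definition level_mass v m : \bar R := fk (decay v) m.*2 m m 0 0.

Lemma level_mass_ge0 v m : 0 <= level_mass v m.
Proof. by apply: fk_ge0; exact: decay_ge0. Qed.

Lemma level_mass0 (v : int -> R) : v 0%R = 0%R -> level_mass v 0 = 1.
Proof. by move=> v0; rewrite /level_mass /= /decay v0 oppr0 mul0r expR0. Qed.

(** An up jump is inserted at r and a down jump at s, each in m + 1 ways. *)
Lemma level_massS v m : (m.+1 ^ 2)%:R%:E * level_mass v m.+1 =
  \int[mu]_r (if (0 < r < 1)%R then
    \int[mu]_s (if (0 < s < 1)%R then
      fk (shift_after (shift_after (decay v) r 1) s (-1)) m.*2 m m 0 0 else 0) else 0).
Proof.
have mE := jointly_measurable_decay v; have E0 := @decay_ge0 v.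
rewrite expnS expn1 natrM EFinM -muleA /level_mass doubleS -(fk_insert_up mE E0).
rewrite -ge0_integralZl//; last 2 first.
- apply: measurable_fun_ifT => //; first by apply: measurable_and; apply: measurable_fun_ltr.
  have mES := jointly_measurable_shiftR 1%R mE.
  apply: (measurable_fk mES _ _ _ _ _ (w := id) (x := fun=> 0%R)) => //.
  by move=> r; exact: shift_after_ge0.
- by move=> r _; case: ifP => // _; apply: fk_ge0; exact: shift_after_ge0.
apply: eq_integral => r _; case: ifP => _; last by rewrite mule0.
rewrite -(fk_insert_down (E := shift_after (decay v) r 1))//; last exact: shift_after_ge0.
exact: (jointly_measurable_shift (rho := fun=> r)).
Qed.

(** The insertion of the two jumps costs at most a factor expR (k * |r - s|),
    whose average over r and s is 1 + excess k. *)
Lemma level_massS_le (v : int -> R) (k : R) m : (0 < k)%R -> (forall j, (`|v (j + 1) - v j| <= k)%R) ->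
  (m.+1 ^ 2)%:R%:E * level_mass v m.+1 <= (1 + excess k)%:E * level_mass v m.
Proof.
move=> k0 vk; have mE := jointly_measurable_decay v; have E0 := @decay_ge0 v.
have mEr r : jointly_measurable (fun _ : unit => shift_after (decay v) r 1).
  exact: (jointly_measurable_shift (rho := fun=> r)).
have E0r r := shift_after_ge0 r 1 E0.
have mErs r s : jointly_measurable (fun _ : unit => shift_after (shift_after (decay v) r 1) s (-1)).
  exact: (jointly_measurable_shift (rho := fun=> s)).
have E0rs r s := shift_after_ge0 s (-1) (E0r r).
have mdist : measurable_fun setT (fun p : mR * mR => (expR (k * `|p.1 - p.2|))%:E).
  apply/measurable_EFinP; apply: measurableT_comp => //; apply: measurable_funM => //.
  by apply: measurableT_comp => //; exact: measurable_funB.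
rewrite level_massS -integral_expR_dist2// muleC.
have mif (f : mR -> \bar R) : measurable_fun setT f -> measurable_fun setT (fun y : mR => if (0 < y < 1)%R then f y else 0).
  by move=> mf; apply: measurable_fun_ifT => //; apply: measurable_and; apply: measurable_fun_ltr.
have mpair (c : R) : measurable_fun setT (fun y : mR => (c, y) : mR * mR).
  exact: measurable_fun_pair.
have mif2 (f : mR * mR -> \bar R) : measurable_fun setT f -> (forall p, 0 <= f p) ->
    measurable_fun setT (fun r : mR => \int[mu]_s (if (0 < s < 1)%R then f (r, s) else 0)).
  move=> mf f0; apply: (measurable_fun_fubini_tonelli_F (fun p : mR * mR => if (0 < p.2 < 1)%R then f p else 0)).
    apply: measurable_fun_ifT => //; apply: measurable_and; apply: measurable_fun_ltr => //; exact: measurable_snd.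
  by move=> p; case: ifP.
have dist0 r s : 0 <= (expR (k * `|r - s|))%:E by rewrite lee_fin expR_ge0.
rewrite -ge0_integralZl//; last 3 first.
- apply: (mif (fun r => \int[mu]_s (if (0 < s < 1)%R then (expR (k * `|r - s|))%:E else 0))).
  exact: (mif2 (fun p => (expR (k * `|p.1 - p.2|))%:E)).
- by move=> r _; case: ifP => // _; apply: integral_ge0 => s _; case: ifP.
- exact: level_mass_ge0.
apply: ge0_le_integral => //.
- by move=> r _; case: ifP => // _; apply: integral_ge0 => s _; case: ifP => // _; exact: fk_ge0.
- apply: (mif (fun r => \int[mu]_s (if (0 < s < 1)%R then
      fk (shift_after (shift_after (decay v) r 1) s (-1)) m.*2 m m 0 0 else 0))).
  apply: (mif2 (fun p => fk (shift_after (shift_after (decay v) p.1 1) p.2 (-1)) m.*2 m m 0 0)); last first.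
    by move=> p; exact: fk_ge0.
  have mE1 : jointly_measurable (fun p : mR * mR => shift_after (decay v) p.1 1).
    apply: (@jointly_measurable_shift _ _ _ (fun _ : mR * mR => decay v) fst) => //.
    by move=> j d' V w x y mw; exact: (mE j d' V (fun=> tt)).
  have mE2 : jointly_measurable (fun p : mR * mR => shift_after (shift_after (decay v) p.1 1) p.2 (-1)).
    by apply: (@jointly_measurable_shift _ _ _ (fun p : mR * mR => shift_after (decay v) p.1 1) snd) => //; exact: measurable_snd.
  by apply: (measurable_fk mE2 _ _ _ _ _ (w := id) (x := fun=> 0%R)).
- apply: emeasurable_funM => //.
  apply: (mif (fun r => \int[mu]_s (if (0 < s < 1)%R then (expR (k * `|r - s|))%:E else 0))).
  exact: (mif2 (fun p => (expR (k * `|p.1 - p.2|))%:E)).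
move=> r _; case: ifPn => [/andP[r0 r1]|]; last by rewrite mule0.
rewrite -ge0_integralZl//; last 3 first.
- apply: (mif (fun s => (expR (k * `|r - s|))%:E)).
  exact: (measurableT_comp mdist (mpair r)).
- by move=> s _; case: ifP.
- exact: level_mass_ge0.
apply: ge0_le_integral => //.
- by move=> s _; case: ifP => // _; exact: fk_ge0.
- apply: (mif (fun s => fk (shift_after (shift_after (decay v) r 1) s (-1)) m.*2 m m 0 0)).
  have mE2 : jointly_measurable (fun s : mR => shift_after (shift_after (decay v) r 1) s (-1)).
    by apply: (@jointly_measurable_shiftR _ (shift_after (decay v) r 1)).
  by apply: (measurable_fk mE2 _ _ _ _ _ (w := id) (x := fun=> 0%R)).
- apply: emeasurable_funM => //; apply: (mif (fun s => (expR (k * `|r - s|))%:E)).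
  exact: (measurableT_comp mdist (mpair r)).
move=> s _; case: ifPn => [/andP[s0 s1]|]; last by rewrite mule0.
have := @fk_le _ _ (fun t => k * clamp r s t)%R mE (mErs r s) E0 (E0rs r s)
  (fun x y j => @shift_pair_le v k r s vk x y j) m.*2 m m 0 0 ler01.
rewrite muleC; congr (_ <= _ * (expR _)%:E).
rewrite -mulrBr; congr (_ * _)%R; rewrite /clamp.
have -> : Num.max 1%R (Num.min r s) = 1%R by apply/max_idPl; rewrite ge_min ltW.
have -> : Num.max 0%R (Num.min r s) = Num.min r s by apply/max_idPr; rewrite le_min !ltW.
have -> : Num.min 1%R (Num.max r s) = Num.max r s by apply/min_idPr; rewrite ge_max !ltW.
by have [rs|sr] := leP r s; [rewrite min_l ?ler0_norm ?subr_le0|rewrite min_l ?ger0_norm ?subr_ge0]; lra.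
Qed.

(** For the zero potential the insertions do not change the weight, so the
    recursion is exact. *)
Lemma level_mass_flat m : level_mass (fun=> 0%R) m = ((m`! ^ 2)%:R^-1)%:E.
Proof.
elim: m => [|m IH]; first by rewrite level_mass0// invr1.
have one : \int[mu]_r (if (0 < r < 1)%R then 1 else 0) = 1.
  rewrite integral_if_oo; last exact: measurable_cst.
  by rewrite integral_cst//= lebesgue_measure_itv/= lte_fin ltr01 oppr0 adde0 mul1e.
have := level_massS (fun=> 0%R) m.
have -> : \int[mu]_r (if (0 < r < 1)%R then
    \int[mu]_s (if (0 < s < 1)%R then
      fk (shift_after (shift_after (decay (fun=> 0%R)) r 1) s (-1)) m.*2 m m 0 0 else 0) else 0) =
    level_mass (fun=> 0%R) m.
  have E r s : shift_after (shift_after (decay (fun=> 0%R)) r 1) s (-1) = decay (fun=> 0%R) :> (R -> R -> int -> R).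
    apply/funext => x; apply/funext => y; apply/funext => j.
    rewrite /shift_after /decay !oppr0 !mul0r expR0 !mulr1.
    by repeat case: ifP => //; rewrite ?mulr1.
  transitivity (\int[mu]_r (level_mass (fun=> 0%R) m * (if (0 < r < 1)%R then 1 else 0))).
    apply: eq_integral => r _; case: ifP => _; last by rewrite mule0.
    under eq_integral do rewrite E.
    transitivity (\int[mu]_s (level_mass (fun=> 0%R) m * (if (0 < s < 1)%R then 1 else 0))).
      by apply: eq_integral => s _; case: ifP => _; rewrite ?mule1 ?mule0.
    rewrite ge0_integralZl// ?one//; last 2 first.
    - by move=> s _; case: ifP.
    - exact: level_mass_ge0.
    by apply: measurable_fun_ifT => //; apply: measurable_and; apply: measurable_fun_ltr.
  rewrite ge0_integralZl// ?one ?mule1//; last 2 first.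
  - by move=> s _; case: ifP.
  - exact: level_mass_ge0.
  by apply: measurable_fun_ifT => //; apply: measurable_and; apply: measurable_fun_ltr.
rewrite IH => H.
have m0 : ((m.+1 ^ 2)%:R != 0 :> R)%R by rewrite pnatr_eq0 expn_eq0.
have -> : level_mass (fun=> 0%R) m.+1 = ((m.+1 ^ 2)%:R^-1)%:E * ((m.+1 ^ 2)%:R%:E * level_mass (fun=> 0%R) m.+1).
  by rewrite muleA -EFinM mulVf// mul1e.
by rewrite H -EFinM -invfM -natrM factS expnMn.
Qed.
End fk_comparison.

(** * Signs of the jumps and weights of the gaps *)

Section translation.
Context {R : realType}.
Local Notation mR := (measurableTypeR R).
Local Notation mu := (@lebesgue_measure R).

Lemma measurable_addl (x : R) : measurable_fun setT ((fun y => x + y) : mR -> mR).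
Proof. by apply: measurable_funD. Qed.

Lemma lebesgue_measure_addl (x : R) (A : set R) : measurable A ->
  mu ((fun y => x + y) @^-1` A) = mu A.
Proof.
move=> mA; apply/esym.
apply: (@lebesgue_measure_unique _ (measure_function_pushforward__canonical__measure_function_Measure mu (measurable_addl x))) mA.
move=> _ [[a b] _ <-] /=; rewrite /pushforward.
rewrite (_ : _ @^-1` _ = `]a - x, b - x]%classic); last first.
  by apply/seteqP; split=> y /=; rewrite !in_itv/= ltrBlDl lerBrDl.
by rewrite !lebesgue_measure_itv/= !lte_fin ltrD2r; case: ifP => // _; rewrite -!EFinD; congr EFin; ring.
Qed.

Lemma integral_addl (f : R -> \bar R) (x : R) : measurable_fun setT f -> (forall y, 0 <= f y)%E ->
  (\int[mu]_y f (x + y)%R = \int[mu]_y f y)%E.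
Proof.
move=> mf f0; have := @ge0_integral_pushforward _ _ mR mR R _ (measurable_addl x) mu setT f measurableT mf.
rewrite preimage_setT => <-; last by move=> *; exact: f0.
apply: (@eq_measure_integral _ _ _ setT mu (measure_function_pushforward__canonical__measure_function_Measure mu (measurable_addl x)) f) => A mA _.
exact: lebesgue_measure_addl.
Qed.
End translation.

Section colors.
Definition step (c : bool) : int := if c then 1 else -1.

Definition position (j : int) (cs : seq bool) (k : nat) : int :=
  j + \sum_(c <- take k cs) step c.

Lemma position0 j cs : position j cs 0 = j.
Proof. by rewrite /position take0 big_nil addr0. Qed.

Lemma position_cons j c cs k : position j (c :: cs) k.+1 = position (j + step c) cs k.
Proof. by rewrite /position /= big_cons addrA. Qed.

Lemma positionS j cs k : (k < size cs)%N ->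
  position j cs k.+1 = position j cs k + step (nth false cs k).
Proof.
by move=> kn; rewrite /position (take_nth false kn) -cats1 big_cat big_seq1/= addrA.
Qed.

Lemma position_size j cs : position j cs (size cs) = j + (count id cs)%:Z - (count negb cs)%:Z.
Proof.
rewrite /position take_size; elim: cs j => [|c cs IH] j; first by rewrite big_nil /=; lia.
by rewrite big_cons addrA IH; case: c => /=; rewrite /step; lia.
Qed.

(** The order of enumeration follows the recursion of fk. *)
Fixpoint colors (n a b : nat) : seq (seq bool) :=
  match n with
  | 0 => if (a == 0%N) && (b == 0%N) then [:: [::]] else [::]
  | n.+1 => (if a is a.+1 then map (cons true) (colors n a b) else [::]) ++
            (if b is b.+1 then map (cons false) (colors n a b) else [::])
  end.

Lemma mem_colors n a b cs :
  (cs \in colors n a b) = [&& size cs == n, count id cs == a & count negb cs == b].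
Proof.
elim: n a b cs => [|n IH] a b cs /=.
  case: cs => [|c cs] /=; last by case: ifP.
  by rewrite ![0%N == _]eq_sym; case: ifP.
rewrite mem_cat; case: cs => [|c cs] /=.
  apply/norP; split.
    by case: a => // a; apply/mapP => -[].
  by case: b => // b; apply/mapP => -[].
have inj_cons (e : bool) : injective (cons e) by move=> ? ? [].
have ncons (e : bool) s : (c :: cs \in map (cons e) s) = (c == e) && (cs \in s).
  have [->|ce] := eqVneq c e; first by rewrite mem_map.
  by apply/mapP => -[u _ [ce' _]]; rewrite ce' eqxx in ce.
by case: a => [|a]; case: b => [|b] /=; rewrite ?in_nil ?ncons ?IH ?orbF ?orFb; case: (c) => /=;
  rewrite ?add1n ?add0n ?eqSS ?andbF ?orbF.
Qed.

Lemma uniq_colors n a b : uniq (colors n a b).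
Proof.
have inj_cons (e : bool) : injective (cons e) by move=> ? ? [].
elim: n a b => [|n IH] a b /=; first by case: ifP.
rewrite cat_uniq; apply/and3P; split.
- by case: a => // a; rewrite map_inj_uniq.
- apply/hasPn => u; case: b => // b /mapP[w _ ->].
  by case: a => // a; apply/mapP => -[].
- by case: b => // b; rewrite map_inj_uniq.
Qed.
End colors.

Section weight.
Context {R : realType}.
Local Notation mR := (measurableTypeR R).
Local Notation mu := (@lebesgue_measure R).
Implicit Types (v : int -> R) (x : R) (j : int) (cs : seq bool) (t : seq R).

(** Here t lists the gaps between successive jumps and cs their signs, true for
    up.  The path is at j during the first gap, which starts at time x; the last
    factor accounts for the time between the last jump and 1. *)
Fixpoint weight v j cs x t : R :=
  match cs, t with
  | [::], [::] => expR (- v j * (1 - x))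
  | c :: cs, s :: t => if (0 < s) && (x + s < 1)
      then expR (- v j * s) * weight v (j + step c) cs (x + s) t else 0
  | _, _ => 0
  end.

Lemma weight_ge0 v j cs x t : 0 <= weight v j cs x t.
Proof.
elim: cs j x t => [|c cs IH] j x [|s t] /=; rewrite ?expR_ge0 ?lexx//.
by case: ifP => // _; rewrite mulr_ge0 ?expR_ge0.
Qed.

Definition in_simplex (x : R) t := all (fun s => 0 < s) t && (x + \sum_(s <- t) s < 1).

Lemma sum_pos_ge0 t : all (fun s => 0 < s) t -> 0 <= \sum_(s <- t) s.
Proof. by move=> /allP t0; rewrite big_seq; apply: sumr_ge0 => s /t0/ltW. Qed.

Lemma in_simplex_cons x s t :
  in_simplex x (s :: t) = (0 < s) && (x + s < 1) && in_simplex (x + s) t.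
Proof.
rewrite /in_simplex /= big_cons addrA -!andbA; apply: andb_id2l => s0.
rewrite andbCA; apply: andb_id2l => t0.
rewrite andb_idl// => /(le_lt_trans _)-> //.
by rewrite lerDl sum_pos_ge0.
Qed.

Lemma weightE v j cs x t : x < 1 -> size t = size cs -> weight v j cs x t =
  if in_simplex x t then
    expR (- (\sum_(k < size cs) v (position j cs k) * t`_k)
          - v (position j cs (size cs)) * (1 - x - \sum_(s <- t) s)) else 0.
Proof.
elim: cs j x t => [|c cs IH] j x [|s t] //= x1 => [_|[st]].
  by rewrite /in_simplex/= big_nil addr0 x1 big_ord0 oppr0 position0 add0r addr0 mulNr.
rewrite in_simplex_cons; case: ifP => //= /andP[s0 xs1].
rewrite IH//; case: ifP => _; last by rewrite mulr0.
rewrite -expRD; congr expR; rewrite big_ord_recl/= position0 big_cons position_cons.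
under [in RHS]eq_bigr do rewrite position_cons.
by ring.
Qed.

Lemma measurable_weight v j n cs d (V : measurableType d) (x : V -> R) (t : V -> n.-tuple mR) :
  measurable_fun setT x -> measurable_fun setT t ->
  measurable_fun setT (fun u => weight v j cs (x u) (t u)).
Proof.
elim: n cs j x t => [|n IH] [|c cs] j x t mx mt.
- rewrite (_ : (fun u => _) = fun u => expR (- v j * (1 - x u))).
    by apply: measurableT_comp => //; apply: measurable_funM => //; exact: measurable_funB.
  by apply/funext => u; rewrite (tuple0 (t u)).
- rewrite (_ : (fun u => _) = fun=> 0) //.
  by apply/funext => u; rewrite (tuple0 (t u)).
- rewrite (_ : (fun u => _) = fun=> 0) //.
  by apply/funext => u; case/tupleP: (t u).
pose s u : R := thead (t u).
pose t' u : n.-tuple mR := [tuple of behead (t u)].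
rewrite (_ : (fun u => _) = fun u => if (0 < s u) && (x u + s u < 1)
      then expR (- v j * s u) * weight v (j + step c) cs (x u + s u) (t' u) else 0); last first.
  by apply/funext => u; rewrite /s /t'; case/tupleP: (t u) => s0 t0; rewrite theadE.
have ms : measurable_fun setT s.
  by apply: (measurableT_comp (f := fun t : n.+1.-tuple mR => tnth t ord0)) => //; exact: measurable_tnth.
have mt' : measurable_fun setT t'.
  by apply: (measurableT_comp (f := fun t : n.+1.-tuple mR => [tuple of behead t])) => //; exact: measurable_behead.
have mxs : measurable_fun setT (fun u => x u + s u) by exact: measurable_funD.
apply: measurable_fun_ifT => //.
  by apply: measurable_and; exact: measurable_fun_ltr.
apply: measurable_funM; last exact: IH.
by apply: measurableT_comp => //; apply: measurable_funM.
Qed.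

Lemma measurable_weight_tuple v j x n cs :
  measurable_fun setT (fun t : n.-tuple mR => weight v j cs x t).
Proof. exact: (measurable_weight v j cs (x := fun=> x) (t := id)). Qed.

Definition weight_mass v j cs x : \bar R := \int[lebn (size cs)]_t (weight v j cs x t)%:E.

Lemma weight_mass_ge0 v j cs x : (0 <= weight_mass v j cs x)%E.
Proof. by apply: integral_ge0 => t _; rewrite lee_fin weight_ge0. Qed.

Lemma measurable_weight_mass v j cs d (V : measurableType d) (x : V -> R) :
  measurable_fun setT x -> measurable_fun setT (fun u => weight_mass v j cs (x u)).
Proof.
move=> mx; apply: (measurable_fun_fubini_tonelli_F (fun p : V * (size cs).-tuple mR => (weight v j cs (x p.1) p.2)%:E)).
  apply/measurable_EFinP; apply: (measurable_weight v j cs (x := x \o fst) (t := snd)) => //.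
  exact: measurableT_comp.
by move=> p; rewrite lee_fin weight_ge0.
Qed.

Lemma weight_mass_cons v j c cs x :
  (weight_mass v j (c :: cs) x =
   \int[mu]_y if (x < y < 1)%R then (decay v x y j)%:E * weight_mass v (j + step c)%R cs y else 0)%E.
Proof.
rewrite /weight_mass integral_lebnS; last 2 first.
- by apply/measurable_EFinP; exact: measurable_weight_tuple.
- by move=> t; rewrite lee_fin weight_ge0.
pose F y := (if (x < y < 1)%R then (decay v x y j)%:E * weight_mass v (j + step c)%R cs y else 0)%E.
have mF : measurable_fun setT F.
  apply: measurable_fun_ifT => //; first by apply: measurable_and; exact: measurable_fun_ltr.
  apply: emeasurable_funM; last exact: measurable_weight_mass.
  by apply/measurable_EFinP; exact: (@jointly_measurable_decay _ v j _ _ (fun=> tt) (fun=> x) id).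
have F0 y : (0 <= F y)%E.
  by rewrite /F; case: ifP => // _; rewrite mule_ge0 ?weight_mass_ge0// lee_fin expR_ge0.
rewrite -(integral_addl x mF F0); apply: eq_integral => s _.
rewrite /F /= ltrDl; case: ifPn => [/andP[s0 s1]|s0].
  rewrite /weight_mass -ge0_integralZl//; last 3 first.
  - by apply/measurable_EFinP; exact: measurable_weight_tuple.
  - by move=> t _; rewrite lee_fin weight_ge0.
  - by rewrite lee_fin expR_ge0.
  apply: eq_integral => t _; rewrite -EFinM /decay; congr (expR _ * _)%:E.
  by rewrite addrAC subrr add0r.
by rewrite integral0_eq.
Qed.

(** The recursion of fk chooses the sign and the time of one jump after the
    other; here all signs are chosen before the gaps are integrated. *)
Lemma fk_colors v n a b x j : x < 1 ->
  (fk (decay v) n a b x j = \sum_(cs <- colors n a b) weight_mass v j cs x)%E.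
Proof.
elim: n a b x j => [|n IH] a b x j x1.
  rewrite /=; case: ifP => _; last by rewrite big_nil.
  rewrite big_seq1 /weight_mass integral_lebn0//.
  by apply/measurable_EFinP; exact: (measurable_weight_tuple v j x (n := 0) [::]).
pose A y := (if a is a.+1 then \sum_(cs <- colors n a b) weight_mass v (j + 1)%R cs y else 0)%E.
pose B y := (if b is b.+1 then \sum_(cs <- colors n a b) weight_mass v (j - 1)%R cs y else 0)%E.
pose I (f : R -> \bar R) y := (if (x < y < 1)%R then (decay v x y j)%:E * f y else 0)%E.
have mI f : measurable_fun setT f -> measurable_fun setT (I f).
  move=> mf; apply: measurable_fun_ifT => //; first by apply: measurable_and; exact: measurable_fun_ltr.
  apply: emeasurable_funM => //.
  by apply/measurable_EFinP; exact: (@jointly_measurable_decay _ v j _ _ (fun=> tt) (fun=> x) id).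
have I0 f y : (forall z, 0 <= f z)%E -> (0 <= I f y)%E.
  by move=> f0; rewrite /I; case: ifP => // _; rewrite mule_ge0// lee_fin expR_ge0.
have sum0 (s : seq (seq bool)) i y : (0 <= \sum_(cs <- s) weight_mass v i cs y)%E.
  by apply: sume_ge0 => cs _; exact: weight_mass_ge0.
have msum' (s : seq (seq bool)) i : measurable_fun setT (fun y : R => (\sum_(cs <- s) weight_mass v i cs y)%E).
  by apply: emeasurable_sum => cs; exact: measurable_weight_mass.
have Isum (s : seq (seq bool)) i : (\int[mu]_y I (fun y => \sum_(cs <- s) weight_mass v i cs y) y =
    \sum_(cs <- s) \int[mu]_y I (fun y => weight_mass v i cs y) y)%E.
  rewrite -ge0_integral_sum//.
  - apply: eq_integral => y _; rewrite /I; case: ifP => _; last by rewrite big1.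
    by rewrite ge0_sume_distrr// => cs _; exact: weight_mass_ge0.
  - by move=> cs; apply: mI; exact: measurable_weight_mass.
  - by move=> cs y _; apply: I0 => z; exact: weight_mass_ge0.
transitivity (\int[mu]_y (I A y + I B y))%E.
  rewrite fkS; apply: eq_integral => y _; rewrite /I; case: ifP => [/andP[_ y1]|_]; last by rewrite adde0.
  rewrite -ge0_muleDr.
  - congr (_ * (_ + _))%E.
      by rewrite /A; case: (a) => // a'; exact: IH.
    by rewrite /B; case: (b) => // b'; exact: IH.
  - by rewrite /A; case: (a).
  - by rewrite /B; case: (b).
have A0 z : (0 <= A z)%E by rewrite /A; case: (a).
have B0 z : (0 <= B z)%E by rewrite /B; case: (b).
rewrite ge0_integralD//; last 4 first.
- by move=> y _; exact: I0.
- by apply: mI; rewrite /A; case: (a).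
- by move=> y _; exact: I0.
- by apply: mI; rewrite /B; case: (b).
rewrite /= big_cat/=; congr (_ + _)%E.
  rewrite /A; case: (a) => [|a'].
    by rewrite big_nil integral0_eq// => y _; rewrite /I mule0 if_same.
  rewrite Isum big_map; apply: eq_bigr => cs _; exact/esym/weight_mass_cons.
rewrite /B; case: (b) => [|b'].
  by rewrite big_nil integral0_eq// => y _; rewrite /I mule0 if_same.
rewrite Isum big_map; apply: eq_bigr => cs _; exact/esym/weight_mass_cons.
Qed.
End weight.

(** * The path measures *)

Section jump_map.
Context {R : realType}.
Local Notation mR := (measurableTypeR R).
Local Notation mu := (@lebesgue_measure R).
Implicit Types (v : int -> R) (x y : R) (j : int) (cs : seq bool) (t : seq R).

Definition epochs x t : seq R := scanl +%R x t.

Lemma size_epochs x t : size (epochs x t) = size t.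
Proof. exact: size_scanl. Qed.

Lemma path_epochs x t : all (fun s => 0 < s) t -> path <%R x (epochs x t).
Proof.
elim: t x => [//|s t IH] x /= /andP[s0 t0].
by rewrite ltrDl s0 IH.
Qed.

Lemma in_simplex_epochs x t u : in_simplex x t -> u \in epochs x t -> x < u < 1.
Proof.
elim: t x => [//|s t IH] x; rewrite in_simplex_cons => /andP[/andP[s0 xs1] H].
rewrite /= inE => /predU1P[->|/(IH _ H)/andP[xu ->]]; first by rewrite ltrDl s0 xs1.
by rewrite (lt_trans _ xu)// ltrDl.
Qed.

Lemma uniq_epochs x t : all (fun s => 0 < s) t -> uniq (epochs x t).
Proof.
by move=> /(path_epochs x)/path_sorted; apply: sorted_uniq; [exact: lt_trans|exact: ltxx].
Qed.

Lemma count_mask_sub (p : pred R) cs (l : seq R) : size cs = size l ->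
  (count p (mask cs l))%:Z - (count p (mask (map negb cs) l))%:Z =
  \sum_(k < size cs) if p l`_k then step (nth false cs k) else 0.
Proof.
elim: cs l => [|c cs IH] [|u l] //=; first by rewrite big_ord0 subrr.
move=> [/IH]; rewrite big_ord_recl/= => <-.
by case: c => /=; case: (p u) => /=; rewrite /step; lia.
Qed.

Lemma count_mask_sorted y cs (l : seq R) x : size cs = size l -> path <%R x l ->
  (count (<= y) (mask cs l))%:Z - (count (<= y) (mask (map negb cs) l))%:Z =
  \sum_(c <- take (count (<= y) l) cs) step c.
Proof.
elim: cs l x => [|c cs IH] [|u l] x //=; first by rewrite big_nil subrr.
move=> [sz] /andP[xu ul]; have {}IH := IH _ _ sz ul.
have [uy|yu] := leP u y.
  rewrite add1n big_cons -IH; case: c => /=; rewrite uy /step; lia.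
have c0 (l' : seq R) : {subset l' <= l} -> count (<= y) l' = 0%N.
  move=> l'l; apply/eqP; rewrite -leqn0 leqNgt -has_count; apply/hasPn => w /l'l wl.
  rewrite -ltNge; apply: lt_trans yu _.
  by move: ul; rewrite (path_sortedE lt_trans) => /andP[/allP ul _]; exact: ul.
have yuF : (u <= y) = false by apply/negbTE; rewrite -ltNge.
have cl : count (<= y) l = 0%N by exact: c0.
have cm m : count (<= y) (mask m l) = 0%N by apply: c0 => w; exact: mem_mask.
by rewrite cl take0 big_nil; case: c => /=; rewrite ?yuF !cm.
Qed.

Definition balanced cs := count id cs == count negb cs.

Definition split_epochs cs t : {fset R} * {fset R} :=
  (seq_fset tt (mask cs (epochs 0 t)), seq_fset tt (mask (map negb cs) (epochs 0 t))).

(** Gaps outside the simplex have weight zero, and the value there is a mere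
    default. *)
Definition jump_map cs t : jump_pair R :=
  if in_simplex 0 t && balanced cs then insubd (point : jump_pair R) (split_epochs cs t) else (point : jump_pair R).

Lemma mask_negb_disjoint (l : seq R) cs u : uniq l ->
  u \in mask cs l -> u \in mask (map negb cs) l -> False.
Proof.
elim: l cs => [|w l IH] [|c cs] //=; rewrite ?mask0// => /andP[wl ul].
case: c => /=; rewrite inE.
  by move=> /predU1P[->|/IH H /H//]; first by move=> /mem_mask; rewrite (negbTE wl).
by move=> um /predU1P[uw|/(IH _ ul um)//]; move: um; rewrite uw => /mem_mask; rewrite (negbTE wl).
Qed.

Lemma split_epochs_jump_pair cs t : size t = size cs -> in_simplex 0 t -> balanced cs ->
  is_jump_pair (split_epochs cs t).
Proof.
move=> sz st bal.
have t0 : all (fun s => 0 < s) t by case/andP: st.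
have ue := uniq_epochs 0 t0.
rewrite /split_epochs; set A := seq_fset _ _; set B := seq_fset _ _.
have AE u : (u \in A) = (u \in mask cs (epochs 0 t)) by exact: seq_fsetE.
have BE u : (u \in B) = (u \in mask (map negb cs) (epochs 0 t)) by exact: seq_fsetE.
have H1 : all (fun u => 0 < u < 1) A.
  by apply/allP => u; rewrite AE => /mem_mask; exact: in_simplex_epochs.
have H2 : all (fun u => 0 < u < 1) B.
  by apply/allP => u; rewrite BE => /mem_mask; exact: in_simplex_epochs.
have H3 : fdisjoint A B.
  apply/fdisjointP => u; rewrite AE BE => um; apply/negP.
  exact: mask_negb_disjoint um.
have H4 : #|` A|%fset == #|` B|%fset.
  rewrite !size_seq_fset !undup_id ?mask_uniq// !size_mask ?size_map ?size_epochs//.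
  by rewrite count_map; exact: bal.
by apply/and4P; split.
Qed.

Lemma jump_mapE cs t : size t = size cs -> in_simplex 0 t -> balanced cs ->
  jump_times (jump_map cs t) = split_epochs cs t.
Proof.
move=> sz st bal; rewrite /jump_map st bal /=.
by rewrite -[LHS]/(val _) val_insubd split_epochs_jump_pair.
Qed.

Lemma card_fset_le (l : seq R) y : uniq l ->
  #|` [fset u in seq_fset tt l | u <= y]%fset| = count (<= y) l.
Proof.
move=> ul; rewrite -size_filter -(undup_id (filter_uniq (<= y) ul)) -(size_seq_fset tt).
by congr (size _); congr (enum_fset _); apply/fsetP => u; rewrite !(inE, seq_fsetE, mem_filter) andbC.
Qed.

Lemma path_fun_sub cs t y : size t = size cs -> in_simplex 0 t -> balanced cs ->
  path_fun (jump_map cs t) y =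
  (count (<= y) (mask cs (epochs 0 t)))%:Z - (count (<= y) (mask (map negb cs) (epochs 0 t)))%:Z.
Proof.
move=> sz st bal; rewrite /path_fun /up_jumps /down_jumps jump_mapE//.
have t0 : all (fun s => 0 < s) t by case/andP: st.
by rewrite !card_fset_le ?mask_uniq ?uniq_epochs.
Qed.

(** The number of jump times up to y tells how many signs have been used. *)
Lemma path_fun_position cs t y : size t = size cs -> in_simplex 0 t -> balanced cs ->
  path_fun (jump_map cs t) y = position 0 cs (count (<= y) (epochs 0 t)).
Proof.
move=> sz st bal; rewrite path_fun_sub// (@count_mask_sorted _ _ _ 0) ?size_epochs//.
  by rewrite /position add0r.
by apply: path_epochs; case/andP: st.
Qed.

Lemma path_fun_point y : path_fun (point : jump_pair R) y = 0.
Proof.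
rewrite /path_fun /up_jumps /down_jumps /=.
have -> : [fset u in fset0 | u <= y]%fset = fset0 :> {fset R}.
  by apply/fsetP => u; rewrite !inE.
by rewrite cardfs0 subrr.
Qed.

Lemma n_up_jump_map cs t : size t = size cs ->
  (#|` up_jumps (jump_map cs t)| <= count id cs)%N.
Proof.
move=> sz; rewrite /jump_map; case: ifP => [/andP[st bal]|_]; last by rewrite (_ : up_jumps _ = fset0)%fset// cardfs0.
have -> : up_jumps (insubd (point : jump_pair R) (split_epochs cs t)) = (split_epochs cs t).1.
  by rewrite /up_jumps -[jump_times _]/(val _) val_insubd split_epochs_jump_pair.
rewrite /split_epochs; set A := seq_fset _ _; rewrite -[_.1]/A size_seq_fset.
by rewrite (leq_trans (size_undup _))// size_mask ?size_epochs.
Qed.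

(** The sigma-algebra on pairs of jump times is generated by the evaluations of
    the associated paths. *)
Lemma measurable_jump_pair d (T : measurableType d) (f : T -> jump_pair R) :
  (forall y (k : int), 0 <= y <= 1 -> measurable [set w | path_fun (f w) y = k]) ->
  measurable_fun setT f.
Proof.
move=> H.
have mpf : measurable_fun setT (@path_of R \o f).
  apply: (@measurability _ _ _ _ _ _ (@cadlag_cylinder R)) => // _ [C [y [k [y01 ->]]] <-].
  by rewrite setTI; exact: H.
move=> _ A [B mB <-]; rewrite !setTI -comp_preimage -[X in measurable X]setTI.
exact: mpf.
Qed.

Lemma measurable_in_simplex n : measurable_fun setT (fun t : n.-tuple mR => in_simplex 0 t).
Proof.
rewrite (_ : (fun u => _) = fun t : n.-tuple mR => 0 < weight (fun=> 0) 0 (nseq n true) 0 t).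
  apply: measurable_fun_ltr => //; exact: measurable_weight_tuple.
apply/funext => t; rewrite weightE ?size_nseq ?size_tuple//.
by case: ifP => _; rewrite ?expR_gt0 ?ltxx.
Qed.

Lemma measurable_epoch n k : measurable_fun setT (fun t : n.-tuple mR => (epochs 0 t)`_k).
Proof.
have [kn|nk] := ltnP k n; last first.
  rewrite (_ : (fun u => _) = fun=> 0) //; apply/funext => t.
  by rewrite nth_default// size_epochs size_tuple.
rewrite (_ : (fun u => _) = fun t : n.-tuple mR => \sum_(i < n) if (i <= k)%N then tnth t i else 0).
  apply: measurable_sum => i; case: (i <= k)%N => //; exact: measurable_tnth.
apply/funext => t; rewrite /epochs nth_scanl ?size_tuple//.
have foldE (l : seq R) (c : R) : foldl +%R c l = c + \sum_(s <- l) s.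
  by elim: l c => [|a l IH] c /=; rewrite ?big_nil ?addr0// big_cons IH addrA.
rewrite foldE add0r (big_nth 0) size_take size_tuple big_mkord.
have mE : (if (k.+1 < n)%N then k.+1 else n) = k.+1 by case: ltnP => //; lia.
rewrite -[RHS]big_mkcond mE (big_ord_widen_cond n xpredT (fun i => (take k.+1 t)`_i))//.
apply: eq_big => [i|i ik]; first by rewrite ltnS.
by rewrite nth_take// (tnth_nth 0).
Qed.

Lemma measurable_jump_map cs : measurable_fun setT (fun t : (size cs).-tuple mR => jump_map cs t).
Proof.
have [bal|/negbTE nbal] := boolP (balanced cs); last first.
  rewrite (_ : (fun u => _) = fun=> (point : jump_pair R)); first exact: measurable_cst.
  by apply/funext => t; rewrite /jump_map nbal andbF.
apply: measurable_jump_pair => y k _.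
(* The path at time y as a real function of the gaps. *)
pose F (t : (size cs).-tuple mR) : R := if in_simplex 0 t then
   \sum_(i < size cs) (if (epochs 0 t)`_i <= y then (step (nth false cs i))%:~R else 0) else 0.
have mF : measurable_fun setT F.
  apply: measurable_fun_ifT => //; first exact: measurable_in_simplex.
  apply: measurable_sum => i; apply: measurable_fun_ifT => //.
  by apply: measurable_fun_ler => //; exact: measurable_epoch.
rewrite (_ : [set t | _] = F @^-1` [set k%:~R]).
  by rewrite -[X in measurable X]setTI; apply: mF => //; exact: measurable_set1.
have FE (t : (size cs).-tuple mR) : F t = (path_fun (jump_map cs t) y)%:~R.
  rewrite /F; case: ifPn => [st|/negbTE st]; last first.
    by rewrite /jump_map st path_fun_point.
  rewrite path_fun_sub ?size_tuple// count_mask_sub ?size_epochs ?size_tuple//.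
  by rewrite rmorph_sum/=; apply: eq_bigr => i _; case: ifP.
by apply/seteqP; split=> u /=; rewrite FE; [move=> ->|move=> /intr_inj].
Qed.

Lemma measurable_weight_EFin v cs : measurable_fun setT (fun t : (size cs).-tuple mR => (weight v 0 cs 0 t)%:E).
Proof. by apply/measurable_EFinP; exact: measurable_weight_tuple. Qed.

Lemma weight_EFin_ge0 v cs (t : (size cs).-tuple mR) : (0 <= (weight v 0 cs 0 t)%:E)%E.
Proof. by rewrite lee_fin weight_ge0. Qed.

Definition gap_measure v cs : {measure set ((size cs).-tuple mR) -> \bar R} :=
  density (lebn (size cs)) (@measurable_weight_EFin v cs) (@weight_EFin_ge0 v cs).

Definition cs_measure v cs : {measure set (jump_pair R) -> \bar R} :=
  measure_function_pushforward__canonical__measure_function_Measure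
    (gap_measure v cs) (@measurable_jump_map cs).

Definition level_colors n := colors n.*2 n n.

Definition level_measure v n : {measure set (jump_pair R) -> \bar R} :=
  msum (fun i => cs_measure v (nth [::] (level_colors n) i)) (size (level_colors n)).

(** The unnormalized bridge: the jump times have as density the exponential of
    minus the integral of v along the path. *)
Definition path_measure v : {measure set (jump_pair R) -> \bar R} :=
  mseries (level_measure v) 0.

Lemma cs_measureE v cs A : cs_measure v cs A =
  (\int[lebn (size cs)]_(t in [set t | A (jump_map cs t)]) (weight v 0 cs 0 t)%:E)%E.
Proof. by []. Qed.

Lemma level_measureE v n A :
  level_measure v n A = (\sum_(cs <- level_colors n) cs_measure v cs A)%E.
Proof. by rewrite /level_measure /= /msum (big_nth [::]) big_mkord. Qed.

Lemma path_measureE v A : path_measure v A = (\sum_(0 <= n <oo) level_measure v n A)%E.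
Proof. by []. Qed.

Lemma level_measureT v n : level_measure v n setT = level_mass v n.
Proof. by rewrite level_measureE /level_mass fk_colors. Qed.

Lemma mem_level_colors n cs : cs \in level_colors n ->
  [/\ size cs = n.*2, count id cs = n, count negb cs = n & balanced cs].
Proof.
by rewrite mem_colors => /and3P[/eqP sz /eqP c1 /eqP c2]; split => //; rewrite /balanced c1 c2.
Qed.

Lemma integral_cs_measure v cs (f : jump_pair R -> \bar R) :
  measurable_fun setT f -> (forall U, 0 <= f U)%E ->
  (\int[cs_measure v cs]_U f U = \int[gap_measure v cs]_t f (jump_map cs t))%E.
Proof.
move=> mf f0.
have := @ge0_integral_pushforward _ _ _ _ R _ (@measurable_jump_map cs) (gap_measure v cs) setT f measurableT mf.
by rewrite preimage_setT; apply => U _; exact: f0.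
Qed.

Lemma integral_level_measure v n (f : jump_pair R -> \bar R) :
  measurable_fun setT f -> (forall U, 0 <= f U)%E ->
  (\int[level_measure v n]_U f U = \sum_(cs <- level_colors n) \int[cs_measure v cs]_U f U)%E.
Proof.
move=> mf f0; rewrite (big_nth [::]) big_mkord.
by apply: (ge0_integral_measure_sum (fun i => cs_measure v (nth [::] (level_colors n) i)) measurableT _ mf).
Qed.

Lemma integral_path_measure v (f : jump_pair R -> \bar R) :
  measurable_fun setT f -> (forall U, 0 <= f U)%E ->
  (\int[path_measure v]_U f U = \sum_(0 <= n <oo) \int[level_measure v n]_U f U)%E.
Proof. by move=> mf f0; exact: ge0_integral_measure_series. Qed.
End jump_map.

(** * Comparison of path measures *)

Section potentials.
Context {R : realType}.
Local Notation mR := (measurableTypeR R).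
Implicit Types (v : int -> R) (cs : seq bool).

(** The smallest potential which vanishes at 0 and has increments of size at
    most k. *)
Definition cone (k : R) (j : int) : R := - (k * (absz j)%:R).

Lemma norm_le_cone v (k : R) : v 0 = 0 -> (forall j, `|v (j + 1) - v j| <= k) ->
  forall j, `|v j| <= - cone k j.
Proof.
move=> v0 vk; have k0 : 0 <= k by exact: le_trans (vk 0).
have IHS (c d : R) n : `|c - d| <= k -> `|d| <= k * n%:R -> `|c| <= k * n.+1%:R.
  move=> cd dn; rewrite -(subrK d c) (le_trans (ler_normD _ _))// -natr1 mulrDr mulr1 addrC.
  exact: lerD.
rewrite /cone => -[] n; rewrite opprK.
  elim: n => [|n IH]; first by rewrite v0 normr0 mulr0.
  by apply: IHS IH; have := vk n%:Z; rewrite (_ : n%:Z + 1 = n.+1%:Z)//; lia.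
rewrite NegzE abszN.
elim: n => [|n IH].
  have := vk (- 1%:Z); rewrite (_ : - 1%:Z + 1 = 0); last by lia.
  by rewrite v0 sub0r normrN /= mulr1.
apply: IHS IH; rewrite distrC; have := vk (- n.+2%:Z).
by rewrite (_ : - n.+2%:Z + 1 = - n.+1%:Z)//; lia.
Qed.

Lemma cone_lip (k : R) : 0 <= k -> forall j, `|cone k (j + 1) - cone k j| <= k.
Proof.
move=> k0 j; rewrite /cone opprK addrC -mulrBr normrM ger0_norm// ler_piMr//.
have H1 : (absz (j + 1)%R <= absz j + 1)%N by lia.
have H2 : (absz j <= absz (j + 1)%R + 1)%N by lia.
by move: H1 H2; rewrite -!(ler_nat R) !natrD ler_norml; lra.
Qed.

(** The integral of v along the path with signs cs and gaps t. *)
Definition action v cs (t : seq R) : R :=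
  (\sum_(i < size cs) v (position 0 cs i) * t`_i)
  + v (position 0 cs (size cs)) * (1 - \sum_(s <- t) s).

Lemma weight_action v cs t : size t = size cs ->
  weight v 0 cs 0 t = if in_simplex 0 t then expR (- action v cs t) else 0.
Proof. by move=> st; rewrite weightE// /action opprD subr0. Qed.

Lemma action_le v (u : int -> R) cs t : size t = size cs -> in_simplex 0 t ->
  (forall j, `|v j| <= - u j) -> `|action v cs t| <= - action u cs t.
Proof.
move=> st /andP[t0]; rewrite add0r => /ltW t1 vu.
rewrite /action opprD -mulNr -[X in _ <= X + _]sumrN (le_trans (ler_normD _ _))// lerD//.
  rewrite (le_trans (ler_norm_sum _ _ _))//; apply: ler_sum => i _.
  rewrite normrM -mulNr (ger0_norm (x := t`_i)) ?ler_wpM2r//.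
    by apply: ltW; apply: (allP t0); rewrite mem_nth// st.
  by apply: ltW; apply: (allP t0); rewrite mem_nth// st.
by rewrite normrM (ger0_norm (x := 1 - _)) ?subr_ge0// ler_wpM2r// subr_ge0.
Qed.

Lemma weight_le v (u : int -> R) cs t : size t = size cs -> (forall j, `|v j| <= - u j) ->
  weight v 0 cs 0 t <= weight u 0 cs 0 t.
Proof.
move=> st vu; rewrite !weight_action//; case: ifP => // st0.
have := action_le st st0 vu; rewrite ler_norml ler_expR; lra.
Qed.

(** Convexity of the exponential: the actions of v and u add up to at most 0, so
    expR x >= 1 + x gives the bound. *)
Lemma weight_sum_ge v (u : int -> R) cs t : size t = size cs -> (forall j, `|v j| <= - u j) ->
  2 * weight (fun=> 0) 0 cs 0 t <= weight v 0 cs 0 t + weight u 0 cs 0 t.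
Proof.
move=> st vu; rewrite !weight_action//; case: ifP => [st0|_]; last by rewrite mulr0 addr0.
have := action_le st st0 vu; rewrite ler_norml => /andP[_ H].
have -> : action (fun=> 0) cs t = 0.
  by rewrite /action mul0r addr0 big1// => i _; rewrite mul0r.
rewrite oppr0 expR0 mulr1.
have H1 := expR_ge1Dx (- action v cs t); have H2 := expR_ge1Dx (- action u cs t).
by lra.
Qed.

Lemma gap_measure_le v (u : int -> R) cs : (forall j, `|v j| <= - u j) ->
  forall A, measurable A -> (gap_measure v cs A <= gap_measure u cs A)%E.
Proof.
move=> vu A mA; rewrite /gap_measure !densityE; apply: ge0_le_integral => //.
- by move=> t _; exact: weight_EFin_ge0.
- by apply: measurable_funTS; exact: measurable_weight_EFin.
- by apply: measurable_funTS; exact: measurable_weight_EFin.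
- by move=> t _; rewrite lee_fin weight_le// size_tuple.
Qed.

Lemma level_measure_le v (u : int -> R) n : (forall j, `|v j| <= - u j) ->
  forall A, measurable A -> (level_measure v n A <= level_measure u n A)%E.
Proof.
move=> vu A mA; rewrite !level_measureE; apply: lee_sum => cs _.
apply: gap_measure_le => //; rewrite -[X in measurable X]setTI.
exact: measurable_jump_map.
Qed.

Lemma level_measure_sum_ge v (u : int -> R) n : (forall j, `|v j| <= - u j) ->
  forall A, measurable A ->
  (2%:E * level_measure (fun=> 0%R) n A <= level_measure v n A + level_measure u n A)%E.
Proof.
move=> vu A mA; rewrite !level_measureE -big_split ge0_sume_distrr//=; last first.
  by move=> cs _; apply: integral_ge0 => t _; exact: weight_EFin_ge0.
apply: lee_sum => cs _.
have mB : measurable ((fun t : (size cs).-tuple mR => jump_map cs t) @^-1` A).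
  by rewrite -[X in measurable X]setTI; exact: measurable_jump_map.
rewrite /pushforward /gap_measure/= /density_of -ge0_integralZl//; last 2 first.
- by apply: measurable_funTS; exact: measurable_weight_EFin.
- by move=> t _; exact: weight_EFin_ge0.
rewrite -ge0_integralD//; last 4 first.
- by move=> t _; exact: weight_EFin_ge0.
- by apply: measurable_funTS; exact: measurable_weight_EFin.
- by move=> t _; exact: weight_EFin_ge0.
- by apply: measurable_funTS; exact: measurable_weight_EFin.
apply: ge0_le_integral => //.
- by move=> t _; rewrite mule_ge0// weight_EFin_ge0.
- by apply: measurable_funTS; apply: emeasurable_funM => //; exact: measurable_weight_EFin.
- by apply: measurable_funTS; apply: emeasurable_funD; exact: measurable_weight_EFin.
- by move=> t _; rewrite -EFinM -EFinD lee_fin weight_sum_ge// size_tuple.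
Qed.

Lemma path_measure_le v (u : int -> R) : (forall j, `|v j| <= - u j) ->
  forall A, measurable A -> (path_measure v A <= path_measure u A)%E.
Proof. by move=> vu A mA; apply: lee_nneseries => // n _; exact: level_measure_le. Qed.

Lemma path_measure_sum_ge v (u : int -> R) : (forall j, `|v j| <= - u j) ->
  forall A, measurable A ->
  (2%:E * path_measure (fun=> 0%R) A <= path_measure v A + path_measure u A)%E.
Proof.
move=> vu A mA; rewrite !path_measureE -nneseriesZl// -nneseriesD//.
by apply: lee_nneseries => [n _ _|n _]; [rewrite mule_ge0|exact: level_measure_sum_ge].
Qed.
End potentials.

Section measure_gap.
Context d (T : measurableType d) (R : realType) (m0 m1 : {measure set T -> \bar R}).
Local Open Scope ereal_scope.

(** This is the monotonicity in the measure of the integral of C - phi; the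
    masses are kept on both sides to avoid subtracting extended reals. *)
Lemma integral_gap (phi : T -> R) (C : R) : (forall A, measurable A -> m0 A <= m1 A) ->
  measurable_fun setT phi -> (forall x, (0 <= phi x <= C)%R) ->
  \int[m1]_x (phi x)%:E + C%:E * m0 setT <= \int[m0]_x (phi x)%:E + C%:E * m1 setT.
Proof.
move=> m01 mphi phiC.
have phi0 x : 0 <= (phi x)%:E by rewrite lee_fin; have /andP[] := phiC x.
have rem0 x : 0 <= (C - phi x)%:E by rewrite lee_fin subr_ge0; have /andP[] := phiC x.
have mrem : measurable_fun setT (fun x => (C - phi x)%:E).
  by apply/measurable_EFinP; exact: measurable_funB.
have mphi' : measurable_fun setT (fun x => (phi x)%:E) by exact/measurable_EFinP.
have split_ (m : {measure set T -> \bar R}) :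
    C%:E * m setT = \int[m]_x (phi x)%:E + \int[m]_x (C - phi x)%:E.
  rewrite -ge0_integralD// -integral_cst//; apply: eq_integral => x _.
  by rewrite -EFinD addrC subrK.
rewrite !split_ addeCA leeD2l// leeD2l//.
exact: ge0_le_measure_integral.
Qed.
End measure_gap.

Section level_estimates.
Context {R : realType}.
Local Open Scope ereal_scope.
Implicit Types (v : int -> R).

(** By the definition of a jump pair also the number of down jumps. *)
Definition n_jump (U : jump_pair R) : nat := #|` up_jumps U|.

Lemma integral_level_measure_le v n (phi : jump_pair R -> R) (C : R) :
  measurable_fun setT phi ->
  (forall U, (0 <= phi U)%R) -> (forall U, (n_jump U <= n)%N -> (phi U <= C)%R) ->
  \int[level_measure v n]_U (phi U)%:E <= C%:E * level_mass v n.
Proof.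
move=> mphi phi0 phiC; rewrite integral_level_measure//; last exact/measurable_EFinP.
rewrite -level_measureT level_measureE ge0_sume_distrr//.
rewrite big_seq [X in _ <= X]big_seq; apply: lee_sum => cs csn.
have [sz c1 _ _] := mem_level_colors csn.
rewrite integral_cs_measure//; last exact/measurable_EFinP.
have mj := @measurable_jump_map R cs.
rewrite [X in _ * X](_ : _ = gap_measure v cs setT)// -integral_cst//.
apply: ge0_le_integral => //.
- by move=> t _; rewrite lee_fin.
- by apply/measurable_EFinP; exact: (measurableT_comp mphi mj).
- by move=> t _; rewrite lee_fin phiC// -c1; apply: n_up_jump_map; rewrite size_tuple.
Qed.

(** On a single level phi is bounded, and the gap between the two integrals is at
    most C times the gap between the masses. *)
Lemma level_gap v n (phi : jump_pair R -> R) (C : R) :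
  (forall j, (`|0 : R| <= - v j)%R) -> measurable_fun setT phi ->
  (forall U, (0 <= phi U)%R) -> (forall U, (n_jump U <= n)%N -> (phi U <= C)%R) ->
  \int[level_measure v n]_U (phi U)%:E + C%:E * level_mass (fun=> 0%R) n <=
  \int[level_measure (fun=> 0%R) n]_U (phi U)%:E + C%:E * level_mass v n.
Proof.
move=> v0 mphi phi0 phiC; rewrite !integral_level_measure//; last 2 first.
  exact/measurable_EFinP.
  exact/measurable_EFinP.
rewrite -!level_measureT !level_measureE !ge0_sume_distrr// -!big_split/=.
rewrite big_seq [X in _ <= X]big_seq; apply: lee_sum => cs csn.
have [sz c1 _ _] := mem_level_colors csn.
rewrite !integral_cs_measure//; last 2 first.
  exact/measurable_EFinP.
  exact/measurable_EFinP.
rewrite /pushforward preimage_setT.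
apply: (@integral_gap _ _ _ (gap_measure (fun=> 0%R) cs) (gap_measure v cs)
  (fun t => phi (jump_map cs t)) C).
- by move=> A mA; exact: (@gap_measure_le _ (fun=> 0%R)).
- exact: (measurableT_comp mphi (@measurable_jump_map R cs)).
- by move=> t; rewrite phi0/= phiC// -c1; apply: n_up_jump_map; rewrite size_tuple.
Qed.

Lemma nneseriesS (f : nat -> \bar R) : (forall n, 0 <= f n) ->
  \sum_(0 <= n <oo) f n = f 0%N + \sum_(0 <= n <oo) f n.+1.
Proof.
move=> f0; rewrite nneseries_recl//; congr (_ + _).
by rewrite -(nneseries_addn 1)//; apply: eq_eseriesr => n _; rewrite addn1.
Qed.

Lemma integral_path_measure_le v (phi : jump_pair R -> R) :
  measurable_fun setT phi ->
  (forall U, (0 <= phi U)%R) -> (forall U, (phi U <= (n_jump U)%:R)%R) ->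
  \int[path_measure v]_U (phi U)%:E <= \sum_(0 <= n <oo) n.+1%:R%:E * level_mass v n.+1.
Proof.
move=> mphi phi0 phiN; rewrite integral_path_measure//; last exact/measurable_EFinP.
have H n : \int[level_measure v n]_U (phi U)%:E <= n%:R%:E * level_mass v n.
  apply: integral_level_measure_le => // U Un.
  by rewrite (le_trans (phiN U))// ler_nat.
rewrite nneseriesS; last by move=> n; apply: integral_ge0 => U _; rewrite lee_fin.
have := H 0%N; rewrite mul0e => H0.
rewrite [X in X + _](_ : _ = 0) ?add0e; last first.
  by apply/eqP; rewrite eq_le H0/= integral_ge0// => U _; rewrite lee_fin.
by apply: lee_nneseries => // n _ _; apply: integral_ge0 => U _; rewrite lee_fin.
Qed.

Lemma path_measureT v : path_measure v setT = \sum_(0 <= n <oo) level_mass v n.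
Proof. by rewrite path_measureE; apply: eq_eseriesr => n _; exact: level_measureT. Qed.

(** The recursion for the level masses, weakened by n + 1 <= (n + 1)^2, bounds the
    mean number of up jumps by 1 + excess k. *)
Lemma mean_jumps_le v k : (0 < k)%R -> (forall j, (`|v (j + 1) - v j| <= k)%R) ->
  \sum_(0 <= n <oo) n.+1%:R%:E * level_mass v n.+1 <= (1 + excess k)%:E * path_measure v setT.
Proof.
move=> k0 vk; rewrite path_measureT -nneseriesZl; last by move=> n _; exact: level_mass_ge0.
apply: lee_nneseries => [n _ _|n _]; first by rewrite mule_ge0// ?lee_fin// level_mass_ge0.
apply: le_trans (level_massS_le n k0 vk).
by rewrite lee_wpmul2r ?level_mass_ge0// lee_fin ler_nat expnS expn1 leq_pmulr.
Qed.

Lemma mean_jumps_flat :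
  \sum_(0 <= n <oo) n.+1%:R%:E * level_mass (fun=> 0%R) n.+1 <= path_measure (fun=> 0%R : R) setT.
Proof.
rewrite path_measureT.
apply: lee_nneseries => [n _ _|n _]; first by rewrite mule_ge0// ?lee_fin// level_mass_ge0.
rewrite !level_mass_flat -EFinM lee_fin factS expnMn natrM invfM mulrA.
rewrite ler_piMl ?invr_ge0//.
by rewrite ler_pdivrMr ?ltr0n ?expn_gt0// mul1r ler_nat expnS expn1 leq_pmulr.
Qed.

Lemma level_mass_le v k n : (0 < k)%R -> v 0%R = 0%R -> (forall j, (`|v (j + 1) - v j| <= k)%R) ->
  level_mass v n <= ((1 + excess k) ^+ n / (n`! ^ 2)%:R)%:E.
Proof.
move=> k0 v0 vk; have e0 := excess_ge0 k0.
elim: n => [|n IH]; first by rewrite level_mass0// expr0 mul1r invr1.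
have m0 : ((n.+1 ^ 2)%:R != 0 :> R)%R by rewrite pnatr_eq0 expn_eq0.
have -> : level_mass v n.+1 = ((n.+1 ^ 2)%:R^-1)%:E * ((n.+1 ^ 2)%:R%:E * level_mass v n.+1).
  by rewrite muleA -EFinM mulVf// mul1e.
have := level_massS_le n k0 vk => H.
apply: (@le_trans _ _ (((n.+1 ^ 2)%:R^-1)%:E * ((1 + excess k)%:E * ((1 + excess k) ^+ n / (n`! ^ 2)%:R)%:E))).
  rewrite lee_wpmul2l ?lee_fin ?invr_ge0//; apply: (le_trans H).
  by rewrite lee_wpmul2l// lee_fin addr_ge0.
rewrite -!EFinM lee_fin factS expnMn natrM invfM exprS.
by rewrite le_eqVlt; apply/orP; left; apply/eqP; ring.
Qed.

(** A mean value estimate in which 5 / 4 bounds 1 + e. *)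
Lemma power_sub1_le (e : R) n : (0 <= e <= 4^-1)%R ->
  ((1 + e) ^+ n.+1 - 1 <= n.+1%:R * e * (5 / 4) ^+ n)%R.
Proof.
move=> /andP[e0 e1]; elim: n => [|n IH]; first by rewrite !expr1 expr0; lra.
have q1 : (1 <= (5 / 4 : R) ^+ n)%R by apply: exprn_ege1; lra.
rewrite exprS [in X in (_ <= X)%R]exprS -natr1.
have a0 : (0 <= n.+1%:R * e * (5 / 4) ^+ n)%R by rewrite !mulr_ge0//; lra.
have H : ((1 + e) * (1 + e) ^+ n.+1 - 1 <= (1 + e) * (n.+1%:R * e * (5 / 4) ^+ n) + e)%R.
  have : ((1 + e) * ((1 + e) ^+ n.+1 - 1) <= (1 + e) * (n.+1%:R * e * (5 / 4) ^+ n))%R by rewrite ler_wpM2l//; lra.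
  lra.
apply: (le_trans H).
set q := ((5 / 4 : R) ^+ n)%R in q1 a0 *; set m := (n.+1%:R : R)%R in a0 *.
have : ((1 + e) * (m * e * q) <= 5 / 4 * (m * e * q))%R by rewrite ler_wpM2r//; lra.
have : (e <= e * (5 / 4 * q))%R by rewrite ler_peMr//; lra.
by nra.
Qed.

(** From n to n + 1 the right side grows by (n + 2)^2 and the left side by at
    most 15 / 2; the tightest case is n = 1, where the inequality is 30 <= 36. *)
Lemma fact_growth n : (n.+1%:R * n.+2%:R * (5 / 4) ^+ n * 2 ^+ n.+1 <= 9 * (n.+1`! ^ 2)%:R :> R)%R.
Proof.
elim: n => [|n IH]; first by rewrite expr0 expr1 (_ : (1`! ^ 2)%N = 1%N)//; lra.
case: n IH => [|n] IH; first by rewrite !exprS !expr0 (_ : (2`! ^ 2)%N = 4%N)//; lra.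
rewrite factS expnMn natrM [X in (_ <= X)%R]mulrCA.
have n0 : (0 <= n%:R :> R)%R by [].
set F := (9 * _)%R in IH *.
have F0 : (0 <= F)%R by rewrite mulr_ge0.
rewrite [((5 / 4) ^+ n.+2)%R]exprS [(2 ^+ n.+3)%R]exprS.
set A := ((5 / 4) ^+ n.+1)%R in IH *; set B := (2 ^+ n.+2)%R in IH *.
have A0 : (0 < A)%R by rewrite exprn_gt0.
have B0 : (0 < B)%R by rewrite exprn_gt0.
have -> : (n.+3%:R * n.+4%:R * (5 / 4 * A) * (2 * B) = (5 / 2 * n.+4%:R / n.+2%:R) * (n.+2%:R * n.+3%:R * A * B))%R.
  have : (n.+2%:R != 0 :> R)%R by rewrite pnatr_eq0.
  by move: (n.+2%:R : R)%R => c c0; field.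
apply: ler_pM => //.
  by apply: mulr_ge0 (ltW B0); apply: mulr_ge0 (ltW A0); exact: mulr_ge0.
rewrite ler_pdivrMr ?ltr0n// natrX -[in n.+4%:R]addn4 -[in n.+3%:R]addn3 -[in n.+2%:R]addn2 !natrD.
move: (n%:R : R)%R n0 => x x0.
have := mulr_ge0 x0 x0; have := mulr_ge0 (mulr_ge0 x0 x0) x0; lra.
Qed.

(** The factor n + 2 is the bound on level n + 1 of the test functions to be
    integrated; the factorials turn the geometric growth of the level masses
    into a summable error. *)
Lemma level_mass_gap v k n : (0 < k)%R -> v 0%R = 0%R -> (forall j, (`|v (j + 1) - v j| <= k)%R) ->
  (excess k <= 4^-1)%R ->
  n.+2%:R%:E * level_mass v n.+1 <=
  n.+2%:R%:E * level_mass (fun=> 0%R) n.+1 + ((9 * excess k) / (2 ^ n.+1)%:R)%:E.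
Proof.
move=> k0 v0 vk e1; have e0 := excess_ge0 k0.
apply: (@le_trans _ _ (n.+2%:R%:E * ((1 + excess k) ^+ n.+1 / (n.+1`! ^ 2)%:R)%:E)).
  by rewrite lee_wpmul2l ?lee_fin// level_mass_le.
rewrite level_mass_flat -!EFinM -EFinD lee_fin.
have f0 : (0 < (n.+1`! ^ 2)%:R :> R)%R by rewrite ltr0n expn_gt0 fact_gt0.
have H1 := @power_sub1_le (excess k) n; rewrite e0 e1 in H1; have {}H1 := H1 isT.
have H2 := fact_growth n.
have p0 : (0 < (2 ^ n.+1)%:R :> R)%R by rewrite ltr0n expn_gt0.
set X := ((1 + excess k) ^+ n.+1)%R in H1 *; set F := ((n.+1`! ^ 2)%:R : R)%R in f0 H2 *.
rewrite (_ : n.+2%:R * (X / F) = n.+2%:R * F^-1 + n.+2%:R * (X - 1) / F)%R; last by ring.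
rewrite lerD2l ler_pdivrMr// mulrAC ler_pdivlMr//.
apply: (@le_trans _ _ (n.+2%:R * (n.+1%:R * excess k * (5 / 4) ^+ n) * (2 ^ n.+1)%:R)%R).
  by rewrite ler_wpM2r// ler_wpM2l.
rewrite natrX; set A := ((5 / 4) ^+ n)%R in H2 *; set B := (2 ^+ n.+1)%R in H2 *.
rewrite (_ : n.+2%:R * (n.+1%:R * excess k * A) * B = excess k * (n.+1%:R * n.+2%:R * A * B))%R; last by ring.
by rewrite [X in (_ <= X)%R](_ : _ = excess k * (9 * F))%R ?ler_wpM2l//; ring.
Qed.
End level_estimates.

(** * Joint law of the jump chain and the holding times *)

Lemma exponential_tail {R : realType} (c s : R) : 0 < c -> 0 < s ->
  (\int[@lebesgue_measure R]_x (if (s < x)%R then (exponential_pdf c x)%:E else 0) = (expR (- c * s))%:E)%E.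
Proof.
move=> c0 s0; transitivity (\int[lebesgue_measure]_(x in `]s, +oo[) (exponential_pdf c x)%:E)%E.
  rewrite [RHS]integral_mkcond; apply: eq_integral => x _; rewrite patchE.
  by rewrite -[x \in _]/(x \in [set` _]) mem_setE in_itv/= andbT.
have mpdf : measurable_fun setT (EFin \o exponential_pdf c).
  by apply/measurable_EFinP; exact: measurable_exponential_pdf.
rewrite (@integral_itv_obnd_cbnd _ s +oo%O); last exact: measurable_funTS.
have cE : continuous (fun z : R^o => expR (- c * z)).
  move=> z; apply: continuous_comp; last exact: continuous_expR.
  by apply: continuousM => //; apply: (@continuousN _ R^o); exact: cst_continuous.
rewrite (@ge0_continuous_FTC2y _ _ (fun x => - (expR (- c * x))) _ 0)//.
- by rewrite EFinN oppeK add0e.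
- by move=> x _; apply: exponential_pdf_ge0; exact: ltW.
- apply: (@continuous_subspaceW R^o _ _ [set` `[0, +oo[%R]).
    by apply: subset_itv => //; rewrite bnd_simp ltW.
  exact: within_continuous_exponential_pdf.
- rewrite -oppr0; apply: cvgN.
  rewrite (_ : (fun x => expR (- c * x)) = (fun z => expR (- z)) \o (fun z => c * z)).
    by apply: (@cvg_comp _ _ _ _ _ _ (pinfty_nbhs R)); [exact: gt0_cvgMry|exact: cvgr_expR].
  by apply: eq_fun => x; rewrite mulNr.
- by apply: cvgN; apply/cvg_at_right_filter; exact: cE.
- move=> z; rewrite in_itv/= andbT => sz; apply: derive1_exponential_pdf.
  by rewrite in_itv/= andbT (lt_trans s0).
Qed.

Section almost_everywhere.
Context d (T : measurableType d) (R : realType) (P : {measure set T -> \bar R}).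

Lemma ae_forall_count (I : countType) (Q : I -> T -> Prop) :
  (forall i, {ae P, forall w, Q i w}) -> {ae P, forall w, forall i, Q i w}.
Proof.
move=> H.
pose Q' n w := if @choice.unpickle I n is Some i then Q i w else True.
have := ae_foralln (mu := P) (P := Q').
have H' n : {ae P, forall w, if @choice.unpickle I n is Some i then Q i w else True}.
  by case: (@choice.unpickle I n) => [i|]; [exact: H|exact: aeW].
move=> /(_ H'); apply: filterS => w /= Qw i; have := Qw (choice.pickle i).
by rewrite /Q' choice.pickleK.
Qed.

Lemma ae_eq_measure (A B : set T) : measurable A -> measurable B ->
  {ae P, forall w, A w <-> B w} -> P A = P B.
Proof.
move=> mA mB [N [mN N0 sub]].
have le (X Z : set T) : measurable X -> measurable Z ->
    (forall w, ~ N w -> X w -> Z w) -> (P X <= P Z)%E.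
  move=> mX mZ XZ; rewrite -(measureU0 mZ mN N0); apply: le_measure; rewrite ?inE//.
    exact: measurableU.
  by move=> w Xw; have [Nw|Nw] := pselect (N w); [right|left; exact: XZ].
have AB w : ~ N w -> A w <-> B w.
  by move=> Nw; apply: contrapT => /sub.
by apply/eqP; rewrite eq_le; apply/andP; split; apply: le => // w /AB [].
Qed.
End almost_everywhere.

Section jump_hold.
Context {R : realType}.
Local Notation mR := (measurableTypeR R).
Local Notation mu := (@lebesgue_measure R).
Variables (a b : int -> R).
Hypotheses (a0 : forall j, 0 < a j) (b0 : forall j, 0 < b j).
Context d (T : measurableType d) (P : probability T R).
Variables (Y : nat -> T -> int) (S : nat -> T -> R).
Hypothesis YS : is_jump_hold a b P Y S.
Local Notation c := (fun j => a j + b j).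
Local Notation rate i j := (jump_rate a b i j / (a i + b i)).

Let mY n i : measurable (Y n @^-1` [set i]). Proof. by case: YS. Qed.
Let mS n : measurable_fun setT (S n). Proof. by case: YS. Qed.

Lemma total_rate_gt0 j : 0 < a j + b j.
Proof. exact: addr_gt0. Qed.

Lemma exponential_prob_ge0 j B : (0 <= exponential_prob (a j + b j) B)%E.
Proof. by apply: integral_ge0 => x _; rewrite lee_fin exponential_pdf_ge0// ltW// total_rate_gt0. Qed.

Lemma measurable_Y n (i : nat -> int) : measurable [set w | forall k, (k <= n)%N -> Y k w = i k].
Proof.
rewrite (_ : [set w | _] = \bigcap_(k < n.+1) (Y k @^-1` [set i k])); last first.
  by apply/seteqP; split=> w /= H k; exact: H.
by apply: fin_bigcap_measurable => // k _; exact: mY.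
Qed.

Lemma measurable_S n (B : nat -> set R) : (forall k, measurable (B k)) ->
  measurable [set w | forall k, (k < n)%N -> B k (S k w)].
Proof.
move=> mB; rewrite (_ : [set w | _] = \bigcap_(k < n) (S k @^-1` B k)); last first.
  by apply/seteqP; split=> w /= H k; exact: H.
by apply: fin_bigcap_measurable => // k _; rewrite -[X in measurable X]setTI; exact: mS.
Qed.

(** The law of the walk is given on initial segments of the jump chain, of which
    there are countably many. *)
Lemma ae_prefix n (Q : T -> Prop) :
  (forall i : nat -> int, {ae P, forall w, (forall k, (k <= n)%N -> Y k w = i k) -> Q w}) ->
  {ae P, forall w, Q w}.
Proof.
move=> H.
have := @ae_forall_count _ _ _ P (seq int) (fun i w => (forall k, (k <= n)%N -> Y k w = nth 0 i k) -> Q w).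
move=> /(_ (fun i => H _)); apply: filterS => w Hw.
by apply: (Hw (mkseq (Y ^~ w) n.+1)) => k kn; rewrite nth_mkseq.
Qed.

Lemma ae_null (A : set T) : measurable A -> P A = 0%E -> {ae P, forall w, ~ A w}.
Proof. by move=> mA A0; exists A; split => // w /contrapT. Qed.

Lemma ae_steps n : {ae P, forall w, Y n.+1 w = Y n w + 1 \/ Y n.+1 w = Y n w - 1}.
Proof.
apply: (@ae_prefix n.+1) => i.
have [ok|/orP nok] := boolP ((i n.+1 == i n + 1) || (i n.+1 == i n - 1)).
  apply: aeW => w H; rewrite !H//.
  by case/orP: ok => /eqP ->; [left|right].
have mA : measurable [set w | (forall k, (k <= n.+1)%N -> Y k w = i k) /\
                   (forall k, (k < n.+1)%N -> setT (S k w))].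
  by apply: measurableI; [exact: measurable_Y|exact: (@measurable_S _ (fun=> setT))].
have : P [set w | (forall k, (k <= n.+1)%N -> Y k w = i k) /\
                   (forall k, (k < n.+1)%N -> setT (S k w))] = 0%E.
  case: YS => _ _ YSE; rewrite (YSE n.+1 i (fun=> setT))// big_ord_recr/= /jump_rate.
  rewrite !ifF ?mul0r ?mul0e ?mule0//; apply/negbTE/negP => H; apply: nok; rewrite H ?orbT; by [left|right].
move=> /(ae_null mA); apply: filterS => w nA H; exfalso; apply: nA; split => //.
Qed.

(** The defining formula leaves the holding time in the last state free.  It is
    recovered by summing over the next state, whose two possible values have
    probabilities adding up to 1. *)
Lemma holdE n (i : nat -> int) (B : nat -> set R) : (forall k, measurable (B k)) ->
  P [set w | (forall k, (k <= n)%N -> Y k w = i k) /\ (forall k, (k <= n)%N -> B k (S k w))] =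
  (P (Y 0%N @^-1` [set i 0%N]) * (\prod_(k < n) (rate (i k) (i k.+1))%:E)
   * \prod_(k < n.+1) exponential_prob (a (i k) + b (i k)) (B k))%E.
Proof.
move=> mB.
pose i' j k := if (k <= n)%N then i k else j.
(* The next state is j. *)
pose G j := [set w | (forall k, (k <= n.+1)%N -> Y k w = i' j k) /\ (forall k, (k < n.+1)%N -> B k (S k w))].
have mG j : measurable (G j) by apply: measurableI; [exact: measurable_Y|exact: measurable_S].
have PG j : P (G j) = (P (Y 0%N @^-1` [set i 0%N]) * (\prod_(k < n) (rate (i k) (i k.+1))%:E) *
    ((rate (i n) j)%:E * \prod_(k < n.+1) exponential_prob (a (i k) + b (i k)) (B k)))%E.
  rewrite /G; case: YS => _ _ -> //; rewrite big_split/= big_ord_recr/= !muleA; congr (_ * _ * _ * _)%E.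
  - by apply: eq_bigr => k _; rewrite /i' !ifT// ltnW.
  - by rewrite /i' leqnn ltnn.
  by apply: eq_bigr => k _; rewrite /i' ifT// -ltnS.
rewrite (@ae_eq_measure _ _ _ P _ (G (i n + 1) `|` G (i n - 1))); last 3 first.
- apply: measurableI; first exact: measurable_Y.
  exact: (@measurable_S n.+1).
- exact: measurableU.
- have := ae_steps n; apply: filterS => w stepw; split=> [[Yi SB]|].
    have Yj j : Y n.+1 w = j -> G j w.
      move=> Yj; split=> // k; rewrite leq_eqVlt ltnS => /predU1P[->|kn].
        by rewrite /i' ltnn.
      by rewrite /i' kn Yi.
    by case: stepw => Ye; [left|right]; apply: Yj; rewrite Ye Yi.
  by move=> [|] [Yi SB]; split=> // k kn; have := Yi k (leqW kn); rewrite /i' kn.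
transitivity (P (G (i n + 1)%R) + P (G (i n - 1)%R))%E.
  rewrite measureU// -subset0 => w [[/(_ n.+1 (leqnn _)) Y1 _] [/(_ n.+1 (leqnn _)) Y2 _]].
  by move: Y2; rewrite Y1 /i' ltnn => /addrI.
rewrite !PG -ge0_muleDr; last 2 first.
- rewrite mule_ge0// ?prode_ge0// => [|k _]; last exact: exponential_prob_ge0.
  by rewrite lee_fin /jump_rate eqxx divr_ge0// ltW// total_rate_gt0.
- rewrite mule_ge0// ?prode_ge0// => [|k _]; last exact: exponential_prob_ge0.
  rewrite lee_fin /jump_rate eqxx divr_ge0//; last by rewrite ltW// total_rate_gt0.
  by case: ifP => _; rewrite ltW.
rewrite -ge0_muleDl; last 2 first.
- by rewrite lee_fin /jump_rate eqxx divr_ge0// ltW// total_rate_gt0.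
- rewrite lee_fin /jump_rate eqxx divr_ge0//; last by rewrite ltW// total_rate_gt0.
  by case: ifP => _; rewrite ltW.
rewrite -EFinD /jump_rate !eqxx ifF; last by apply/negP => /eqP/addrI.
by rewrite -mulrDl divff ?mul1e// gt_eqF// total_rate_gt0.
Qed.

Lemma ae_S_gt0 n : {ae P, forall w, 0 < S n w}.
Proof.
apply: (@ae_prefix n) => i.
pose B k : set R := if k == n then `]-oo, 0]%classic else setT.
have mB k : measurable (B k) by rewrite /B; case: ifP.
have mA : measurable [set w | (forall k, (k <= n)%N -> Y k w = i k) /\ (forall k, (k <= n)%N -> B k (S k w))].
  by apply: measurableI; [exact: measurable_Y|exact: (@measurable_S n.+1)].
have := holdE n i mB; rewrite big_ord_recr/= [X in (_ * (_ * X))%E](_ : _ = 0%E) ?mule0; last first.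
  rewrite /B eqxx /exponential_prob.
  rewrite -(@integral_itv_bndo_bndc _ -oo%O 0); last first.
    by apply/measurable_funTS/measurable_EFinP; exact: measurable_exponential_pdf.
  apply: integral0_eq => x; rewrite /= in_itv/= => x0.
  by rewrite lt0_exponential_pdf.
move=> /(ae_null mA); apply: filterS => w nA H; rewrite ltNge; apply/negP => S0.
apply: nA; split => // k _; rewrite /B; case: eqP => [->|//].
by rewrite /= in_itv.
Qed.

Definition gaps m w : m.-tuple mR := [tuple S k w | k < m].
(** The last holding time comes first, where it can be integrated out first. *)
Definition all_gaps m w : m.+1.-tuple mR := tcons (S m w, gaps m w).

Lemma measurable_gaps m : measurable_fun setT (gaps m).
Proof.
apply/measurable_fun_tnthP => k.
rewrite (_ : _ \o _ = S k); first exact: mS.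
by apply/funext => w /=; rewrite tnth_mktuple.
Qed.

Lemma measurable_all_gaps m : measurable_fun setT (all_gaps m).
Proof.
apply: (measurableT_comp (@measurable_tcons R m)); apply: measurable_fun_pair; first exact: mS.
exact: measurable_gaps.
Qed.

Definition gap_pdf m (i : nat -> int) (k : nat) : R -> R :=
  if k is k.+1 then exponential_pdf (a (i k) + b (i k)) else exponential_pdf (a (i m) + b (i m)).

Lemma measurable_gap_pdf m i k : measurable_fun setT (gap_pdf m i k).
Proof. by case: k => [|k]; exact: measurable_exponential_pdf. Qed.

Lemma gap_pdf_ge0 m i k x : 0 <= gap_pdf m i k x.
Proof. by case: k => [|k]; apply: exponential_pdf_ge0; exact/ltW/total_rate_gt0. Qed.

Definition chain_weight m (i : nat -> int) : R :=
  fine (P (Y 0%N @^-1` [set i 0%N])) * \prod_(k < m) rate (i k) (i k.+1).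

Lemma rate_ge0 i j : 0 <= rate i j.
Proof.
rewrite divr_ge0//; last by rewrite ltW// total_rate_gt0.
by rewrite /jump_rate; case: ifP => _; [|case: ifP => _ //]; rewrite ltW.
Qed.

Lemma chain_weight_ge0 m i : 0 <= chain_weight m i.
Proof. by rewrite mulr_ge0 ?fine_ge0 ?prodr_ge0// => k _; exact: rate_ge0. Qed.

(** Both sides are finite measures of C, and they agree on boxes. *)
Lemma joint_law m (i : nat -> int) (C : set (m.+1.-tuple mR)) : measurable C ->
  P [set w | (forall k, (k <= m)%N -> Y k w = i k) /\ C (all_gaps m w)] =
  ((chain_weight m i)%:E * \int[lebn m.+1]_(t in C) (\prod_(k < m.+1) gap_pdf m i k (tnth t k))%:E)%E.
Proof.
pose D := [set w | forall k, (k <= m)%N -> Y k w = i k].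
have mD : measurable D by exact: measurable_Y.
have mh : measurable_fun [set: m.+1.-tuple mR] (fun t : m.+1.-tuple mR => (\prod_(k < m.+1) gap_pdf m i k (tnth t k))%:E).
  by apply/measurable_EFinP; apply: (measurable_prod_tuple (h := gap_pdf m i)) => k; exact: measurable_gap_pdf.
have h0 (t : m.+1.-tuple mR) : (0 <= (\prod_(k < m.+1) gap_pdf m i k (tnth t k))%:E)%E.
  by rewrite lee_fin; apply: prodr_ge0 => k _; exact: gap_pdf_ge0.
pose m1 := measure_function_pushforward__canonical__measure_function_Measure
   (mrestr P mD) (@measurable_all_gaps m).
pose m2 := mscale (NngNum (chain_weight_ge0 m i)) (density (lebn m.+1) mh h0).
have m1E A : m1 A = P [set w | (forall k, (k <= m)%N -> Y k w = i k) /\ A (all_gaps m w)].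
  by rewrite /m1/= /pushforward/= /mrestr setIC.
move=> mC; rewrite -m1E.
rewrite (@tuple_measure_unique _ _ m1 m2)//.
- rewrite m1E (le_lt_trans (probability_le1 _ _)) ?ltry//.
  rewrite (_ : [set w | _] = D)//.
  by apply/seteqP; split=> w // [].
move=> B mB; rewrite m1E.
(* Back to the chronological order of the holding times. *)
pose B' k := if (k < m)%N then B k.+1 else B 0%N.
have mB' k : measurable (B' k) by rewrite /B'; case: ifP.
transitivity (P [set w | (forall k, (k <= m)%N -> Y k w = i k) /\ (forall k, (k <= m)%N -> B' k (S k w))]).
  congr (P _); apply/seteqP; split=> w [Yw Bw]; split=> //.
    move=> k; rewrite leq_eqVlt /B' => /predU1P[->|km].
      by rewrite ltnn; have := Bw ord0; rewrite /all_gaps /tcons/= tnth0.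
    rewrite km; have := Bw (lift ord0 (Ordinal km)).
    by rewrite /all_gaps /tcons/= tnthS tnth_mktuple /= /bump.
  move=> k; case: (unliftP ord0 k) => [j ->|->] /=.
    rewrite tnthS tnth_mktuple /bump/= add1n.
    by have := Bw j (ltnW (ltn_ord j)); rewrite /B' ltn_ord.
  by rewrite tnth0; have := Bw m (leqnn m); rewrite /B' ltnn.
transitivity ((chain_weight m i)%:E * \int[lebn m.+1]_(t in box B) (\prod_(k < m.+1) gap_pdf m i k (tnth t k))%:E)%E; last by [].
rewrite holdE// (@integral_box R m.+1 (gap_pdf m i) B)//; last 2 first.
- by move=> k; exact: measurable_gap_pdf.
- by move=> k x; exact: gap_pdf_ge0.
rewrite /chain_weight EFinM fineK ?fin_num_measure// -prodEFin; congr (_ * _)%E.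
rewrite big_ord_recr/= big_ord_recl muleC; congr (_ * _)%E.
  by rewrite /B' ltnn.
by apply: eq_bigr => k _; rewrite /B' ltn_ord.
Qed.
End jump_hold.

(** * Trajectories of the walk *)

Section balance.
Context {R : realType}.
Variables (a b : int -> R).
Hypotheses (a0 : forall j, 0 < a j) (b0 : forall j, 0 < b j) (ab : forall j, a j * b (j + 1) = 1).

(** The function phi with a j = phi (j + 1) / phi j and
    b (j + 1) = phi j / phi (j + 1), normalized at 0. *)
Definition balance (j : int) : R :=
  match j with Posz n => \prod_(i < n) a i%:Z | Negz n => \prod_(i < n.+1) b (- i%:Z) end.

Lemma balance_gt0 j : 0 < balance j.
Proof. by case: j => n; apply: prodr_gt0. Qed.

Lemma balanceS j : balance (j + 1) = a j * balance j.
Proof.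
case: j => [n|[|n]]; first by rewrite -PoszD addn1 /balance big_ord_recr/= mulrC.
  rewrite (_ : Negz 0 + 1 = 0)//= big_ord0 big_ord1 oppr0 -(ab (Negz 0)).
  by [].
have -> : Negz n.+1 + 1 = Negz n by lia.
rewrite /balance [in RHS]big_ord_recr/= mulrCA.
by rewrite (_ : - n.+1%:Z = Negz n.+1 + 1) ?ab ?mulr1//; lia.
Qed.

Lemma jump_rate_balance j (c : bool) : jump_rate a b j (j + step c) = balance (j + step c) / balance j.
Proof.
have nz i : balance i != 0 by rewrite gt_eqF// balance_gt0.
case: c; rewrite /jump_rate /step.
  by rewrite eqxx balanceS mulfK.
rewrite ifF; last by apply/negP => /eqP/addrI.
rewrite eqxx; have := balanceS (j - 1); rewrite subrK => ->.
have := ab (j - 1); rewrite subrK => H; rewrite invfM mulrCA divff// mulr1.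
by apply: (mulfI (lt0r_neq0 (a0 (j - 1)))); rewrite H divff// gt_eqF.
Qed.

Lemma prod_rates j cs : \prod_(k < size cs) jump_rate a b (position j cs k) (position j cs k.+1) =
  balance (position j cs (size cs)) / balance j.
Proof.
have nz i : balance i != 0 by rewrite gt_eqF// balance_gt0.
elim: cs j => [|c cs IH] j; first by rewrite big_ord0 position0 divff.
rewrite big_ord_recl position0 !position_cons position0 jump_rate_balance.
under eq_bigr do rewrite !position_cons.
by rewrite IH mulrC -mulrA mulKf.
Qed.

Lemma position_balanced cs : balanced cs -> position 0 cs (size cs) = 0.
Proof. by rewrite position_size /balanced => /eqP ->; rewrite add0r subrr. Qed.

(** The quotients of phi telescope along the path, which is closed. *)
Lemma prod_rates_balanced cs : balanced cs ->
  \prod_(k < size cs) jump_rate a b (position 0 cs k) (position 0 cs k.+1) = 1.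
Proof.
by move=> bal; rewrite prod_rates position_balanced// divff// gt_eqF// balance_gt0.
Qed.
End balance.

Section trajectories.
Context {R : realType}.
Variables (y : nat -> int) (s : nat -> R).
Definition jump_time (n : nat) : R := \sum_(k < n) s k.

Lemma jump_timeS n : jump_time n.+1 = jump_time n + s n.
Proof. by rewrite /jump_time big_ord_recr. Qed.

Lemma jump_time_le m n : (m <= n)%N -> (forall k, (k < n)%N -> 0 < s k) -> jump_time m <= jump_time n.
Proof.
move=> /subnK <-; elim: (n - m)%N => [//|k IH] s0.
rewrite addSn jump_timeS (le_trans (IH _))//; first by move=> i ik; rewrite s0// addSn ltnW.
by rewrite lerDl ltW// s0// addSn.
Qed.

(** If the jump times accumulated at some T <= 1, the left limit of x at T would
    be the value of all late y n, although y changes at every step. *)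
Lemma no_explosion (x : R -> int) : is_cadlag x ->
  (forall n, y n.+1 = y n + 1 \/ y n.+1 = y n - 1) -> (forall n, 0 < s n) ->
  (forall n t, 0 <= t <= 1 -> jump_time n <= t < jump_time n.+1 -> x t = y n) ->
  exists n, 1 < jump_time n.
Proof.
move=> [_ xl] ystep s0 xy; apply: contrapT => /forallNP nt.
have t1 n : jump_time n <= 1 by rewrite leNgt; apply/negP/nt.
pose A := range jump_time.
have supA : has_sup A.
  by split; [exists (jump_time 0), 0%N|exists 1 => _ [n _ <-]].
have tS n : jump_time n < jump_time n.+1 by rewrite jump_timeS ltrDl.
have ltA n : jump_time n < sup A.
  by apply: lt_le_trans (tS n) _; apply: ub_le_sup; [case: supA|exists n.+1].
have A1 : sup A <= 1 by apply: ge_sup => [|_ [n _ <-]//]; case: supA.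
have A0 : 0 < sup A by have := ltA 0%N; rewrite /jump_time big_ord0.
have [l] := xl (sup A) (introT andP (conj A0 A1)).
rewrite /at_left /within/= => -[e /= e0 He].
have [_ [n _ <-] ln] := sup_adherent e0 supA.
have t0 k : 0 <= jump_time k by rewrite sumr_ge0// => i _; exact: ltW.
have ymn k : (n <= k)%N -> y k = l.
  move=> nk; rewrite -(xy k (jump_time k)) ?t0 ?t1 ?lexx ?tS//.
  apply: He => //=; rewrite gtr0_norm ?subr_gt0//.
  by rewrite ltrBlDr -ltrBlDl (lt_le_trans ln)// jump_time_le.
by have := ystep n; rewrite !ymn//; lia.
Qed.

Lemma exists_colors m : (forall n, y n.+1 = y n + 1 \/ y n.+1 = y n - 1) ->
  exists cs, size cs = m /\ forall k, (k <= m)%N -> y k = position (y 0%N) cs k.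
Proof.
move=> ystep; exists (mkseq (fun k => y k.+1 == y k + 1) m); split; first by rewrite size_mkseq.
elim=> [|k IH] km; first by rewrite position0.
have sz := size_mkseq (fun k => y k.+1 == y k + 1) m.
rewrite positionS; last by rewrite sz.
rewrite -(IH (ltnW km)) (nth_mkseq _ _ km) /step.
by have [->//|/eqP ne] := eqVneq (y k.+1) (y k + 1); case: (ystep k).
Qed.

Lemma mkseq_cons (f : nat -> R) m : mkseq f m.+1 = f 0%N :: mkseq (fun k => f k.+1) m.
Proof. by rewrite /mkseq /= -[1%N]addn0 iotaDl -map_comp. Qed.
End trajectories.

Section path_values.
Context {R : realType}.

Lemma sum_mkseq (s : nat -> R) m : \sum_(u <- mkseq s m) u = jump_time s m.
Proof. by rewrite /jump_time big_map /index_iota -{1}(subn0 m) -/(index_iota 0 m) big_mkord. Qed.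

Lemma epochs_mkseq x (s : nat -> R) m : epochs x (mkseq s m) = mkseq (fun k => x + jump_time s k.+1) m.
Proof.
elim: m x s => [//|m IH] x s; rewrite !mkseq_cons /= {}IH.
rewrite /jump_time big_ord_recl big_ord0 addr0; congr (_ :: _).
by apply: eq_mkseq => k; rewrite [in RHS]big_ord_recl addrA.
Qed.

Lemma path_value (x : R -> int) (y : nat -> int) (s : nat -> R) j cs :
  (forall n t, 0 <= t <= 1 -> jump_time s n <= t < jump_time s n.+1 -> x t = y n) ->
  (forall k, (k <= size cs)%N -> y k = position j cs k) ->
  in_simplex 0 (mkseq s (size cs)) -> 1 < jump_time s (size cs).+1 ->
  forall t, 0 <= t <= 1 -> x t = position j cs (count (<= t) (epochs 0 (mkseq s (size cs)))).
Proof.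
move=> xy ycs sim s1 t t01.
set l := epochs _ _; set k := count _ _.
have sl : size l = size cs by rewrite size_epochs size_mkseq.
have kc : (k <= size cs)%N by rewrite -sl count_size.
have lE i : (i < size cs)%N -> nth 0 l i = jump_time s i.+1.
  by move=> ic; rewrite /l epochs_mkseq nth_mkseq// add0r.
have srt : sorted <=%R l.
  have: sorted <%R l by apply: (@path_sorted _ _ 0); apply: path_epochs; case/andP: sim.
  by apply: sub_sorted => u w; exact: ltW.
rewrite -ycs//; apply: xy => //; apply/andP; split.
  case: {-1}k (erefl k) => [|k'] kk; first by rewrite /jump_time big_ord0; case/andP: t01.
  by rewrite -lE -?kk//; apply: nth_count_le => //; rewrite -/k kk.
have [kl|kl] := ltnP k (size cs).
  by rewrite -lE//; apply: nth_count_gt => //; rewrite -/k leqnn sl.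
rewrite (_ : k = size cs); last by apply/eqP; rewrite eqn_leq kc.
by case/andP: t01 => _ /le_lt_trans; apply.
Qed.

(** The generating evaluations only look at times between 0 and 1. *)
Lemma cylinder_saturated (A : set (cadlag R)) (x z : cadlag R) : measurable A ->
  (forall t, 0 <= t <= 1 -> x t = z t) -> A x -> A z.
Proof.
pose sat : set (set (cadlag R)) := [set B | forall x z : cadlag R,
  (forall t, 0 <= t <= 1 -> x t = z t) -> B x <-> B z].
suff: measurable `<=` sat by move=> H mA xz; case: (H _ mA _ _ xz).
apply: smallest_sub.
  split.
  - by [].
  - by move=> B HB u w uw; rewrite /setD/= (HB u w uw).
  - move=> F HF u w uw; split=> -[n _ Fn]; exists n => //.
      by rewrite -(HF n u w uw).
    by rewrite (HF n u w uw).
by move=> _ [t [k [t01 ->]]] u w uw /=; rewrite uw.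
Qed.
End path_values.

(** * Law of the jump times of a closed path *)

Section identification.
Context {R : realType}.
Local Notation mR := (measurableTypeR R).
Local Notation mu := (@lebesgue_measure R).
Variables (a b : int -> R).
Hypotheses (a0 : forall j, 0 < a j) (b0 : forall j, 0 < b j) (ab : forall j, a j * b (j + 1) = 1).
Context d (T : measurableType d) (P : probability T R).
Variables (Y : nat -> T -> int) (S : nat -> T -> R).
Hypothesis YS : is_jump_hold a b P Y S.
Local Notation c := (fun j => a j + b j).
Local Notation tau w n := (jump_time (S ^~ w) n).

Let c0 j : 0 < a j + b j. Proof. exact: addr_gt0. Qed.

Lemma sum_gaps m w : \sum_(u <- gaps S m w) u = tau w m.
Proof. by rewrite big_tuple; apply: eq_bigr => k _; rewrite tnth_mktuple. Qed.

Lemma gaps_mkseq m w : gaps S m w = mkseq (S ^~ w) m :> seq R.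
Proof.
apply: (@eq_from_nth _ 0); first by rewrite size_tuple size_mkseq.
move=> i; rewrite size_tuple => im.
by rewrite nth_mkseq// -[i]/(val (Ordinal im)) -tnth_nth tnth_mktuple.
Qed.

Lemma measurable_sum_tuple m : measurable_fun setT (fun t : m.-tuple mR => \sum_(u <- t) (u : R)).
Proof.
rewrite (_ : (fun t => _) = fun t : m.-tuple mR => \sum_(k < m) (tnth t k : R)).
  by apply: measurable_sum => k; exact: measurable_tnth.
by apply/funext => t; rewrite big_tuple.
Qed.

Lemma gap_pdf_tail_prod m (i : nat -> int) (t : m.-tuple mR) : all (fun s => 0 < s) (t : seq R) ->
  \prod_(k < m) gap_pdf a b m i k.+1 (tnth t k) =
  (\prod_(k < m) c (i k)) * expR (- \sum_(k < m) c (i k) * (t : seq R)`_k).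
Proof.
move=> /all_tnthP t0; rewrite -sumrN expR_sum -big_split/=; apply: eq_bigr => k _.
by rewrite -tnth_nth -mulNr; apply: exponential_pdfE; exact/ltW/t0.
Qed.

(** Given the earlier holding times, only one value of the last one makes the sum
    equal to 1. *)
Lemma ae_jump_time_neq1 n : {ae P, forall w, tau w n != 1}.
Proof.
case: n => [|m].
  by apply: aeW => w; rewrite /jump_time big_ord0 eq_sym oner_neq0.
apply: (ae_prefix (Y := Y) (n := m)) => i.
pose C := [set t : m.+1.-tuple mR | \sum_(u <- t) (u : R) = 1].
have mC : measurable C.
  rewrite -[X in measurable X]setTI.
  by apply: (@measurable_sum_tuple m.+1 measurableT [set 1]); exact: measurable_set1.
have mA : measurable [set w | (forall k, (k <= m)%N -> Y k w = i k) /\ C (all_gaps S m w)].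
  apply: measurableI; first exact: (measurable_Y YS).
  by rewrite -[X in measurable X]setTI; exact: (measurable_all_gaps YS).
have := joint_law a0 b0 YS i mC.
set J := (\int[_]_(_ in _) _)%E; have -> : J = 0%E.
  rewrite /J integral_mkcond integral_lebnS'; last 2 first.
  - apply/(measurable_restrictT _ mC)/measurable_funTS/measurable_EFinP.
    by apply: (@measurable_prod_tuple _ m.+1 (gap_pdf a b m i)) => k; exact: measurable_gap_pdf.
  - move=> t; apply: erestrict_ge0 => {}t _; rewrite lee_fin.
    by apply: prodr_ge0 => k _; exact: gap_pdf_ge0.
  apply: integral0_eq => t _.
  rewrite (@integral_point_neq _ _ (fun=> 0%E) (1 - \sum_(u <- t) (u : R)))//.
  - by rewrite integral0.
  - apply: (measurableT_comp (f := (fun t : m.+1.-tuple mR => (\prod_(k < m.+1) gap_pdf a b m i k (tnth t k))%:E) \_ C)).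
      apply/(measurable_restrictT _ mC)/measurable_funTS/measurable_EFinP.
      by apply: (@measurable_prod_tuple _ m.+1 (gap_pdf a b m i)) => k; exact: measurable_gap_pdf.
    apply: (measurableT_comp (@measurable_tcons R m)).
    by apply: measurable_fun_pair.
  - move=> s; apply: erestrict_ge0 => {}t _; rewrite lee_fin.
    by apply: prodr_ge0 => k _; exact: gap_pdf_ge0.
  - move=> s sn; rewrite patchE memNset// /C/= big_cons => st.
    by move: sn; rewrite -st addrK eqxx.
rewrite mule0 => /(ae_null mA); apply: filterS => w nA H; apply/eqP => t1; apply: nA; split => //.
by rewrite /C/= /all_gaps /tcons/= big_cons sum_gaps addrC -jump_timeS.
Qed.

(** The first size cs + 1 states are those of the path with signs cs, exactly
    size cs jumps occur before time 1, and their times lie in A. *)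
Definition bridge_event cs (A : set (jump_pair R)) := [set w |
  (forall k, (k <= size cs)%N -> Y k w = position 0 cs k) /\
  [/\ in_simplex 0 (gaps S (size cs) w), 1 < tau w (size cs).+1
    & A (jump_map cs (gaps S (size cs) w))]].

Let C cs (A : set (jump_pair R)) : set ((size cs).+1.-tuple mR) := (@tuncons R (size cs)) @^-1`
  [set p : mR * (size cs).-tuple mR | [/\ in_simplex 0 p.2, 1 < p.1 + \sum_(u <- p.2) (u : R) & A (jump_map cs p.2)]].

Let measurable_C cs A : measurable A -> measurable (@C cs A).
Proof.
move=> mA; rewrite -[X in measurable X]setTI; apply: measurable_tuncons => //.
rewrite (_ : [set p | _] = (snd @^-1` [set t : (size cs).-tuple mR | in_simplex 0 t]) `&`
  ([set p : mR * (size cs).-tuple mR | 1 < p.1 + \sum_(u <- p.2) (u : R)] `&`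
   (snd @^-1` [set t : (size cs).-tuple mR | A (jump_map cs t)]))).
  apply: measurableI; [|apply: measurableI].
  - rewrite -[X in measurable X]setTI; apply: measurable_snd => //.
    rewrite -[X in measurable X]setTI; exact: (measurable_in_simplex measurableT).
  - have mlt : measurable_fun setT (fun p : mR * (size cs).-tuple mR => 1 < p.1 + \sum_(u <- p.2) (u : R)).
      apply: measurable_fun_ltr => //; apply: measurable_funD => //.
      exact: (measurableT_comp (@measurable_sum_tuple (size cs))).
    by rewrite -[X in measurable X]setTI; exact: (mlt measurableT [set true]).
  - rewrite -[X in measurable X]setTI; apply: measurable_snd => //.
    by rewrite -[X in measurable X]setTI; exact: measurable_jump_map.
by apply/seteqP; split=> p /=; [case=> ? ? ?|case=> ? []].
Qed.

Lemma bridge_eventE cs A : bridge_event cs A =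
  [set w | (forall k, (k <= size cs)%N -> Y k w = position 0 cs k) /\ @C cs A (all_gaps S (size cs) w)].
Proof.
have tcK w : tuncons (all_gaps S (size cs) w) = (S (size cs) w, gaps S (size cs) w).
  exact: tconsK.
by apply/seteqP; split=> w /=; rewrite /C /preimage /mkset tcK /= sum_gaps addrC -jump_timeS.
Qed.

Lemma measurable_bridge_event cs A : measurable A -> measurable (bridge_event cs A).
Proof.
move=> mA; rewrite bridge_eventE; apply: measurableI; first exact: (measurable_Y YS).
by rewrite -[X in measurable X]setTI; apply: (measurable_all_gaps YS) => //; exact: (@measurable_C cs A).
Qed.

(** Integrating out the last holding time leaves the exponential of minus the
    remaining time.  The rates in the other exponential densities cancel the
    denominators of the transition probabilities, and the jump rates multiply
    to 1.  Since the gaps fill the unit interval, the factor expR (- c 0) can be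
    split off, which replaces the holding rate c by c - c 0. *)
Lemma bridge_event_law cs A : balanced cs -> measurable A ->
  P (bridge_event cs A) = ((fine (P (Y 0%N @^-1` [set 0%R])) * expR (- c 0))%:E *
    cs_measure (fun j => c j - c 0)%R cs A)%E.
Proof.
move=> bal mA; rewrite bridge_eventE (joint_law a0 b0 YS _ (@measurable_C cs A mA)).
set m := size cs; set i := position 0 cs; set h := gap_pdf a b m i.
have mA' : measurable [set t : m.-tuple mR | A (jump_map cs t)].
  by rewrite -[X in measurable X]setTI; exact: measurable_jump_map.
rewrite cs_measureE integral_mkcond [in RHS]integral_mkcond.
have mh : measurable_fun setT ((fun t : m.+1.-tuple mR => (\prod_(k < m.+1) h k (tnth t k))%:E) \_ (@C cs A)).
  apply/(measurable_restrictT _ (@measurable_C cs A mA))/measurable_funTS/measurable_EFinP.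
  by apply: (@measurable_prod_tuple _ m.+1 h) => k; exact: measurable_gap_pdf.
have h0 (t : m.+1.-tuple mR) : (0 <= ((fun t : m.+1.-tuple mR => (\prod_(k < m.+1) h k (tnth t k))%:E) \_ (@C cs A)) t)%E.
  by apply: erestrict_ge0 => {}t _; rewrite lee_fin; apply: prodr_ge0 => k _; exact: gap_pdf_ge0.
rewrite integral_lebnS'// -ge0_integralZl//; last 3 first.
- apply: (measurable_fun_fubini_tonelli_G (m1 := mu) (((fun t : m.+1.-tuple mR => (\prod_(k < m.+1) h k (tnth t k))%:E) \_ (@C cs A)) \o @tcons R m)) => //.
    exact: (measurableT_comp mh (@measurable_tcons R m)).
  by move=> p; exact: h0.
- by move=> t _; apply: integral_ge0.
- by rewrite lee_fin; exact: chain_weight_ge0.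
rewrite -ge0_integralZl//; last 3 first.
- by apply/(measurable_restrictT _ mA')/measurable_funTS; exact: measurable_weight_EFin.
- by move=> t _; apply: erestrict_ge0 => {}t _; exact: weight_EFin_ge0.
- by rewrite lee_fin mulr_ge0 ?fine_ge0 ?expR_ge0.
apply: eq_integral => t _; rewrite patchE.
have CE s : @C cs A (tcons (s, t)) = [/\ in_simplex 0 t, 1 < s + \sum_(u <- t) (u : R) & A (jump_map cs t)].
  by rewrite /C /preimage /mkset tconsK.
have [st|st] := boolP (in_simplex 0 t); last first.
  rewrite integral0_eq ?mule0; last by move=> s _; rewrite patchE memNset// CE => -[]; rewrite (negbTE st).
  by rewrite weightE ?size_tuple// (negbTE st) if_same mule0.
case: ifPn; rewrite ?inE ?notin_setE => At; last first.
  by rewrite integral0_eq ?mule0// => s _; rewrite patchE memNset// CE => -[].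
have t0 : all (fun s => 0 < s) (t : seq R) by case/andP: st.
have s1 : 0 < 1 - \sum_(u <- t) (u : R) by case/andP: st; rewrite subr_gt0 add0r.
transitivity ((chain_weight a b P Y m i)%:E * \int[mu]_s ((\prod_(k < m) h k.+1 (tnth t k))%:E *
   (if (1 - \sum_(u <- t) (u : R) < s)%R then (exponential_pdf (c (i m)) s)%:E else 0)))%E.
  congr (_ * _)%E; apply: eq_integral => s _; rewrite patchE.
  case: ifPn; rewrite ?inE ?notin_setE CE => Hs.
    case: Hs => _ s1' _; rewrite ltrBlDr s1' -EFinM big_ord_recl/= tnth0 mulrC; congr (_ * _)%:E.
    by apply: eq_bigr => k _; rewrite tnthS.
  by case: ifPn; rewrite ?mule0// ltrBlDr => s1'; exfalso; apply: Hs.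
rewrite ge0_integralZl//; last 3 first.
- by apply: measurable_fun_ifT => //; [exact: measurable_fun_ltr|apply/measurable_EFinP; exact: measurable_exponential_pdf].
- by move=> s _; case: ifP => // _; rewrite lee_fin exponential_pdf_ge0// ltW.
- by rewrite lee_fin; apply: prodr_ge0 => k _; exact: gap_pdf_ge0.
rewrite exponential_tail// -!EFinM; congr EFin.
rewrite /h gap_pdf_tail_prod// weightE ?size_tuple// st /chain_weight.
rewrite (_ : i 0%N = 0); last exact: position0.
rewrite big_split/= prodfV prod_rates_balanced// mul1r.
set X := (\prod_(k < m) _)%R; have X0 : X != 0 by apply/prodf_neq0 => k _; rewrite gt_eqF.
rewrite [LHS](_ : _ = fine (P (Y 0%N @^-1` [set 0])) *
   (expR (- \sum_(k < m) c (i k) * (t : seq R)`_k) * expR (- c (i m) * (1 - \sum_(u <- t) (u : R))))); last first.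
  by field.
rewrite -mulrA -!expRD; congr (_ * expR _).
have im : i m = 0 by exact: position_balanced.
rewrite -/m -/i im subr0 subrr mul0r subr0.
have -> : \sum_(k < m) (c (i k) - c 0) * (t : seq R)`_k = \sum_(k < m) c (i k) * (t : seq R)`_k - c 0 * \sum_(u <- t) (u : R).
  rewrite mulr_sumr big_tuple -sumrB; apply: eq_bigr => k _.
  by rewrite (tnth_nth 0); ring.
by ring.
Qed.
End identification.

(** * Bridges are normalized path measures *)

Section bridge_event_disjoint.
Context {R : realType} d (T : measurableType d) (Y : nat -> T -> int) (S : nat -> T -> R).

Lemma position_inj cs cs' : size cs = size cs' ->
  (forall k, (k <= size cs)%N -> position 0 cs k = position 0 cs' k) -> cs = cs'.
Proof.
move=> sz H; apply: (@eq_from_nth _ false) => // k kc.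
have := H k.+1 kc; rewrite !positionS -?sz// H ?(ltnW kc)// => /addrI.
by rewrite /step; case: (nth _ cs k); case: (nth _ cs' k).
Qed.

(** The number of jumps before time 1 and the states visited determine the signs. *)
Lemma bridge_event_inj cs cs' A w :
  bridge_event Y S cs A w -> bridge_event Y S cs' A w -> cs = cs'.
Proof.
have lt_size c c' : bridge_event Y S c A w -> bridge_event Y S c' A w -> (size c < size c')%N -> False.
  move=> [_ [_ c1 _]] [_ [st _ _]] cc.
  have := st; rewrite gaps_mkseq => /andP[/allP s0]; rewrite add0r sum_mkseq => t1.
  have := lt_trans t1 c1; rewrite ltNge jump_time_le// => k kc.
  by apply: s0; apply/mapP; exists k => //; rewrite mem_iota.
move=> H H'; have sz : size cs = size cs'.
  by case: (ltngtP (size cs) (size cs')) => // [/(lt_size _ _ H H')|/(lt_size _ _ H' H)].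
case: H H' => [Y1 _] [Y2 _]; apply: position_inj => // k kc.
by rewrite -Y1// Y2// -sz.
Qed.
End bridge_event_disjoint.

Section bridge_law.
Context {R : realType}.
Variables (a b : int -> R).
Hypotheses (a0 : forall j, 0 < a j) (b0 : forall j, 0 < b j) (ab : forall j, a j * b (j + 1) = 1).

Definition rate_excess (j : int) : R := (a j + b j) - (a 0 + b 0).

Let E := [set x : cadlag R | x 0 = 0 /\ x 1 = 0].

Lemma measurable_closed_paths : measurable E.
Proof.
apply: measurableI; apply: sub_sigma_algebra.
  by exists 0, 0; split => //; rewrite lexx ler01.
by exists 1, 0; split => //; rewrite lexx ler01.
Qed.

(** Almost surely, the walk is at 0 at the times 0 and 1 if and only if one of
    the disjoint bridge events occurs, and it then follows the path of the
    resulting pair of jump times. *)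
Lemma walk_law_path_measure (law : probability (cadlag R) R) : is_walk_law a b law ->
  exists2 K : R, 0 <= K & forall A : set (cadlag R), measurable A ->
    law (A `&` E) = (K%:E * path_measure rate_excess (@path_of R @^-1` A))%E.
Proof.
move=> [d [T [P [Y [S [X [YS walk lawE]]]]]]].
exists (fine (P (Y 0%N @^-1` [set 0])) * expR (- (a 0 + b 0))).
  by rewrite mulr_ge0 ?fine_ge0 ?expR_ge0.
move=> A mA; set K := (_ * _)%R; set A' := (path_of (R:=R) @^-1` A).
have mA' : measurable A' by exists A => //; rewrite setTI.
have mE := measurable_closed_paths.
rewrite lawE; last exact: measurableI.
pose F n := \bigcup_(cs in [set` level_colors n]) bridge_event Y S cs A'.
have mF n : measurable (F n).
  apply: fin_bigcup_measurable; first exact: finite_seq.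
  by move=> cs _; exact: (measurable_bridge_event YS).
have -> : distribution P X (A `&` E) = P (\bigcup_n F n).
  rewrite /distribution /pushforward.
  apply: ae_eq_measure.
  - rewrite -[X in measurable X]setTI; exact: (measurable_funPT X) _ _ (measurableI _ _ mA mE).
  - exact: bigcupT_measurable.
  have st := ae_foralln (ae_steps YS).
  have sg := ae_foralln (ae_S_gt0 a0 b0 YS).
  have s1 := ae_foralln (ae_jump_time_neq1 a0 b0 YS).
  have : {ae P, forall w, (forall n, Y n.+1 w = Y n w + 1 \/ Y n.+1 w = Y n w - 1) /\
      (forall n, 0 < S n w) /\ (forall n, jump_time (S ^~ w) n != 1)}.
    by apply: filterS3 st sg s1 => w.
  move: walk; apply: filterS2 => w xy [ystep [s0 t1]] /=.
  have X0E : X w 0 = Y 0%N w.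
    apply: xy; first by rewrite lexx ler01.
    by rewrite big_ord0 big_ord1 lexx s0.
  have val cs t : (forall k, (k <= size cs)%N -> Y k w = position 0 cs k) ->
      in_simplex 0 (gaps S (size cs) w) -> 1 < jump_time (S^~ w) (size cs).+1 -> balanced cs ->
      0 <= t <= 1 -> X w t = path_fun (jump_map cs (gaps S (size cs) w)) t.
    move=> ycs sim t1' bal t01; rewrite path_fun_position ?size_tuple//.
    move: sim; rewrite gaps_mkseq => sim.
    exact: (path_value xy ycs).
  split.
    move=> [Xw [X0 X1]].
    have [n tn] : exists n, 1 < jump_time (S^~ w) n.
      exact: (no_explosion (cadlagP (X w)) ystep s0 xy).
    case: (ex_minnP (ex_intro (fun n => 1 < jump_time (S^~ w) n) n tn)) => m tm mmin.
    have [m' mm'] : exists m', m = m'.+1.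
      by case: m tm {mmin} => [|m' _]; [rewrite /jump_time big_ord0 ltr10|exists m'].
    have tm' : jump_time (S^~ w) m' < 1.
      rewrite lt_neqAle t1/= leNgt; apply/negP => /mmin; rewrite mm' ltnn.
      by [].
    have [cs [szcs ycs]] := exists_colors m' ystep.
    have Y0 : Y 0%N w = 0 by rewrite -X0E.
    have Ym : Y m' w = 0.
      by rewrite -X1 (xy m' 1) ?ler01 ?lexx//; rewrite ltW//= -mm'.
    have sim : in_simplex 0 (gaps S (size cs) w).
      rewrite gaps_mkseq /in_simplex add0r sum_mkseq szcs tm' andbT.
      by apply/allP => _ /mapP[k _ ->].
    have bal : count id cs = count negb cs.
      by have := ycs m' (leqnn _); rewrite Ym Y0 -szcs position_size; lia.
    have ycs0 k : (k <= size cs)%N -> Y k w = position 0 cs k by rewrite szcs => /ycs; rewrite Y0.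
    have t1' : 1 < jump_time (S^~ w) (size cs).+1 by rewrite szcs -mm'.
    exists (count id cs) => //; exists cs.
      rewrite /= mem_colors -bal !eqxx !andbT -(count_predC id cs) -addnn.
      by rewrite [X in _ == (_ + X)%N]bal.
    split=> //; split => //; apply: cylinder_saturated mA _ Xw => t t01.
    by rewrite (val cs)// /balanced bal.
  move=> [n _ [cs /= csn [ycs [sim t1' Aw]]]].
  have [_ _ _ bal] := mem_level_colors csn.
  have H t := val cs t ycs sim t1' bal.
  split; last split.
  - by apply: cylinder_saturated Aw => // t t01; rewrite H.
  - by rewrite X0E ycs// position0.
  - rewrite (xy (size cs) 1) ?ler01 ?lexx//; first by rewrite ycs// position_balanced.
    move: sim; rewrite gaps_mkseq => /andP[_]; rewrite add0r sum_mkseq => tl.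
    by apply/andP; split; [exact: ltW|exact: t1'].
rewrite measure_bigcup//; last first.
  move=> i j _ _ [w [[cs /= csi Hi] [cs' /= csj Hj]]].
  have [szi _ _ _] := mem_level_colors csi; have [szj _ _ _] := mem_level_colors csj.
  apply: double_inj; rewrite -szi -szj; congr size; exact: bridge_event_inj Hi Hj.
rewrite path_measureE -nneseriesZl//.
rewrite (eq_eseriesl (Q := xpredT)); last by move=> n; rewrite in_setT.
apply: eq_eseriesr => n _; rewrite /F measure_fin_bigcup//; last 3 first.
- exact: finite_seq.
- by move=> cs cs' _ _ [w [Hi Hj]]; exact: bridge_event_inj Hi Hj.
- by move=> cs _; exact: (measurable_bridge_event YS).
rewrite -fsbig_seq ?uniq_colors// level_measureE ge0_sume_distrr//.
rewrite !big_seq; apply: eq_bigr => cs /mem_level_colors[_ _ _ bal].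
exact: (bridge_event_law a0 b0 ab YS).
Qed.

(** Conditioning only changes the normalization.  That the bridge has mass 1
    shows that both factors of proportionality are positive. *)
Lemma bridge_path_measure (law : probability (cadlag R) R) (nu : probability (jump_pair R) R) :
  is_walk_law a b law -> is_bridge_law law nu ->
  exists2 Z : R, 0 < Z & forall A, measurable A -> path_measure rate_excess A = (Z%:E * nu A)%E.
Proof.
move=> /walk_law_path_measure[K K0 HK] Hnu.
set p := fine (law E) in Hnu *.
have pE : law E = p%:E by rewrite fineK// fin_num_measure//; exact: measurable_closed_paths.
have p0 : p != 0.
  apply/eqP => p0; have := Hnu setT measurableT.
  by rewrite preimage_setT probability_setT setTI -/E pE p0 mul0e => /eqP; rewrite onee_eq0.
have nuK (A : set (cadlag R)) : measurable A ->
    (p%:E * nu (@path_of R @^-1` A) = K%:E * path_measure rate_excess (@path_of R @^-1` A))%E.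
  by move=> mA; rewrite -HK// Hnu// -/E -/p muleCA -EFinM divff ?mule1.
have {}K0 : 0 < K.
  rewrite lt_neqAle K0 andbT eq_sym; apply/eqP => K00; move: p0.
  have := nuK setT measurableT; rewrite preimage_setT probability_setT K00 mul0e mule1 => -[->].
  by rewrite eqxx.
have {}p0 : 0 < p by rewrite lt_neqAle eq_sym p0 fine_ge0.
exists (p / K); first exact: divr_gt0.
move=> _ [A mA <-]; rewrite setTI EFinM muleAC nuK// muleAC -EFinM divff ?mul1e//.
by rewrite gt_eqF.
Qed.
End bridge_law.

(** * Lipschitz functions and the gap between path measures *)

Section lipschitz.
Context {R : realType}.
Implicit Types (U V : jump_pair R) (f : jump_pair R -> R).

Lemma lip_neighbour f U V : Lip1 f -> neighbour U V -> `|f U - f V| <= 1.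
Proof.
move=> [_ lip] UV; rewrite -lee_fin (le_trans (lip U V))// ereal_inf_lbound//.
by exists [:: V] => //=; rewrite UV.
Qed.

Lemma n_jump0 U : n_jump U = 0%N -> U = point.
Proof.
move=> n0; have /and4P[_ _ _ /eqP cd] := valP U.
apply: val_inj; rewrite /=; case: U n0 cd => -[up dn] /= H.
rewrite /n_jump /up_jumps/= => upn cd; move: upn cd => /cardfs0_eq -> /esym.
by rewrite cardfs0 => /cardfs0_eq ->.
Qed.

Lemma remove_pair U n : n_jump U = n.+1 -> exists2 V, neighbour V U & n_jump V = n.
Proof.
move=> nU; have /and4P[up01 dn01 dis /eqP cd] := valP U.
have [r rU] : exists r, r \in up_jumps U.
  by apply/fset0Pn; rewrite -cardfs_gt0; rewrite /n_jump in nU; rewrite nU.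
have [s sU] : exists s, s \in down_jumps U.
  by apply/fset0Pn; rewrite -cardfs_gt0 -[#|` _|]cd; rewrite /n_jump in nU; rewrite [X in (0 < X)%N]nU.
pose V := Psi r s U.
have pV : is_jump_pair (up_jumps U `\ r, down_jumps U `\ s)%fset.
  apply/and4P; split => /=.
  - by apply/allP => u; rewrite in_fsetD1 => /andP[_ uU]; exact: (allP up01).
  - by apply/allP => u; rewrite in_fsetD1 => /andP[_ uU]; exact: (allP dn01).
  - by rewrite (fdisjointWl (fsubD1set _ _))// (fdisjointWr (fsubD1set _ _)).
  - apply/eqP/(@addnI 1%N).
    have <- : #|` up_jumps U| = (1 + #|` (up_jumps U `\ r)%fset|)%N by rewrite (cardfsD1 r) rU.
    have <- : #|` down_jumps U| = (1 + #|` (down_jumps U `\ s)%fset|)%N by rewrite (cardfsD1 s) sU.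
    exact: cd.
have VE : jump_times V = (up_jumps U `\ r, down_jumps U `\ s)%fset.
  by rewrite /V /Psi rU sU /= -[jump_times _]/(val _) val_insubd pV.
have nV : n_jump V = n.
  apply: (@addnI 1%N); rewrite !add1n -nU /n_jump (cardfsD1 r (up_jumps U)) rU.
  by rewrite {1}/up_jumps VE.
exists V => //; apply/andP; split.
  by apply/eqP => VU; move: nV; rewrite VU nU; lia.
apply/asboolP; exists r, s; split => //.
- exact: (allP up01).
- exact: (allP dn01).
- by apply/eqP => rs; have /fdisjointP/(_ _ rU) := dis; rewrite rs sU.
Qed.

(** Remove the pairs of jumps one after the other. *)
Lemma lip_le_n_jump f U : Lip1 f -> `|f U - f point| <= (n_jump U)%:R.
Proof.
move=> lip; move nU : (n_jump U) => n; elim: n U nU => [|n IH] U nU.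
  by rewrite (n_jump0 nU) subrr normr0.
have [V /(lip_neighbour lip) VU /IH Vp] := remove_pair nU.
rewrite (_ : f U - f point = (f V - f point) - (f V - f U)); last by ring.
by rewrite (le_trans (ler_normB _ _))// -natr1 lerD.
Qed.
End lipschitz.

Section scaled_integrals.
Context {R : realType}.
Local Open Scope ereal_scope.
Implicit Types (v : int -> R) (phi : jump_pair R -> R).

Lemma integral_scaled v (m : probability (jump_pair R) R) (Z : R) phi : (0 <= Z)%R ->
  (forall A, measurable A -> path_measure v A = Z%:E * m A) ->
  measurable_fun setT phi -> (forall U, (0 <= phi U)%R) ->
  \int[path_measure v]_U (phi U)%:E = Z%:E * \int[m]_U (phi U)%:E.
Proof.
move=> Z0 H mphi phi0.
rewrite -(@ge0_integral_mscale _ _ _ m setT measurableT (NngNum Z0) (EFin \o phi))//.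
- apply: eq_measure_integral => A mA _; exact: H.
- exact/measurable_EFinP.
- by move=> U _; rewrite lee_fin.
Qed.

Lemma integral_path_measure_mono v (u : int -> R) phi : (forall j, (`|v j| <= - u j)%R) ->
  measurable_fun setT phi -> (forall U, (0 <= phi U)%R) ->
  \int[path_measure v]_U (phi U)%:E <= \int[path_measure u]_U (phi U)%:E.
Proof.
move=> vu mphi phi0.
apply: (@ge0_le_measure_integral _ _ _ _ _ (path_measure_le vu) (EFin \o phi) setT measurableT).
  by move=> U; rewrite lee_fin.
exact/measurable_EFinP.
Qed.

Lemma integral_path_measure_sum_ge v (u : int -> R) phi : (forall j, (`|v j| <= - u j)%R) ->
  measurable_fun setT phi -> (forall U, (0 <= phi U)%R) ->
  2%:E * \int[path_measure (fun=> 0%R)]_U (phi U)%:E <=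
  \int[path_measure v]_U (phi U)%:E + \int[path_measure u]_U (phi U)%:E.
Proof.
move=> vu mphi phi0.
have mphi' : measurable_fun setT (EFin \o phi) by exact/measurable_EFinP.
have phi0' U : setT U -> 0 <= (EFin \o phi) U by rewrite lee_fin.
rewrite -(@ge0_integral_measure_add _ _ _ _ _ setT measurableT (EFin \o phi))//.
rewrite -(@ge0_integral_mscale _ _ _ (path_measure (fun=> 0%R)) setT measurableT (NngNum (ler0n R 2)) (EFin \o phi))//.
apply: ge0_le_measure_integral => //.
- move=> A mA; have := path_measure_sum_ge vu mA.
  by rewrite -(measure_addE (path_measure v) (path_measure u)).
Qed.

(** The constant path already has weight 1. *)
Lemma path_measure_ge1 v : v 0%R = 0%R -> 1 <= path_measure v setT.
Proof.
move=> v0; rewrite path_measureT nneseriesS; last by move=> n; exact: level_mass_ge0.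
by rewrite level_mass0// leeDl// nneseries_ge0// => n _ _; exact: level_mass_ge0.
Qed.

(** The levels are compared one by one; level 0 has mass 1 for both potentials
    and does not contribute. *)
Lemma path_measure_gap k phi : (0 < k)%R -> (excess k <= 4^-1)%R ->
  measurable_fun setT phi -> (forall U, (0 <= phi U <= (n_jump U).+1%:R)%R) ->
  \int[path_measure (cone k)]_U (phi U)%:E <=
  \int[path_measure (fun=> 0%R)]_U (phi U)%:E + (9 * excess k)%:E.
Proof.
move=> k0 ek mphi phiN; have e0 := excess_ge0 k0.
have phi0 U : (0 <= phi U)%R by case/andP: (phiN U).
have cone0 : cone k 0 = 0%R by rewrite /cone mulr0 oppr0.
have conek j : (`|0 : R| <= - cone k j)%R by rewrite normr0 opprK mulr_ge0// ltW.
have L0 v n : 0 <= \int[level_measure v n]_U (phi U)%:E by apply: integral_ge0 => U _; rewrite lee_fin.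
have mphi' : measurable_fun setT (EFin \o phi) by exact/measurable_EFinP.
have phi0' U : 0 <= (EFin \o phi) U by rewrite lee_fin.
rewrite [X in X <= _](integral_path_measure (cone k) mphi' phi0').
rewrite [X in _ <= X + _](integral_path_measure (fun=> 0%R) mphi' phi0').
have gap n : \int[level_measure (cone k) n]_U (phi U)%:E + n.+1%:R%:E * level_mass (fun=> 0%R) n <=
    \int[level_measure (fun=> 0%R) n]_U (phi U)%:E + n.+1%:R%:E * level_mass (cone k) n.
  apply: (level_gap conek mphi phi0) => U Un; have /andP[_ /le_trans->//] := phiN U.
  by rewrite ler_nat ltnS.
rewrite [X in X <= _](nneseriesS (L0 (cone k))) [X in _ <= X + _](nneseriesS (L0 (fun=> 0%R))) -[leRHS]addeA; apply: leeD.
  have := gap 0%N; rewrite (level_mass0 cone0) (@level_mass0 R (fun=> 0%R) erefl) mule1.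
  by rewrite leeD2rE.
apply: (@le_trans _ _ (\sum_(0 <= n <oo) (\int[level_measure (fun=> 0%R) n.+1]_U (phi U)%:E +
    (9 * excess k / (2 ^ n.+1)%:R)%:E))).
  apply: lee_nneseries => // n _.
  rewrite -(@leeD2rE _ (n.+2%:R%:E * level_mass (fun=> 0%R) n.+1)); last by rewrite level_mass_flat.
  apply: le_trans (gap n.+1) _; rewrite -[leRHS]addeA; apply: leeD => //; rewrite addeC.
  exact: (level_mass_gap n k0 cone0 (cone_lip (ltW k0)) ek).
rewrite nneseriesD//; last by move=> n _ _; rewrite lee_fin divr_ge0// mulr_ge0.
by rewrite leeD2l// epsilon_trick0// mulr_ge0.
Qed.
End scaled_integrals.

(** * The Wasserstein bound *)

Section positive_negative_parts.
Context d (T : measurableType d) {R : realType}.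
Local Open Scope ereal_scope.

Definition above (f : T -> R) (c : R) (x : T) : R := Num.max (f x - c)%R 0%R.
Definition below (f : T -> R) (c : R) (x : T) : R := Num.max (c - f x)%R 0%R.

Lemma above_ge0 f c x : (0 <= above f c x)%R. Proof. by rewrite le_max lexx orbT. Qed.
Lemma below_ge0 f c x : (0 <= below f c x)%R. Proof. by rewrite le_max lexx orbT. Qed.

Lemma above_below_sum f c x : (above f c x + below f c x = `|f x - c|)%R.
Proof.
rewrite /above /below; case: (lerP 0 (f x - c)%R) => h.
  by rewrite ger0_norm// (@max_r _ _ (c - f x)%R) ?addr0//; lra.
by rewrite ltr0_norm// (@max_l _ _ (c - f x)%R) ?add0r ?opprB//; lra.
Qed.

Lemma measurable_above f c : measurable_fun setT f -> measurable_fun setT (above f c).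
Proof. by move=> mf; apply: measurable_maxr => //; exact: measurable_funB. Qed.

Lemma measurable_below f c : measurable_fun setT f -> measurable_fun setT (below f c).
Proof. by move=> mf; apply: measurable_maxr => //; exact: measurable_funB. Qed.

Lemma mean_split (m : probability T R) (f : T -> R) (c : R) : m.-integrable setT (EFin \o f) ->
  exists p q : R, [/\ \int[m]_x (above f c x)%:E = p%:E, \int[m]_x (below f c x)%:E = q%:E
    & \int[m]_x (f x)%:E = (c + p - q)%:E].
Proof.
move=> If.
have Ic : m.-integrable setT (EFin \o cst c) by exact: finite_measure_integrable_cst.
have Ig : m.-integrable setT (fun x => (f x - c)%:E).
  by apply: eq_integrable (integrableB measurableT If Ic).
have pE x : (above f c x)%:E = (fun x => (f x - c)%:E)^\+ x by rewrite funeposE -EFin_max.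
have qE x : (below f c x)%:E = (fun x => (f x - c)%:E)^\- x.
  by rewrite funenegE /below -EFinN opprB -EFin_max.
have fp : \int[m]_x (above f c x)%:E \is a fin_num.
  by under eq_integral do rewrite pE; apply: integrable_pos_fin_num.
have fq : \int[m]_x (below f c x)%:E \is a fin_num.
  by under eq_integral do rewrite qE; apply: integrable_neg_fin_num.
exists (fine (\int[m]_x (above f c x)%:E)), (fine (\int[m]_x (below f c x)%:E)).
rewrite !fineK//; split => //.
have := integralE m setT (fun x => (f x - c)%:E).
rewrite (_ : \int[m]_x (f x - c)%:E = \int[m]_x (f x)%:E - c%:E); last first.
  transitivity (\int[m]_x (f x)%:E - \int[m]_x cst c%:E x).
    exact: integralB_EFin measurableT If Ic.
  rewrite integral_cst//.
  by rewrite [X in _ * X](_ : _ = 1) ?mule1//; exact: probability_setT.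
have Ef : \int[m]_x (f x)%:E \is a fin_num by exact: integrable_fin_num.
rewrite -(eq_integral _ _ (fun x _ => pE x)) -(eq_integral _ _ (fun x _ => qE x)).
move: fp fq Ef; do 3 case: (\int[m]_x _) => //= ?.
move=> _ _ _; rewrite -!EFinB => -[H]; congr EFin; lra.
Qed.
End positive_negative_parts.

Section wasserstein_bound.
Context {R : realType}.
Local Open Scope ereal_scope.
Variables (v : int -> R) (k : R).
Hypotheses (v0 : v 0%R = 0%R) (k0 : (0 < k)%R) (vk : forall j, (`|v (j + 1) - v j| <= k)%R).
Variables (m m0 : probability (jump_pair R) R) (Z Z0 : R).
Hypotheses (Zgt0 : (0 < Z)%R) (Z0gt0 : (0 < Z0)%R).
Hypothesis mE : forall A, measurable A -> path_measure v A = Z%:E * m A.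
Hypothesis m0E : forall A, measurable A -> path_measure (fun=> 0%R) A = Z0%:E * m0 A.

(** f differs from its value at the empty pair by at most the number of up jumps,
    whose mean is at most B. *)
Lemma lip_spread u (n : probability (jump_pair R) R) (K B : R) f p q : (0 < K)%R ->
  (forall A, measurable A -> path_measure u A = K%:E * n A) ->
  \sum_(0 <= i <oo) i.+1%:R%:E * level_mass u i.+1 <= B%:E * path_measure u setT ->
  Lip1 f -> \int[n]_U (above f (f point) U)%:E = p%:E -> \int[n]_U (below f (f point) U)%:E = q%:E ->
  (p + q <= B)%R.
Proof.
move=> K0 nE mean lip hp hq; have [mf _] := lip.
have mabove := @measurable_above _ _ _ f (f point) mf.
have mbelow := @measurable_below _ _ _ f (f point) mf.
pose h U := (above f (f point) U + below f (f point) U)%R.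
have mh : measurable_fun setT h by exact: measurable_funD.
have h0 U : (0 <= h U)%R by rewrite addr_ge0 ?above_ge0 ?below_ge0.
have := @integral_path_measure_le R u h mh h0.
move=> /(_ (fun U => _)) H.
have {}H : \int[path_measure u]_U (h U)%:E <= \sum_(0 <= i <oo) i.+1%:R%:E * level_mass u i.+1.
  by apply: H => U; rewrite /h above_below_sum; exact: lip_le_n_jump.
have := le_trans H mean; rewrite nE// probability_setT mule1 (integral_scaled (ltW K0) nE)//.
rewrite (_ : \int[n]_U (h U)%:E = p%:E + q%:E); last first.
  rewrite -hp -hq -ge0_integralD//; last 4 first.
  - by move=> U _; rewrite lee_fin above_ge0.
  - exact/measurable_EFinP.
  - by move=> U _; rewrite lee_fin below_ge0.
  - exact/measurable_EFinP.
by rewrite -!EFinM lee_fin mulrC ler_pM2r.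
Qed.

Lemma flat_spread f p q : Lip1 f ->
  \int[m0]_U (above f (f point) U)%:E = p%:E -> \int[m0]_U (below f (f point) U)%:E = q%:E ->
  (p + q <= 1)%R.
Proof. by apply: lip_spread m0E _ => //; rewrite mul1e; exact: mean_jumps_flat. Qed.

Lemma bridge_spread f p q : Lip1 f ->
  \int[m]_U (above f (f point) U)%:E = p%:E -> \int[m]_U (below f (f point) U)%:E = q%:E ->
  (p + q <= 1 + excess k)%R.
Proof. by apply: lip_spread mE _ => //; exact: mean_jumps_le. Qed.

(** If excess k > 1/4, the spreads 1 + excess k and 1 of f under the two
    probabilities suffice.  Otherwise f is compared with its mean c under m0,
    for which the integrals of the two parts of f - c agree. *)
Lemma lip_mean_gap f : Lip1 f -> m.-integrable setT (EFin \o f) -> m0.-integrable setT (EFin \o f) ->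
  `|\int[m]_U (f U)%:E - \int[m0]_U (f U)%:E| <= (9 * excess k)%:E.
Proof.
move=> lip If If0; have [mf _] := lip; have e0 := excess_ge0 k0.
have [p [q [pE qE fE]]] := mean_split (f point) If.
have [p0 [q0 [p0E q0E f0E]]] := mean_split (f point) If0.
have pq0 := flat_spread lip p0E q0E.
have ge0 (n : probability (jump_pair R) R) (x : R) g : (forall U, (0 <= g U)%R) -> \int[n]_U (g U)%:E = x%:E -> (0 <= x)%R.
  by move=> g0 gx; rewrite -lee_fin -gx; apply: integral_ge0 => U _; rewrite lee_fin.
have p_0 : (0 <= p)%R := ge0 m p _ (above_ge0 f (f point)) pE.
have q_0 : (0 <= q)%R := ge0 m q _ (below_ge0 f (f point)) qE.
have p0_0 : (0 <= p0)%R := ge0 m0 p0 _ (above_ge0 f (f point)) p0E.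
have q0_0 : (0 <= q0)%R := ge0 m0 q0 _ (below_ge0 f (f point)) q0E.
have [ek|ek] := lerP (excess k) 4^-1; last first.
  have pq := bridge_spread lip pE qE.
  by rewrite fE f0E -EFinB abse_EFin lee_fin ler_norml; apply/andP; split; lra.
set c := (f point + p0 - q0)%R in f0E.
have [P [N [PE NE fE']]] := mean_split c If.
have [P0 [N0 [P0E N0E f0E']]] := mean_split c If0.
(* c is the mean of f under m0. *)
have PN0 : P0 = N0 by move: f0E'; rewrite f0E => -[]; lra.
rewrite fE' f0E -EFinB abse_EFin lee_fin.
have ma := @measurable_above _ _ _ f c mf; have mb := @measurable_below _ _ _ f c mf.
have a0 := above_ge0 f c; have b0 := below_ge0 f c.
have cone_v : forall j, (`|v j| <= - cone k j)%R := norm_le_cone v0 vk.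
(* Once the integrals are abstracted, what remains is arithmetic in the
   extended reals. *)
pose up := above f c; pose down := below f c.
have [I IE] : exists I : (int -> R) -> (jump_pair R -> R) -> \bar R,
    forall u g, I u g = \int[path_measure u]_U (g U)%:E by eexists.
have vP : I v up = (Z * P)%:E by rewrite IE (integral_scaled (ltW Zgt0) mE ma a0) PE -EFinM.
have vN : I v down = (Z * N)%:E by rewrite IE (integral_scaled (ltW Zgt0) mE mb b0) NE -EFinM.
have wP : I (fun=> 0%R) up = (Z0 * P0)%:E.
  by rewrite IE (integral_scaled (ltW Z0gt0) m0E ma a0) P0E -EFinM.
have wN : I (fun=> 0%R) down = (Z0 * N0)%:E.
  by rewrite IE (integral_scaled (ltW Z0gt0) m0E mb b0) N0E -EFinM.
have sumE u : I u (fun U => up U + down U)%R = I u up + I u down.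
  rewrite !IE -ge0_integralD//.
  - by move=> U _; rewrite lee_fin.
  - exact/measurable_EFinP.
  - by move=> U _; rewrite lee_fin.
  - exact/measurable_EFinP.
have absN U : (0 <= above f c U + below f c U <= (n_jump U).+1%:R)%R.
  rewrite addr_ge0//= above_below_sum -natr1.
  rewrite (_ : f U - c = (f U - f point) - (p0 - q0))%R; last by rewrite /c; ring.
  rewrite (le_trans (ler_normB _ _))// lerD ?lip_le_n_jump//.
  by rewrite ler_norml; apply/andP; split; lra.
have A0 : 0 <= I (cone k) up by rewrite IE; apply: integral_ge0 => U _; rewrite lee_fin.
have B0 : 0 <= I (cone k) down by rewrite IE; apply: integral_ge0 => U _; rewrite lee_fin.
have Z1 : (1 <= Z)%R.
  by have := path_measure_ge1 v0; rewrite mE// probability_setT mule1 lee_fin.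
have : I (cone k) (fun U => up U + down U)%R <= I (fun=> 0%R) (fun U => up U + down U)%R + (9 * excess k)%:E.
  by rewrite !IE; exact: (path_measure_gap k0 ek (measurable_funD ma mb) absN).
have : 2%:E * I (fun=> 0%R) down <= I v down + I (cone k) down.
  by rewrite !IE; exact: integral_path_measure_sum_ge.
have : 2%:E * I (fun=> 0%R) up <= I v up + I (cone k) up.
  by rewrite !IE; exact: integral_path_measure_sum_ge.
have : I v down <= I (cone k) down by rewrite !IE; exact: integral_path_measure_mono.
have : I v up <= I (cone k) up by rewrite !IE; exact: integral_path_measure_mono.
rewrite !sumE vP vN wP wN -PN0; move: A0 B0.
case: (I (cone k) up) => [A| |]//; case: (I (cone k) down) => [B| |]//.
rewrite -!EFinM -!EFinD !lee_fin => _ _ Pv Nv P2 N2 gap.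
have H : (`|Z * (P - N)| <= 9 * excess k)%R by rewrite ler_norml; apply/andP; split; lra.
rewrite (_ : c + P - N - c = P - N)%R; last by lra.
apply: le_trans H; rewrite normrM ler_peMl//.
by rewrite ger0_norm// (le_trans ler01).
Qed.
End wasserstein_bound.

Theorem proposition3p26 (R : realType) (a b : int -> R)
    (ha : forall j, 0 < a j) (hb : forall j, 0 < b j)
    (hab : forall j, a j * b (j + 1) = 1)
    (kappa : R) (hkappa : 0 < kappa)
    (hXi : forall j, `|(a (j + 1) + b (j + 1)) - (a j + b j)| <= kappa)
    (walk_ab walk_11 : probability (cadlag R) R)
    (hwalk_ab : is_walk_law a b walk_ab)
    (hwalk_11 : is_walk_law (fun=> 1) (fun=> 1) walk_11)
    (bridge_ab bridge_11 : probability (jump_pair R) R)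
    (hbridge_ab : is_bridge_law walk_ab bridge_ab)
    (hbridge_11 : is_bridge_law walk_11 bridge_11) :
  (dW1 bridge_ab bridge_11 <=
     (9 * (2 * ((expR kappa - 1 - kappa) / kappa ^+ 2) - 1))%:E)%E.
Proof.
have one_gt0 (j : int) : (0 < (1 : R)) by [].
have [Z Z0 mE] := bridge_path_measure ha hb hab hwalk_ab hbridge_ab.
have [Z' Z'0 mE'] := bridge_path_measure one_gt0 one_gt0 (fun=> mulr1 1) hwalk_11 hbridge_11.
have flat : rate_excess (fun=> 1) (fun=> 1) = (fun=> 0) :> (int -> R).
  by apply/funext => j; rewrite /rate_excess subrr.
rewrite flat in mE'; apply: ge_ereal_sup => _ [f [lip If If'] <-].
apply: lip_mean_gap mE mE' f lip If If' => //.
- by rewrite /rate_excess subrr.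
- by move=> j; rewrite /rate_excess opprB addrA subrK.
Qed.
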